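(* Let $f$ be distributionally integrable over $[a,b]$ and let $\psi$ be any smooth ($C^\infty$) function defined in $\mathbb R$. Then $f\psi$ is distributionally integrable over $[a,b]$ and $$(\mathfrak{dist})\int_a^bf(x)\psi(x)\,dx=F(b)\psi(b)-(\mathfrak{dist})\int_a^bF(x)\psi'(x)\,dx,$$ where $F$ is the indefinite integral $F(x)=(\mathfrak{dist})\int_a^xf(t)\,dt$.
   Context: Distributions and functions are real. Notation: $\overline{\mathbb R}=\mathbb R\cup\{-\infty,\infty\}$; $\mathcal E'[a,b]$ is the space of distributions on $\mathbb R$ with support contained in $[a,b]$; $\langle \mathsf g(x+ty),\phi(y)\rangle:=|t|^{-1}\langle \mathsf g(y),\phi((y-x)/t)\rangle$ for $t\ne0$. Point values. For $\mathsf g\in\mathcal D'(\mathbb R)$, the distributional (Łojasiewicz) point value $\mathsf g(x_0)$ exists and equals $\gamma\in\mathbb R$ if $\lim_{\varepsilon\to0}\langle \mathsf g(x_0+\varepsilon y),\phi(y)\rangle=\gamma\int_{-\infty}^\infty\phi(y)\,dy$ for every $\phi\in\mathcal D(\mathbb R)$. A Łojasiewicz distribution is one having a point value at every point of $\mathbb R$. Test classes. $\mathcal T_0$: functions $\phi\in C^\infty(\mathbb R)$, $\phi\ge0$, $\int\phi=1$, such that for some $\alpha<-1$, $\phi^{(m)}(x)=O(|x|^{\alpha-m})$ as $|x|\to\infty$ for all $m\ge0$. $\mathcal T_1$: those $\phi\in\mathcal T_0$ with $x\phi'(x)\le0$ for all $x$. For $\mathsf g\in\mathcal E'(\mathbb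 R)$, $\phi\in\mathcal T_0$: $\mathsf g^{+}_{\phi,0}(x)=\limsup_{t\to0^+}\langle \mathsf g(x+ty),\phi(y)\rangle$ and $\mathsf g^{-}_{\phi,0}(x)=\liminf_{t\to0^+}\langle \mathsf g(x+ty),\phi(y)\rangle$. Integral. Let $f:[a,b]\to\overline{\mathbb R}$. A major distributional pair $(\mathsf u,\mathsf U)$ for $f$ consists of $\mathsf u\in\mathcal E'[a,b]$ and a Łojasiewicz distribution $\mathsf U$ with $\mathsf U'=\mathsf u$, $\mathsf U(a)=0$, such that there exist a countable set $E$ and a Lebesgue null set $Z$ with $\mathsf u^-_{\phi,0}(x)\ge f(x)$ for all $x\in[a,b]\setminus Z$, $\phi\in\mathcal T_0$, and $\mathsf u^-_{\phi,0}(x)>-\infty$ for all $x\in[a,b]\setminus E$, $\phi\in\mathcal T_1$. A minor distributional pair $(\mathsf v,\mathsf V)$ for $f$ consists of $\mathsf v\in\mathcal E'[a,b]$ and a Łojasiewicz distribution $\mathsf V$ with $\mathsf V'=\mathsf v$, $\mathsf V(a)=0$, such that there exist a countable set $E$ and a null set $Z$ with $\mathsf v^+_{\phi,0}(x)\le f(x)$ for all $x\in[a,b]\setminus Z$, $\phi\in\mathcal T_0$, and $\mathsf v^+_{\phi,0}(x)<\infty$ for all $x\in[a,b]\setminus E$, $\phi\in\mathcal T_1$. The function $f$ is distributionally integrable over $[a,b]$ if it has both major and minor pairs and $\sup\mathsf V(b)=\inf\mathsf U(b)$ (sup over minor pairs, inf over major pairs); the common value is $(\mathfrak{dist})\int_a^bf(x)\,dx$.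 A function distributionally integrable over $[a,b]$ is finite almost everywhere and is distributionally integrable over each subinterval; integrability and the integral do not change if the function is modified on a null set. *)

(* Defs.v *)
From HB Require Import structures.
From mathcomp Require Import all_boot all_order all_algebra.
From mathcomp Require Import all_classical all_reals all_analysis.

Set Implicit Arguments.
Unset Strict Implicit.
Unset Printing Implicit Defensive.

Import Order.TTheory GRing.Theory Num.Theory.
Import numFieldNormedType.Exports.

Local Open Scope classical_set_scope.
Local Open Scope ring_scope.

Section TestFunctions.
Context {R : realType}.
Implicit Types phi : R -> R.

Definition smooth phi : Prop :=
  forall (n : nat) (x : R), derivable (derive1n n phi) x 1.

Definition tsupport phi : set R := closure [set x | phi x != 0].

Definition test_function phi : Prop := smooth phi /\ compact (tsupport phi).

(* phi^(m)(x) = O(|x|^(alpha - m)) as |x| -> oo, with alpha uniform in m. *)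
Definition T0 phi : Prop :=
  [/\ smooth phi,
      forall x, 0 <= phi x,
      (\int[lebesgue_measure]_x (phi x)%:E = 1)%E &
      exists2 alpha : R, alpha < -1 &
        forall m : nat, exists C A : R, forall x : R, A <= `|x| ->
          `|derive1n m phi x| <= C * `|x| `^ (alpha - m%:R)].

Definition T1 phi : Prop := T0 phi /\ forall x, x * derive1 phi x <= 0.

End TestFunctions.

Section Distributions.
Context {R : realType}.
Implicit Types (g u U : (R -> R) -> R) (phi chi : R -> R) (K : set R).

(* A distribution is carried by a functional on all functions R -> R; only its
   values on test functions are meaningful. *)
Definition is_distribution g : Prop :=
  (forall (c : R) phi chi, test_function phi -> test_function chi ->
     g (fun x => c * phi x + chi x) = c * g phi + g chi) /\
  (forall K, compact K -> exists (C : R) (m : nat),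
     forall phi (M : R), test_function phi -> tsupport phi `<=` K ->
       (forall (i : nat) (x : R), (i <= m)%N -> `|derive1n i phi x| <= M) ->
       `|g phi| <= C * M).

(* supp g `<=` K, for K closed: g vanishes on the open set ~` K. *)
Definition supported_in g K : Prop :=
  forall phi, test_function phi -> tsupport phi `<=` ~` K -> g phi = 0.

(* The space E'[a, b]. *)
Definition Eprime (a b : R) g : Prop := is_distribution g /\ supported_in g `[a, b].

(* <g, phi> for g of compact support and phi smooth: the common value of
   g (chi * phi) over all cutoffs chi equal to 1 near the support of g. *)
Definition pairing g phi : R :=
  xget 0 [set r | exists K chi O,
    [/\ compact K /\ supported_in g K,
        test_function chi,
        open O /\ K `<=` O,
        forall y, O y -> chi y = 1 &
        r = g (fun y => chi y * phi y)]].

Definition is_derivative U u : Prop :=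
  forall phi, test_function phi -> u phi = - U (derive1 phi).

Definition point_value g (x0 gamma : R) : Prop :=
  forall phi, test_function phi ->
    `|e|^-1 * g (fun y => phi ((y - x0) / e)) @[e --> 0^'] -->
      gamma * \int[lebesgue_measure]_y phi y.

Definition Lojasiewicz g : Prop :=
  is_distribution g /\ forall x, exists gamma, point_value g x gamma.

(* <g(x + t y), phi(y)> for g of compact support. *)
Definition scaled_pairing g phi (x t : R) : R :=
  `|t|^-1 * pairing g (fun y => phi ((y - x) / t)).

Definition upper_value g phi (x : R) : \bar R :=
  limf_esup (fun t => (scaled_pairing g phi x t)%:E) 0^'+.

Definition lower_value g phi (x : R) : \bar R :=
  limf_einf (fun t => (scaled_pairing g phi x t)%:E) 0^'+.

End Distributions.

Section Integral.
Context {R : realType}.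
Implicit Types (a b : R) (f : R -> \bar R) (u U v V : (R -> R) -> R).

(* A function [a, b] -> \bar R is represented by f : R -> \bar R; its values
   outside of [a, b] are never used. *)
Definition major_pair a b f u U : Prop :=
  [/\ Eprime a b u, Lojasiewicz U, is_derivative U u, point_value U a 0 &
      exists E Z : set R,
        [/\ countable E, lebesgue_measure.-negligible Z,
            forall x phi, (`[a, b] `\` Z) x -> T0 phi ->
              (f x <= lower_value u phi x)%E &
            forall x phi, (`[a, b] `\` E) x -> T1 phi ->
              (-oo < lower_value u phi x)%E]].

Definition minor_pair a b f v V : Prop :=
  [/\ Eprime a b v, Lojasiewicz V, is_derivative V v, point_value V a 0 &
      exists E Z : set R,
        [/\ countable E, lebesgue_measure.-negligible Z,
            forall x phi, (`[a, b] `\` Z) x -> T0 phi ->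
              (upper_value v phi x <= f x)%E &
            forall x phi, (`[a, b] `\` E) x -> T1 phi ->
              (upper_value v phi x < +oo)%E]].

Definition major_values a b f : set \bar R :=
  [set x%:E | x in
    [set x : R | exists u U, major_pair a b f u U /\ point_value U b x]].

Definition minor_values a b f : set \bar R :=
  [set x%:E | x in
    [set x : R | exists v V, minor_pair a b f v V /\ point_value V b x]].

(* When both sets of values are nonempty, a common value of the supremum and
   the infimum is necessarily finite. *)
Definition dist_integrable a b f : Prop :=
  [/\ exists u U, major_pair a b f u U,
      exists v V, minor_pair a b f v V &
      ereal_sup (minor_values a b f) = ereal_inf (major_values a b f)].

Definition dist_int a b f : R := fine (ereal_inf (major_values a b f)).

End Integral.

(* Main.v *)
Require Import Defs.
From HB Require Import structures.
From mathcomp Require Import all_boot all_order all_algebra.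
From mathcomp Require Import all_classical all_reals all_analysis.
From mathcomp Require Import measurable_realfun ring lra.

Import Order.TTheory GRing.Theory Num.Theory.
Import numFieldNormedType.Exports.

Local Open Scope classical_set_scope.
Local Open Scope ring_scope.

(* A major pair (u, U) is determined by u, and U(b) is the mass of u. If w majorizes 0 and u
   majorizes f, then u + k w majorizes f for all k >= 0; as f is integrable, the masses of its
   majorants are bounded below, so w has nonnegative mass. This replaces a monotonicity theorem. An
   integrable f is finite almost everywhere: at points where all mean values of u tend to +oo the
   primitive U increases infinitely fast, which a covering by short windows allows on a null set only.

   Since (psi - psi(x)) u has point value 0 at x, the mean values of psi u behave at x like psi(x)
   times those of u. Hence if u and w majorize f and -f, then (M + psi) u + M w and M u + (M + psi) w
   majorize f psi and - f psi, for M >= |psi|. The primitives U and W of u and w, truncated at x, bound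
   the indefinite integral: - W(x) <= F(x) <= U(x). So U and W, cut off at b, majorize F and - F, and
   the same combinations, with psi' in place of psi, majorize F psi' and - F psi'. Integration by
   parts of distributions computes all the masses, and they match up to a multiple of the gap
   U(b) + W(b), which is arbitrarily small. *)

(** * Smooth functions and test functions *)

(** Products, primitives and truncations need estimates uniform in the test function, whereas a
    point value is a statement about each test function separately. A gliding hump argument at a
    single point supplies this uniformity, in place of a local representation as a derivative of a
    continuous function. It also carries point values from compactly supported test functions over
    to [T0], by summation over dyadic annuli. Truncation at [c] is multiplication by a discontinuous
    function; it is a limit of smooth cutoffs, which exists by the same uniform estimate, and the
    value of the primitive at [c] is subtracted beforehand so that the cut leaves a point value
    there. Only nonnegative combinations of majorants are majorants, while [psi] and its derivative
    may change sign: hence the shift by [M] and the joint use of [u] and [w]. The primitive cut off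
    at [b] jumps there and has no point value in general, but bounded mean values are enough for the
    next primitive to have one. *)

Section SmoothCalculus.
Context {R : realType}.
Implicit Types (f g : R -> R) (x y c d : R) (n m i : nat).

(** Coinduction: by induction on the order, every iterated derivative stays in [S]. Smoothness thus
    reduces to one derivative and a class stable under derivation, with no formula for higher
    derivatives. *)
Lemma smooth_coind (S : set (R -> R)) :
  (forall f, S f -> (forall x, derivable f x 1) /\ S (derive1 f)) ->
  forall f, S f -> smooth f.
Proof.
move=> HS f Sf n; suff : S (derive1n n f) by move=> /HS[].
by elim: n => [//|n IH]; rewrite derive1nS; apply HS.
Qed.

Lemma smooth_derivable f x : smooth f -> derivable f x 1.
Proof. by move=> /(_ 0%N). Qed.

Lemma smooth_derive1 f : smooth f -> smooth (derive1 f).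
Proof. by move=> sf n x; rewrite -derive1Sn; exact: sf. Qed.

Lemma smooth_derive1n n f : smooth f -> smooth (derive1n n f).
Proof. by move=> sf; elim: n => [//|n IH]; rewrite derive1nS; exact: smooth_derive1. Qed.

Lemma smooth_is_derive f x : smooth f -> is_derive x 1 f (derive1 f x).
Proof. by move=> sf; rewrite derive1E; apply: derivableP; exact: smooth_derivable. Qed.

Lemma smooth_continuous f : smooth f -> continuous f.
Proof.
by move=> sf x; apply: differentiable_continuous; apply/derivable1_diffP; exact: smooth_derivable.
Qed.

Lemma derive1_eq f (df : R -> R) :
  (forall x, is_derive x 1 f (df x)) -> derive1 f = df.
Proof. by move=> H; apply/funext => x; rewrite derive1E; apply: derive_val. Qed.

Lemma smooth_cst c : smooth (fun=> c).
Proof.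
apply: (@smooth_coind [set f | exists c, f = fun=> c]); last by exists c.
move=> _ [k ->]; split; first by move=> x; exact: derivable_cst.
by exists 0; apply: derive1_eq => x; exact: is_derive_cst.
Qed.

Lemma derive1_const c : derive1 (fun=> c : R) = fun=> 0 :> R.
Proof. by apply: derive1_eq => x; exact: is_derive_cst. Qed.

Lemma derive1n_cst0 n : derive1n n (fun=> 0 : R) = fun=> 0 :> R.
Proof. by elim: n => [//|n IH]; rewrite derive1Sn derive1_const. Qed.

Lemma derive1n_const n c x : derive1n n.+1 (fun=> c : R) x = 0.
Proof. by rewrite derive1Sn derive1_const derive1n_cst0. Qed.

Lemma derive1D f g : smooth f -> smooth g ->
  derive1 (fun x => f x + g x) = fun x => derive1 f x + derive1 g x.
Proof.
move=> sf sg; apply: derive1_eq => x.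
by have := is_deriveD (smooth_is_derive f x sf) (smooth_is_derive g x sg).
Qed.

Lemma derivableD' f g : smooth f -> smooth g -> forall x, derivable (fun x => f x + g x) x 1.
Proof. by move=> sf sg x; apply: (@derivableD _ _ _ f g); exact: smooth_derivable. Qed.

Lemma smoothD f g : smooth f -> smooth g -> smooth (fun x => f x + g x).
Proof.
move=> sf sg.
apply: (@smooth_coind [set h | exists f g, [/\ smooth f, smooth g & h = fun x => f x + g x]]); last by exists f, g.
move=> _ [u [v [su sv ->]]]; split; first exact: derivableD'.
exists (derive1 u), (derive1 v); split; [exact: smooth_derive1|exact: smooth_derive1|].
exact: derive1D.
Qed.

Lemma derive1M f g : smooth f -> smooth g ->
  derive1 (fun x => f x * g x) = fun x => derive1 f x * g x + f x * derive1 g x.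
Proof.
move=> sf sg; apply: derive1_eq => x.
have := is_deriveM (smooth_is_derive f x sf) (smooth_is_derive g x sg).
by move/is_derive_eq; apply; rewrite addrC [X in X + _]mulrC.
Qed.

(** The class to which [smooth_coind] is applied for products: the product rule leads out of the
    products, but not out of their finite sums. *)
Inductive prodsum : (R -> R) -> Prop :=
| prodsum1 f g : smooth f -> smooth g -> prodsum (fun x => f x * g x)
| prodsumD f g : prodsum f -> prodsum g -> prodsum (fun x => f x + g x).

Lemma smoothM f g : smooth f -> smooth g -> smooth (fun x => f x * g x).
Proof.
move=> sf sg; apply: (@smooth_coind prodsum); last exact: prodsum1.
move=> h; elim=> {h} [u v su sv|u v _ [du pu] _ [dv pv]]; split.
- by move=> x; apply: (@derivableM _ _ u v); exact: smooth_derivable.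
- rewrite (derive1M u v su sv); apply: prodsumD; apply: prodsum1; [exact: smooth_derive1|exact: sv|exact: su|exact: smooth_derive1].
- by move=> x; apply: (@derivableD _ _ _ u v).
- suff -> : derive1 (fun x => u x + v x) = fun x => derive1 u x + derive1 v x by exact: prodsumD.
  apply: derive1_eq => x.
  by have := is_deriveD (derivableP (du x)) (derivableP (dv x)); rewrite !derive1E.
Qed.

Lemma smoothZ c f : smooth f -> smooth (fun x => c * f x).
Proof. by move=> sf; exact: (smoothM (fun=> c) f (smooth_cst c) sf). Qed.

Lemma derive1Z c f : smooth f -> derive1 (fun x => c * f x) = fun x => c * derive1 f x.
Proof.
move=> sf; rewrite (derive1M (fun=> c) f (smooth_cst c) sf).
by apply/funext => x; rewrite derive1_const mul0r add0r.
Qed.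

Lemma smoothN f : smooth f -> smooth (fun x => - f x).
Proof. by move=> /(smoothZ (-1)); under eq_fun do rewrite mulN1r. Qed.

Lemma smoothB f g : smooth f -> smooth g -> smooth (fun x => f x - g x).
Proof. by move=> sf /smoothN; exact: smoothD. Qed.

Lemma derive1B f g : smooth f -> smooth g ->
  derive1 (fun x => f x - g x) = fun x => derive1 f x - derive1 g x.
Proof.
move=> sf sg; apply: derive1_eq => x.
by have := is_deriveB (smooth_is_derive f x sf) (smooth_is_derive g x sg).
Qed.

Lemma is_derive_affine f c d x : smooth f ->
  is_derive x 1 (fun x => f (c * x + d)) (c * derive1 f (c * x + d)).
Proof.
move=> sf.
have H : is_derive x 1 (fun x : R => c * x + d) c.
  have := is_deriveD (is_deriveZ c (is_derive_id x 1)) (is_derive_cst d x (1:R)).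
  by move/is_derive_eq; apply; rewrite addr0 /GRing.scale/= mulr1.
have := @is_derive1_comp _ f (fun x : R => c * x + d) x _ _ (smooth_is_derive f (c * x + d) sf) H.
by move/is_derive_eq; apply; rewrite mulrC.
Qed.

Lemma derive1_affine f c d : smooth f ->
  derive1 (fun x => f (c * x + d)) = fun x => c * derive1 f (c * x + d).
Proof. by move=> sf; apply: derive1_eq => x; exact: is_derive_affine. Qed.

Lemma smooth_affine f c d : smooth f -> smooth (fun x => f (c * x + d)).
Proof.
move=> sf.
(* The chain rule produces a constant factor, so the class must allow one. *)
apply: (@smooth_coind [set h | exists k u, smooth u /\ h = fun x => k * u (c * x + d)]); last first.
  by exists 1, f; split => //; apply/funext => x; rewrite mul1r.
move=> _ [k [u [su ->]]].
have H x : is_derive x 1 (fun x => k * u (c * x + d)) (k * (c * derive1 u (c * x + d))).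
  exact: (is_deriveZ k (is_derive_affine u c d x su)).
split; first by move=> x; have [] := H x.
exists (k * c), (derive1 u); split; first exact: smooth_derive1.
by rewrite (derive1_eq _ _ H); apply/funext => x; rewrite mulrA.
Qed.

Lemma smooth_id : smooth (fun x => x : R).
Proof.
apply: (@smooth_coind ([set id] `|` [set f | smooth f])); last by left.
move=> h [->|/= sh]; split.
- by move=> x; exact: derivable_id.
- right => /=; rewrite (_ : derive1 id = fun=> 1); first exact: smooth_cst.
  by apply: derive1_eq => x; exact: is_derive_id.
- by move=> x; exact: smooth_derivable.
- by right; exact: smooth_derive1.
Qed.

Lemma derive1_idfun : derive1 (fun x => x : R) = fun=> 1 :> R.
Proof. by apply: derive1_eq => x; exact: is_derive_id. Qed.

Lemma derive1nD n f g : smooth f -> smooth g ->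
  derive1n n (fun x => f x + g x) = fun x => derive1n n f x + derive1n n g x.
Proof.
elim: n f g => [//|n IH] f g sf sg; rewrite !derive1Sn (derive1D f g sf sg).
by rewrite (IH _ _ (smooth_derive1 f sf) (smooth_derive1 g sg)).
Qed.

Lemma derive1nB n f g : smooth f -> smooth g ->
  derive1n n (fun x => f x - g x) = fun x => derive1n n f x - derive1n n g x.
Proof.
elim: n f g => [//|n IH] f g sf sg; rewrite !derive1Sn (derive1B f g sf sg).
by rewrite (IH _ _ (smooth_derive1 f sf) (smooth_derive1 g sg)).
Qed.

Lemma derive1nZ n c f : smooth f ->
  derive1n n (fun x => c * f x) = fun x => c * derive1n n f x.
Proof.
elim: n f => [//|n IH] f sf; rewrite !derive1Sn (derive1Z c f sf).
by rewrite (IH _ (smooth_derive1 f sf)).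
Qed.

Lemma derive1n_affine n f c d : smooth f ->
  derive1n n (fun x => f (c * x + d)) = fun x => c ^+ n * derive1n n f (c * x + d).
Proof.
elim: n f => [|n IH] f sf; first by apply/funext => x; rewrite expr0 mul1r.
have sf' := smooth_derive1 f sf.
rewrite !derive1Sn (derive1_affine f c d sf) (derive1nZ n c _ (smooth_affine _ c d sf')) (IH _ sf').
by apply/funext => x; rewrite exprS mulrA.
Qed.

Lemma near_derive1n n f g x : (\forall y \near x, f y = g y) ->
  \forall y \near x, derive1n n f y = derive1n n g y.
Proof.
move=> fg; elim: n => [//|n IH]; rewrite !derive1nS.
have := near_join IH; apply: filterS => y Hy.
rewrite !derive1E; apply: near_eq_derive => //.
Qed.

(* The weight [r ^- i] on the [i]-th derivative makes the bound scale invariant. *)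
Lemma derive1nM_bound n f g x A B r : smooth f -> smooth g -> 0 < r -> 0 <= A -> 0 <= B ->
  (forall i, (i <= n)%N -> `|derive1n i f x| <= A / r ^+ i) ->
  (forall i, (i <= n)%N -> `|derive1n i g x| <= B / r ^+ i) ->
  `|derive1n n (fun y => f y * g y) x| <= 2 ^+ n * A * B / r ^+ n.
Proof.
move=> + + r0.
elim: n f g A B => [|n IH] f g A B sf sg A0 B0 hf hg.
  rewrite derive1n0 normrM expr0 mul1r divr1.
  by apply: ler_pM => //; [have := hf 0%N|have := hg 0%N]; rewrite expr0 divr1; apply.
have sf' := smooth_derive1 _ sf; have sg' := smooth_derive1 _ sg.
rewrite derive1Sn (derive1M f g sf sg) (derive1nD n _ _ (smoothM _ _ sf' sg) (smoothM _ _ sf sg')).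
apply: (le_trans (ler_normD _ _)).
have H1 : `|derive1n n (fun y => derive1 f y * g y) x| <= 2 ^+ n * (A / r) * B / r ^+ n.
  apply: IH => //; first by rewrite divr_ge0// ltW.
    by move=> i ni; rewrite -derive1Sn; have := hf i.+1 ni; rewrite exprS invfM mulrA.
  by move=> i ni; apply: hg; rewrite ltnW.
have H2 : `|derive1n n (fun y => f y * derive1 g y) x| <= 2 ^+ n * A * (B / r) / r ^+ n.
  apply: IH => //; first by rewrite divr_ge0// ltW.
    by move=> i ni; apply: hf; rewrite ltnW.
  by move=> i ni; rewrite -derive1Sn; have := hg i.+1 ni; rewrite exprS invfM mulrA.
apply: (le_trans (lerD H1 H2)); rewrite le_eqVlt; apply/orP; left; apply/eqP.
have rn : r != 0 by rewrite gt_eqF.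
by rewrite !exprS; field; rewrite rn expf_neq0.
Qed.

End SmoothCalculus.

(** * A smooth bump *)

Section Bump.
Context {R : realType}.
Implicit Types (f g : R -> R) (x y c d : R) (n m i k : nat).

Lemma is_derive_eps f x d :
  (forall e, 0 < e -> exists2 r, 0 < r &
     forall h, `|h| < r -> `|f (x + h) - f x - h * d| <= e * `|h|) ->
  is_derive x 1 f d.
Proof.
move=> H.
have L : (fun h => h^-1 *: ((f \o shift x) (h *: 1) - f x)) @ 0^' --> d.
  apply/cvgrPdist_le => e e0; have [r r0 Hr] := H e e0.
  near=> h.
  have h0 : h != 0 by near: h; exact: nbhs_dnbhs_neq.
  have hr : `|h| < r by near: h; apply: dnbhs0_lt.
  have -> : (f \o shift x) (h *: 1) = f (x + h) by rewrite /= /GRing.scale/= mulr1 addrC.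
  have := Hr h hr; rewrite /GRing.scale/=; set A := f (x + h) => HA.
  rewrite -(@ler_pM2r _ `|h|) ?normr_gt0// -normrM.
  by rewrite (_ : _ * h = - (A - f x - h * d)) ?normrN//; field.
by split; [exact: cvgP L|exact: cvg_lim L].
Unshelve. all: by end_near. Qed.

(** The classical flat functions x^-k exp(-1/x). The index makes the family stable under derivation
    up to linear combinations: the derivative at index [k] involves the indices k + 1 and k + 2. *)
Definition flat k x : R := if 0 < x then x^-1 ^+ k * expR (- x^-1) else 0.

Lemma flat_ge0 k x : 0 <= flat k x.
Proof.
by rewrite /flat; case: ifP => // x0; rewrite mulr_ge0 ?expR_ge0// exprn_ge0// invr_ge0 ltW.
Qed.

(** With z = 1/x this is exp z >= z^(k+1) / (k+1)!, one term of the exponential series. *)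
Lemma flat_le k x : 0 <= x -> flat k x <= k.+1`!%:R * x.
Proof.
rewrite le_eqVlt => /predU1P[<-|x0]; first by rewrite /flat ltxx mulr0.
rewrite /flat x0 expRN.
have y0 : 0 < x^-1 by rewrite invr_gt0.
rewrite ler_pdivrMr ?expR_gt0//.
have := expR_ge1Dxn k (ltW y0).
set z := x^-1 in y0 *; have -> : x = z^-1 by rewrite invrK.
move=> H; have zn : z != 0 by rewrite gt_eqF.
have : z ^+ k.+1 / k.+1`!%:R <= expR z by apply: le_trans H; rewrite lerDr.
rewrite ler_pdivrMr ?ltr0n ?fact_gt0// => {}H.
rewrite -mulrA [z^-1 * _]mulrC mulrA ler_pdivlMr//.
by rewrite -exprSr (le_trans H)// mulrC.
Qed.

Lemma is_derive_flat k x :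
  is_derive x 1 (flat k) (flat k.+2 x - k%:R * flat k.+1 x).
Proof.
have [x0|x0|->] := ltgtP x 0.
- rewrite /flat !ltNge (ltW x0)/= mulr0 subr0.
  apply: (@near_eq_is_derive _ _ _ (fun=> 0)).
  by near=> y; rewrite ifF//; apply/negbTE; rewrite -leNgt ltW//; near: y; exact: lt_nbhsl.
- have Ef : \forall y \near x, y^-1 ^+ k * expR (- y^-1) = flat k y.
    by near=> y; rewrite /flat ifT//; near: y; exact: lt_nbhsr.
  apply: (near_eq_is_derive Ef).
  have xn : x != 0 by rewrite gt_eqF.
  have dV : is_derive x 1 (fun y : R => y^-1) (- x ^- 2).
    have := is_deriveV xn (is_derive_id x (1:R)).
    by move/is_derive_eq; apply; rewrite /GRing.scale/= mulr1.
  have dE : is_derive x 1 (fun y : R => expR (- y^-1)) (x ^- 2 * expR (- x^-1)).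
    have := @is_derive1_comp _ expR (fun y : R => - y^-1) x _ _ (is_derive_expR (- x^-1)) (is_deriveN dV).
    by move/is_derive_eq; apply; rewrite opprK mulrC.
  have dX : is_derive x 1 (fun y : R => y^-1 ^+ k) (k%:R * x^-1 ^+ k.-1 * (- x ^- 2)).
    have := is_deriveX k dV; rewrite exprfctE.
    by move/is_derive_eq; apply; rewrite /GRing.scale/= mulr_natl.
  have := @is_deriveM _ _ (fun y : R => y^-1 ^+ k) (fun y : R => expR (- y^-1)) _ _ _ _ dX dE.
  move/is_derive_eq; apply; rewrite /flat x0 /GRing.scale/=.
  case: k {Ef dX} => [|k]; first by rewrite !mulr0n !mul0r mulr0 addr0 subr0 expr0 mul1r exprVn.
  rewrite succnK -exprVn !exprS -mulr_natr expr0; ring.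
- have F0 j : flat j 0 = 0 by rewrite /flat ltxx.
  rewrite !F0 mulr0 subr0; apply: is_derive_eps => e e0.
  (* The difference quotient of [flat k] at 0 is [flat k.+1 h], at most (k+2)! h by [flat_le]; hence
     this radius. *)
  exists (e / k.+2`!%:R); first by rewrite divr_gt0// ltr0n fact_gt0.
  move=> h; rewrite add0r F0 mulr0 !subr0 => hr.
  have [h0|h0] := ltP 0 h; last by rewrite /flat ltNge h0/= normr0 mulr_ge0// ltW.
  rewrite (ger0_norm (flat_ge0 _ _)).
  have -> : flat k h = h * flat k.+1 h.
    by rewrite /flat h0 exprS !mulrA mulfV ?gt_eqF// mul1r.
  rewrite gtr0_norm// mulrC ler_pM2r// (le_trans (flat_le _ _ (ltW h0)))//.
  by rewrite mulrC -ler_pdivlMr ?ltr0n ?fact_gt0// ltW// -(gtr0_norm h0).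
Unshelve. all: by end_near. Qed.

Inductive flat_span : (R -> R) -> Prop :=
| flat_span1 c k : flat_span (fun x => c * flat k x)
| flat_spanD f g : flat_span f -> flat_span g -> flat_span (fun x => f x + g x).

Lemma smooth_flat k : smooth (flat k).
Proof.
apply: (@smooth_coind _ flat_span); last first.
  rewrite (_ : flat k = fun x => 1 * flat k x); first exact: flat_span1.
  by apply/funext => x; rewrite mul1r.
move=> h; elim=> {h} [c j|u v _ [du pu] _ [dv pv]]; split.
- by move=> x; have [] := is_deriveZ c (is_derive_flat j x).
- rewrite (derive1_eq _ _ (fun x => is_deriveZ c (is_derive_flat j x))).
  rewrite (_ : (fun x => _) = fun x => c * flat j.+2 x + (- c * j%:R) * flat j.+1 x).
    by apply: flat_spanD; exact: flat_span1.
  by apply/funext => x; rewrite /GRing.scale/=; ring.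
- by move=> x; apply: (@derivableD _ _ _ u v).
- suff -> : derive1 (fun x => u x + v x) = fun x => derive1 u x + derive1 v x by exact: flat_spanD.
  apply: derive1_eq => x.
  by have := is_deriveD (derivableP (du x)) (derivableP (dv x)); rewrite !derive1E.
Qed.

Definition bump01 x : R := flat 0 x * flat 0 (1 - x).

Lemma smooth_bump01 : smooth bump01.
Proof.
apply: smoothM; first exact: smooth_flat.
have := smooth_affine _ (-1) 1 (smooth_flat 0).
by under eq_fun do rewrite mulN1r addrC.
Qed.

Lemma bump01_ge0 x : 0 <= bump01 x.
Proof. by rewrite mulr_ge0 ?flat_ge0. Qed.

Lemma bump01_gt0 x : 0 < x < 1 -> 0 < bump01 x.
Proof.
move=> /andP[x0 x1]; rewrite /bump01 /flat x0 subr_gt0 x1 !expr0 !mul1r.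
by rewrite mulr_gt0 ?expR_gt0.
Qed.

Lemma bump01_out x : ~~ (0 < x < 1) -> bump01 x = 0.
Proof.
rewrite negb_and /bump01 /flat => /orP[/negbTE ->|/negbTE]; first by rewrite mul0r.
by rewrite subr_gt0 => ->; rewrite mulr0.
Qed.

End Bump.

(** * Antiderivatives and integrals of test functions *)

Section TestAndPrimitive.
Context {R : realType}.
Local Notation mu := (@lebesgue_measure R).
Implicit Types (f g F phi : R -> R) (x y c d A M : R) (n m i k : nat).

(** Compact support is recorded by an explicit radius, on which the constants of all later seminorm
    estimates depend. A negative [A] forces [phi] to be 0. *)
Definition supp_in A phi := forall x, A < `|x| -> phi x = 0.
Definition tst A phi := smooth phi /\ supp_in A phi.
Definition bounded_upto m M phi :=
  forall i x, (i <= m)%N -> `|derive1n i phi x| <= M.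

Lemma mvt_le f x y M : smooth f -> (forall z, `|derive1 f z| <= M) ->
  `|f y - f x| <= M * `|y - x|.
Proof.
move=> sf HM; wlog xy : x y / x <= y.
  move=> W; have [|/ltW] := leP x y; first exact: W.
  by move=> /W; rewrite distrC [X in _ <= _ * X]distrC.
have [| |c _ ->] := @MVT_segment R f (derive1 f) x y xy.
- by move=> z _; exact: smooth_is_derive.
- by apply: continuous_subspaceT => z; exact: smooth_continuous.
- by rewrite normrM ler_wpM2r.
Qed.

(** Two applications of the mean value theorem; the factor 1/2 of Taylor's formula is given away. *)
Lemma taylor_le f x h M : smooth f -> (forall z, `|derive1n 2 f z| <= M) ->
  `|f (x + h) - f x - h * derive1 f x| <= M * h ^+ 2.
Proof.
move=> sf HM.
have M0 : 0 <= M by apply: le_trans (HM 0).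
have MV (a b : R) : a <= b -> exists2 c, a <= c <= b & f b - f a = derive1 f c * (b - a).
  move=> ab; have [| |c] := @MVT_segment R f (derive1 f) a b ab.
  - by move=> z _; exact: smooth_is_derive.
  - by apply: continuous_subspaceT => z; exact: smooth_continuous.
  - by rewrite in_itv/= => cab E; exists c.
have [c cx E] : exists2 c, `|c - x| <= `|h| & f (x + h) - f x = derive1 f c * h.
  have [h0|h0] := leP 0 h.
    have [|c /andP[xc ch] E] := MV x (x + h); first by rewrite lerDl.
    exists c; last by rewrite E; ring.
    by rewrite ger0_norm ?subr_ge0// ger0_norm// lerBlDl.
  have [|c /andP[xc ch] E] := MV (x + h) x; first by rewrite gerDl ltW.
  exists c; last by rewrite -opprB E; ring.
  by rewrite distrC ger0_norm ?subr_ge0// ltr0_norm//; lra.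
rewrite E [derive1 f c * h]mulrC -mulrBr normrM -(real_normK (num_real h)) expr2 mulrCA ler_wpM2l//.
have H := @mvt_le (derive1 f) x c M (smooth_derive1 f sf) HM.
by rewrite (le_trans H)// ler_wpM2l.
Qed.

Lemma smooth_antiderivative F f : (forall x, is_derive x 1 F (f x)) -> smooth f -> smooth F.
Proof.
move=> dF sf; have E := derive1_eq _ _ dF.
by case=> [|n] x; [have [] := dF x|rewrite derive1Sn E; exact: sf].
Qed.

Lemma tst_integrable A phi : tst A phi -> mu.-integrable setT (EFin \o phi).
Proof.
move=> [sf sA].
have -> : EFin \o phi = (EFin \o phi) \_ `[- A, A].
  apply/funext => x; rewrite patchE; case: ifPn => //; rewrite notin_setE/= in_itv/= => nx.
  by rewrite /= sA// ltNge ler_norml; apply/negP.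
rewrite -integrable_mkcond//; apply: continuous_compact_integrable; first exact: segment_compact.
by apply: continuous_subspaceT => x; exact: smooth_continuous.
Qed.

Definition prim phi y : R := \int[mu]_(z in `]-oo, y]) phi z.
Definition intR phi : R := \int[mu]_z phi z.

Lemma is_derive_prim A phi x : tst A phi -> is_derive x 1 (prim phi) (phi x).
Proof.
move=> tp; have [sp _] := tp.
have [] := @continuous_FTC1 R phi -oo%O x (x + 1) _ _ _ _.
- by rewrite ltrDl.
- by apply: integrableS (tst_integrable _ _ tp).
- by rewrite ltNyr.
- exact: smooth_continuous.
by move=> d1 d2; split; [exact: d1|rewrite -derive1E; exact: d2].
Qed.

Lemma smooth_prim A phi : tst A phi -> smooth (prim phi).
Proof.
move=> tp; apply: (smooth_antiderivative _ phi); last by have [] := tp.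
by move=> x; exact: is_derive_prim tp.
Qed.

Lemma derive1_prim A phi : tst A phi -> derive1 (prim phi) = phi.
Proof. by move=> tp; apply: derive1_eq => x; exact: is_derive_prim tp. Qed.

Lemma prim_eq0 phi y : (forall z, z <= y -> phi z = 0) -> prim phi y = 0.
Proof.
move=> H; rewrite /prim (_ : \int[mu]_(z in `]-oo, y]) phi z = \int[mu]_(z in `]-oo, y]) (cst 0) z).
  by rewrite Rintegral_cst// mul0r.
by apply: eq_Rintegral => z; rewrite inE/= in_itv/= => zy; apply: H.
Qed.

Lemma prim_eq_intR phi y : (forall z, y < z -> phi z = 0) -> prim phi y = intR phi.
Proof.
move=> H; rewrite /prim Rintegral_mkcond; apply: eq_Rintegral => z _.
rewrite patchE; case: ifPn => //; rewrite notin_setE/= in_itv/= => /negP.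
by rewrite -ltNge => yz; apply/esym/H.
Qed.

Lemma prim_left A phi y : supp_in A phi -> y < - A -> prim phi y = 0.
Proof.
move=> sA yA; apply: prim_eq0 => z zy; apply: sA.
by rewrite -normrN; apply: lt_le_trans (ler_norm _); lra.
Qed.

Lemma prim_right A phi y : supp_in A phi -> A < y -> prim phi y = intR phi.
Proof.
move=> sA yA; apply: prim_eq_intR => z yz; apply: sA.
by apply: lt_le_trans (ler_norm z); lra.
Qed.

(** Two antiderivatives differ by a constant, which is 0 far to the left. Integrals of sums,
    dilations and reflections are computed in this way instead of by a change of variables. *)
Lemma prim_unique A phi F B : tst A phi -> (forall x, is_derive x 1 F (phi x)) ->
  (forall x, x < B -> F x = 0) -> F = prim phi.
Proof.
move=> tp dF F0; apply/funext => x.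
have [_ sA] := tp.
have D0 (z : R) : is_derive z 1 (fun x => F x - prim phi x) 0.
  have := is_deriveB (dF z) (is_derive_prim _ _ z tp).
  by move/is_derive_eq; apply; rewrite subrr.
pose y := Num.min B (- A) - 1.
have yB : y < B by have : Num.min B (- A) <= B; [rewrite ge_min lexx|rewrite /y; lra].
have yA : y < - A by have : Num.min B (- A) <= - A; [rewrite ge_min lexx orbT|rewrite /y; lra].
have /= := @is_derive_0_is_cst R (fun x => F x - prim phi x) x y D0.
by rewrite (F0 _ yB) (prim_left _ _ _ sA yA) subr0 => /eqP; rewrite subr_eq0 => /eqP.
Qed.

(** [prim phi] has Lipschitz constant [M], vanishes at -A-1 and is constant from A+1 on, and 2A+2 is
    the length in between. *)
Lemma prim_bound A phi y M : tst A phi -> 0 <= A -> (forall x, `|phi x| <= M) ->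
  `|prim phi y| <= M * (2 * A + 2).
Proof.
move=> tp A0 HM; have [_ sA] := tp.
have M0 : 0 <= M by apply: le_trans (HM 0).
have K a b : `|prim phi b - prim phi a| <= M * `|b - a|.
  by apply: mvt_le; [exact: smooth_prim tp|rewrite (derive1_prim _ _ tp)].
have L : prim phi (- A - 1) = 0 by apply: (prim_left _ _ _ sA); lra.
have [yA|yA] := leP y (A + 1); last first.
  have := K (- A - 1) (A + 1); rewrite L subr0 (prim_right _ _ _ sA); last lra.
  rewrite -(prim_right _ _ y sA); last lra.
  by move=> /le_trans; apply; rewrite ler_wpM2l// ger0_norm; lra.
have [yB|yB] := ltP y (- A - 1).
  by rewrite (prim_left _ _ _ sA) ?normr0 ?mulr_ge0//; lra.
have := K (- A - 1) y; rewrite L subr0.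
by move=> /le_trans; apply; rewrite ler_wpM2l// ger0_norm; lra.
Qed.

End TestAndPrimitive.

(** * Supports, dilations and seminorms of test functions *)

Section TestFunctions.
Context {R : realType}.
Implicit Types (f g F phi : R -> R) (x y c d t A B M : R) (n m i k : nat).

Lemma supp_derive1n n A phi : supp_in A phi -> supp_in A (derive1n n phi).
Proof.
move=> sA x Ax.
have : \forall y \near x, phi y = (fun=> 0) y.
  near=> y; apply: sA; near: y.
  have : \forall z \near `|x|, A < z by exact: lt_nbhsr.
  by move=> /norm_continuous.
move=> /(near_derive1n n) /nbhs_singleton ->.
by rewrite derive1n_cst0.
Unshelve. all: by end_near. Qed.

Lemma tst_derive1n n A phi : tst A phi -> tst A (derive1n n phi).
Proof. by move=> [sp sA]; split; [exact: smooth_derive1n|exact: supp_derive1n]. Qed.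

Lemma tst_derive1 A phi : tst A phi -> tst A (derive1 phi).
Proof. exact: (tst_derive1n 1). Qed.

Lemma tst_le A B phi : A <= B -> tst A phi -> tst B phi.
Proof. by move=> AB [sp sA]; split => // x Bx; apply: sA; apply: le_lt_trans Bx. Qed.

Lemma tstD A f g : tst A f -> tst A g -> tst A (fun x => f x + g x).
Proof.
by move=> [sf Af] [sg Ag]; split; [exact: smoothD|move=> x Ax; rewrite Af// Ag// addr0].
Qed.

Lemma tstB A f g : tst A f -> tst A g -> tst A (fun x => f x - g x).
Proof.
by move=> [sf Af] [sg Ag]; split; [exact: smoothB|move=> x Ax; rewrite Af// Ag// subr0].
Qed.

Lemma tstMl A f g : tst A f -> smooth g -> tst A (fun x => f x * g x).
Proof.
by move=> [sf Af] sg; split; [exact: smoothM|move=> x Ax; rewrite Af// mul0r].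
Qed.

Lemma tstMr A f g : smooth f -> tst A g -> tst A (fun x => f x * g x).
Proof.
by move=> sf [sg Ag]; split; [exact: smoothM|move=> x Ax; rewrite Ag// mulr0].
Qed.

Lemma tstZ A c f : tst A f -> tst A (fun x => c * f x).
Proof. by move=> tf; apply: tstMr tf; exact: smooth_cst. Qed.

Lemma tst0 A : tst A (fun=> 0 : R).
Proof. by split; [exact: smooth_cst|]. Qed.

Definition dil x t phi y := phi ((y - x) / t).

Lemma dilE x t phi : dil x t phi = fun y => phi (t^-1 * y + (- (x / t))).
Proof. by apply/funext => y; rewrite /dil; congr phi; ring. Qed.

Lemma smooth_dil x t phi : smooth phi -> smooth (dil x t phi).
Proof. by move=> sp; rewrite dilE; exact: smooth_affine. Qed.

Lemma derive1n_dil n x t phi : smooth phi ->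
  derive1n n (dil x t phi) = fun y => t^-1 ^+ n * derive1n n phi ((y - x) / t).
Proof.
move=> sp; rewrite dilE (derive1n_affine n phi _ _ sp).
by apply/funext => y; congr (_ * derive1n n phi _); ring.
Qed.

Lemma derive1_dil x t phi : smooth phi ->
  derive1 (dil x t phi) = fun y => t^-1 * dil x t (derive1 phi) y.
Proof. by move=> sp; have := derive1n_dil 1 x t phi sp; rewrite expr1. Qed.

Lemma tst_dil A x t phi : 0 < t -> tst A phi -> tst (t * A + `|x|) (dil x t phi).
Proof.
move=> t0 [sp sA]; split; first exact: smooth_dil.
move=> y Hy; apply: sA; rewrite normrM [`|t^-1|]gtr0_norm ?invr_gt0// ltr_pdivlMr// mulrC.
by have := ler_normD (y - x) x; rewrite subrK; lra.
Qed.

Lemma bounded_dil m M x t phi : smooth phi -> 0 < t -> bounded_upto m M phi ->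
  bounded_upto m (M * Num.max 1 (t^-1 ^+ m)) (dil x t phi).
Proof.
move=> sp t0 HM i y im.
have M0 : 0 <= M by apply: le_trans (HM 0%N 0 _).
rewrite (derive1n_dil i x t phi sp) normrM mulrC.
have ti0 : 0 < t^-1 by rewrite invr_gt0.
rewrite normrX (gtr0_norm ti0); apply: ler_pM => //; first by apply: exprn_ge0; exact: ltW.
  exact: HM.
rewrite le_max; have [t1|t1] := leP (t^-1) 1.
  by rewrite exprn_ile1// ltW.
by apply/orP; right; apply: ler_weXn2l => //; exact: ltW.
Qed.

Lemma bounded_le m n M N phi : (n <= m)%N -> M <= N -> bounded_upto m M phi -> bounded_upto n N phi.
Proof.
by move=> nm MN H i x ni; apply: (le_trans (H i x _)) => //; exact: leq_trans nm.
Qed.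

Lemma bounded_derive1 m M phi : bounded_upto m.+1 M phi -> bounded_upto m M (derive1 phi).
Proof. by move=> H i x im; rewrite -derive1Sn; apply: H. Qed.

Lemma boundedZ m M c phi : smooth phi -> bounded_upto m M phi ->
  bounded_upto m (`|c| * M) (fun x => c * phi x).
Proof. by move=> sp H i x im; rewrite derive1nZ// normrM ler_wpM2l//; exact: H. Qed.

Lemma smooth_local_bound m B f : smooth f ->
  exists2 M, 0 <= M & forall i x, (i <= m)%N -> `|x| <= B -> `|derive1n i f x| <= M.
Proof.
move=> sf; elim: m => [|m [M M0 HM]]; last first.
  have [N N0 HN] : exists2 N, 0 <= N & forall x, `|x| <= B -> `|derive1n m.+1 f x| <= N.
    have [B0|B0] := leP 0 B; last first.
      by exists 0 => // x xB; have := le_trans (normr_ge0 x) xB; rewrite leNgt B0.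
    have c : continuous (fun x => `|derive1n m.+1 f x|).
      move=> x; apply: (continuous_comp _ (@norm_continuous _ _ _)).
      by apply: smooth_continuous; exact: smooth_derive1n.
    have [|z _ Hz] := @EVT_max R (fun x => `|derive1n m.+1 f x|) (- B) B _ (continuous_subspaceT c).
      lra.
    exists `|derive1n m.+1 f z| => // x xB; apply: Hz; rewrite in_itv/= -ler_norml//.
  exists (M + N); first by rewrite addr_ge0.
  move=> i x; rewrite leq_eqVlt ltnS => /predU1P[-> xB|im xB].
    by apply: (le_trans (HN _ xB)); rewrite lerDr.
  by apply: (le_trans (HM _ _ im xB)); rewrite lerDl.
have [B0|B0] := leP 0 B; last first.
  by exists 0 => // i x _ xB; have := le_trans (normr_ge0 x) xB; rewrite leNgt B0.
have c : continuous (fun x => `|f x|).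
  by move=> x; apply: (continuous_comp _ (@norm_continuous _ _ _)); exact: smooth_continuous.
have [|z _ Hz] := @EVT_max R (fun x => `|f x|) (- B) B _ (continuous_subspaceT c); first lra.
exists `|f z| => // i x; rewrite leqn0 => /eqP -> xB; apply: Hz.
by rewrite in_itv/= -ler_norml.
Qed.

Lemma tst_bounded m A f : tst A f -> exists2 M, 0 <= M & bounded_upto m M f.
Proof.
move=> [sf sA]; have [M M0 HM] := smooth_local_bound m A f sf.
exists M => // i x im; have [xA|xA] := leP `|x| A; first exact: HM.
by rewrite (supp_derive1n i A f sA x xA) normr0.
Qed.

Lemma boundedM m M N f g : smooth f -> smooth g -> 0 <= M -> 0 <= N ->
  bounded_upto m M f -> bounded_upto m N g ->
  bounded_upto m (2 ^+ m * M * N) (fun x => f x * g x).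
Proof.
move=> sf sg M0 N0 HM HN i x im.
have := @derive1nM_bound R i f g x M N 1 sf sg ltr01 M0 N0; rewrite !expr1n divr1 => H.
apply: (le_trans (H _ _)).
- by move=> j ji; rewrite expr1n divr1; apply: HM; exact: leq_trans im.
- by move=> j ji; rewrite expr1n divr1; apply: HN; exact: leq_trans im.
- by rewrite ler_wpM2r// ler_wpM2r// ler_weXn2l// ler1n.
Qed.

Lemma intRE A phi F B : tst A phi -> (forall x, is_derive x 1 F (phi x)) ->
  (forall x, x < B -> F x = 0) -> forall y, A < y -> intR phi = F y.
Proof.
move=> tp dF F0 y Ay; rewrite (prim_unique _ _ _ _ tp dF F0).
by rewrite (prim_right _ _ _ tp.2 Ay).
Qed.

Lemma intR_derive1 A phi : tst A phi -> intR (derive1 phi) = 0.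
Proof.
move=> tp; have sp := tp.1.
rewrite (intRE A _ phi (- A) (tst_derive1 _ _ tp) _ _ (A + 1)).
- by apply: tp.2; apply: lt_le_trans (ler_norm _); rewrite ltrDl.
- by move=> x; exact: smooth_is_derive.
- by move=> x xA; apply: tp.2; rewrite -normrN; apply: lt_le_trans (ler_norm _); lra.
- by rewrite ltrDl.
Qed.

Lemma primL A c f g : tst A f -> tst A g ->
  prim (fun x => c * f x + g x) = fun y => c * prim f y + prim g y.
Proof.
move=> tf tg; apply/esym; apply: (prim_unique A _ _ (- A)).
- by apply: tstD => //; exact: tstZ.
- by move=> x; have := is_deriveD (is_deriveZ c (is_derive_prim _ _ x tf)) (is_derive_prim _ _ x tg).
- by move=> x xA; rewrite !(prim_left A)// ?mulr0 ?addr0//; [exact: tg.2|exact: tf.2].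
Qed.

Lemma intRL A c f g : tst A f -> tst A g -> intR (fun x => c * f x + g x) = c * intR f + intR g.
Proof.
move=> tf tg; have Ay : A < A + 1 by rewrite ltrDl.
rewrite -(prim_right A _ (A + 1))//; last by have [] : tst A (fun x => c * f x + g x) by apply: tstD => //; exact: tstZ.
by rewrite (primL A)// !(prim_right A)//; [exact: tg.2|exact: tf.2].
Qed.

Lemma prim_dil A x t phi : 0 < t -> tst A phi ->
  prim (dil x t phi) = fun y => t * prim phi ((y - x) / t).
Proof.
move=> t0 tp; have tn : t != 0 by rewrite gt_eqF.
apply/esym; apply: (prim_unique _ _ _ (- (t * A) + x) (tst_dil _ x _ _ t0 tp)).
- move=> y.
  rewrite (_ : (fun y => _) = t *: (fun z => prim phi (t^-1 * z + - (x / t)))).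
    have H := is_derive_affine (prim phi) t^-1 (- (x / t)) y (smooth_prim _ _ tp).
    apply: is_derive_eq (is_deriveZ t H) _.
    by rewrite (derive1_prim _ _ tp) /GRing.scale/= mulrA mulfV// mul1r dilE.
  by apply/funext => z; rewrite /GRing.scale/=; congr (_ * prim phi _); ring.
- move=> y yA; rewrite (prim_left A) ?mulr0//; first exact: tp.2.
  by rewrite ltr_pdivrMr//; lra.
Qed.

Lemma intR_dil A x t phi : 0 < t -> tst A phi -> intR (dil x t phi) = t * intR phi.
Proof.
move=> t0 tp; have tn : t != 0 by rewrite gt_eqF.
have [_ sd] := tst_dil _ x _ _ t0 tp.
rewrite -(prim_right _ _ (Num.max (t * A + `|x|) (t * A + x) + 1) sd); last first.
  by rewrite (@le_lt_trans _ _ (Num.max (t * A + `|x|) (t * A + x)))// ?ltrDl// le_max lexx.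
rewrite (prim_dil A)// (prim_right A)//; first exact: tp.2.
rewrite ltr_pdivlMr//.
have : t * A + x <= Num.max (t * A + `|x|) (t * A + x) by rewrite le_max lexx orbT.
by rewrite mulrC; lra.
Qed.

Lemma tst_opp A phi : tst A phi -> tst A (fun y => phi (- y)).
Proof.
move=> [sp sA]; split; last by move=> x Ax; apply: sA; rewrite normrN.
by have := smooth_affine _ (-1) 0 sp; under eq_fun do rewrite mulN1r addr0.
Qed.

Lemma intR_opp A phi : tst A phi -> intR (fun y => phi (- y)) = intR phi.
Proof.
move=> tp; have sp := smooth_prim _ _ tp.
rewrite (intRE A _ (fun y => intR phi - prim phi (- y)) (- A) (tst_opp _ _ tp) _ _ (A + 1)).
- by rewrite (prim_left A) ?subr0//; [exact: tp.2|lra].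
- move=> x.
  rewrite (_ : (fun y => _) = cst (intR phi) - (fun z => prim phi (-1 * z + 0))).
    have H := is_derive_affine (prim phi) (-1) 0 x sp.
    apply: is_derive_eq (is_deriveB (is_derive_cst (intR phi) x (1:R)) H) _.
    by rewrite (derive1_prim _ _ tp) sub0r mulN1r opprK addr0 mulN1r.
  apply/funext => z; rewrite -[RHS]/(intR phi - prim phi (-1 * z + 0)).
  by rewrite mulN1r addr0.
- by move=> x xA; rewrite (prim_right A) ?subrr//; [exact: tp.2|lra].
- by rewrite ltrDl.
Qed.

Lemma prim_ge0_mono A phi : tst A phi -> (forall x, 0 <= phi x) ->
  {homo prim phi : x y / x <= y}.
Proof.
move=> tp p0 x y xy; have sp := smooth_prim _ _ tp.
have [| |c _] := @MVT_segment R (prim phi) phi x y xy.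
- by move=> z _; exact: is_derive_prim tp.
- by apply: continuous_subspaceT => z; exact: smooth_continuous.
- by rewrite -subr_ge0 => ->; rewrite mulr_ge0// subr_ge0.
Qed.

Lemma test_functionP phi : test_function phi <-> exists2 A, 0 <= A & tst A phi.
Proof.
split=> [[sp /compact_bounded [A [_ HA]]]|[A A0 [sp sA]]].
  exists (`|A| + 1); first by rewrite addr_ge0.
  split=> // x Ax; apply/eqP; apply: contraTT Ax => px0; rewrite -leNgt.
  apply: HA; first by apply: le_lt_trans (ler_norm A) _; rewrite ltrDl.
  exact: subset_closure.
split=> //; apply: (@subclosed_compact _ _ `[- A, A]).
- exact: closed_closure.
- exact: segment_compact.
- have cl : closed (`[- A, A] : set R) by exact: interval_closed.
  rewrite /tsupport closureE => x; apply; split=> // y /= py.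
  rewrite in_itv/= -ler_norml leNgt; apply/negP => /sA E.
  by rewrite E eqxx in py.
Qed.

Lemma tst_test A phi : tst A phi -> test_function phi.
Proof.
move=> tp; apply/test_functionP; exists `|A| => //.
exact: tst_le (ler_norm A) tp.
Qed.

Lemma tsupport_sub (K : set R) phi : closed K -> (forall x, ~ K x -> phi x = 0) ->
  tsupport phi `<=` K.
Proof.
move=> cK H; rewrite /tsupport closureE => x; apply; split => // y /= py.
by apply: contrapT => /H E; rewrite E eqxx in py.
Qed.

End TestFunctions.

(** * Smooth cutoffs *)

Section Cutoff.
Context {R : realType}.
Implicit Types (x y z : R).

Lemma tst_bump01 : tst 1 (@bump01 R).
Proof.
split; first exact: smooth_bump01.
move=> x x1; apply: bump01_out; apply/negP => /andP[x0 xl].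
by rewrite gtr0_norm// in x1; lra.
Qed.

Lemma prim_bump01_le0 y : y <= 0 -> prim (@bump01 R) y = 0.
Proof.
by move=> y0; apply: prim_eq0 => z zy; apply: bump01_out; apply/negP => /andP[z0 _]; lra.
Qed.

Lemma prim_bump01_ge1 y : 1 <= y -> prim (@bump01 R) y = intR (@bump01 R).
Proof.
by move=> y0; apply: prim_eq_intR => z zy; apply: bump01_out; apply/negP => /andP[z0 z1]; lra.
Qed.

Lemma intR_bump01_gt0 : 0 < intR (@bump01 R).
Proof.
have [| |c c01] := @MVT R (prim bump01) bump01 0 1 ltr01.
- by move=> z _; exact: is_derive_prim tst_bump01.
- by apply: continuous_subspaceT => z; apply: smooth_continuous; exact: smooth_prim tst_bump01.
- rewrite prim_bump01_ge1// prim_bump01_le0// !subr0 mulr1 => ->.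
  by apply: bump01_gt0; rewrite in_itv in c01.
Qed.

Definition step y : R := prim bump01 y / intR bump01.

Lemma smooth_step : smooth step.
Proof.
have := smoothZ (intR (@bump01 R))^-1 _ (smooth_prim _ _ tst_bump01).
by under eq_fun do rewrite mulrC.
Qed.

Lemma step_le0 y : y <= 0 -> step y = 0.
Proof. by move=> y0; rewrite /step prim_bump01_le0// mul0r. Qed.

Lemma step_ge1 y : 1 <= y -> step y = 1.
Proof. by move=> y0; rewrite /step prim_bump01_ge1// divff// gt_eqF// intR_bump01_gt0. Qed.

Lemma step_mono : {homo step : x y / x <= y}.
Proof.
move=> x y xy; rewrite /step ler_pM2r ?invr_gt0 ?intR_bump01_gt0//.
exact: prim_ge0_mono tst_bump01 (@bump01_ge0 R) _ _ xy.
Qed.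

Lemma step_ge0 y : 0 <= step y.
Proof.
by have [y0|y0] := leP 0 y; [rewrite -(step_le0 0)//; exact: step_mono|rewrite step_le0// ltW].
Qed.

Lemma step_le1 y : step y <= 1.
Proof.
by have [y0|y0] := leP y 1; [rewrite -(step_ge1 1)//; exact: step_mono|rewrite step_ge1// ltW].
Qed.

(** Equal to 1 on [-1, 1] and to 0 outside (-2, 2); its dilations [cutr r] are the cutoffs used
    throughout. *)
Definition plateau y : R := step (2 + y) * step (2 - y).

Lemma smooth_plateau : smooth plateau.
Proof.
have H1 := smooth_affine _ 1 2 smooth_step.
have H2 := smooth_affine _ (-1) 2 smooth_step.
have := smoothM _ _ H1 H2; congr smooth; apply/funext => y.
by rewrite /plateau mul1r mulN1r addrC [- y + 2]addrC.
Qed.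

Lemma plateau1 y : `|y| <= 1 -> plateau y = 1.
Proof. by rewrite ler_norml => /andP[? ?]; rewrite /plateau !step_ge1 ?mulr1//; lra. Qed.

Lemma plateau0 y : 2 <= `|y| -> plateau y = 0.
Proof.
rewrite /plateau; have [y0|y0] := leP 0 y.
  by rewrite ger0_norm// => y2; rewrite [step (2 - y)]step_le0 ?mulr0//; lra.
by rewrite ltr0_norm// => y2; rewrite [step (2 + y)]step_le0 ?mul0r//; lra.
Qed.

Lemma tst_plateau : tst 2 plateau.
Proof. by split; [exact: smooth_plateau|move=> x /ltW; exact: plateau0]. Qed.

Lemma plateau_ge0 y : 0 <= plateau y.
Proof. by rewrite mulr_ge0 ?step_ge0. Qed.

Lemma plateau_le1 y : plateau y <= 1.
Proof. by rewrite -[leRHS](mul1r 1) ler_pM ?step_ge0 ?step_le1. Qed.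

Definition cutr r y : R := plateau (y / r).

Lemma cutr_dil r : cutr r = dil 0 r plateau.
Proof. by apply/funext => y; rewrite /cutr /dil subr0. Qed.

Lemma tst_cutr r : 0 < r -> tst (2 * r) (cutr r).
Proof.
by move=> r0; rewrite cutr_dil; have := tst_dil 2 0 r _ r0 tst_plateau; rewrite normr0 addr0 mulrC.
Qed.

Lemma cutr1 r y : 0 < r -> `|y| <= r -> cutr r y = 1.
Proof.
by move=> r0 yr; apply: plateau1; rewrite normrM normfV (gtr0_norm r0) ler_pdivrMr ?mul1r.
Qed.

End Cutoff.

(** * Distributions of compact support *)

Section DistributionFacts.
Context {R : realType}.
Implicit Types (g u : (R -> R) -> R) (f F phi : R -> R) (a b x y c r A M : R) (m : nat).

Lemma dist_L g A c f phi : is_distribution g -> tst A f -> tst A phi ->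
  g (fun x => c * f x + phi x) = c * g f + g phi.
Proof. by move=> [H _] tf tp; apply: H; exact: (@tst_test _ A). Qed.

Lemma dist0 g : is_distribution g -> g (fun=> 0) = 0.
Proof.
move=> dg; have := dist_L _ 0 1 _ _ dg (tst0 0) (tst0 0).
rewrite (_ : (fun x : R => 1 * 0 + 0) = fun=> 0); last by apply/funext => x; rewrite mulr0 addr0.
by rewrite mul1r -[LHS]addr0 => /addrI/esym.
Qed.

Lemma distZ g A c f : is_distribution g -> tst A f -> g (fun x => c * f x) = c * g f.
Proof.
move=> dg tf; have := dist_L _ _ c _ _ dg tf (tst0 A).
by under [X in g X]eq_fun do rewrite addr0; rewrite dist0// addr0.
Qed.

Lemma distD g A f phi : is_distribution g -> tst A f -> tst A phi ->
  g (fun x => f x + phi x) = g f + g phi.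
Proof.
move=> dg tf tp; have := dist_L _ _ 1 _ _ dg tf tp.
by under [X in g X]eq_fun do rewrite mul1r; rewrite mul1r.
Qed.

Lemma distB g A f phi : is_distribution g -> tst A f -> tst A phi ->
  g (fun x => f x - phi x) = g f - g phi.
Proof.
move=> dg tf tp; have := dist_L _ _ (-1) _ _ dg tp tf.
under [X in g X]eq_fun do rewrite mulN1r addrC.
by rewrite mulN1r addrC.
Qed.

Lemma dist_bound g A : is_distribution g -> exists C m, 0 <= C /\
  forall f M, tst A f -> bounded_upto m M f -> `|g f| <= C * M.
Proof.
move=> [_ H]; have [|C [m HC]] := H `[- A, A]%classic; first exact: segment_compact.
exists `|C|, m; split=> // f M tf bf.
have M0 : 0 <= M by apply: le_trans (bf 0%N 0 _).
apply: (@le_trans _ _ (C * M)); last by rewrite ler_wpM2r// ler_norm.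
apply: HC => //; first exact: tst_test tf.
apply: tsupport_sub; first exact: interval_closed.
move=> x nx; apply: tf.2; rewrite ltNge; apply/negP => xA; apply: nx.
by rewrite /= in_itv/= -ler_norml.
Qed.

Lemma dist_intro g :
  (forall A c f phi, 0 <= A -> tst A f -> tst A phi ->
    g (fun x => c * f x + phi x) = c * g f + g phi) ->
  (forall A, 0 <= A -> exists C m,
    forall f M, tst A f -> bounded_upto m M f -> `|g f| <= C * M) ->
  is_distribution g.
Proof.
move=> H1 H2; split=> [c f phi|K cK].
  move=> /test_functionP[A A0 tA] /test_functionP[B B0 tB].
  apply: (H1 (A + B)); first by rewrite addr_ge0.
    by apply: tst_le tA; rewrite lerDl.
  by apply: tst_le tB; rewrite lerDr.
have [B [_ HB]] := compact_bounded cK.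
have A0 : 0 <= `|B| + 1 by rewrite addr_ge0.
have [C [m HC]] := H2 _ A0; exists C, m => f M [sf _] sK bf; apply: HC => //.
split=> // x Ax; apply: contrapT => /eqP fx.
have /HB : K x by apply: sK; exact: subset_closure.
move=> /(_ (`|B| + 1)); rewrite ltNge in Ax.
by move: Ax => /negP Ax /(_ _)/Ax; apply; apply: le_lt_trans (ler_norm _) _; rewrite ltrDl.
Qed.

Lemma dist_eq_on g a b (O : set R) f phi A : Eprime a b g -> open O -> `[a, b] `<=` O ->
  tst A f -> tst A phi -> (forall y, O y -> f y = phi y) -> g f = g phi.
Proof.
move=> [dg sg] oO abO tf tp E; apply/eqP; rewrite -subr_eq0 -(distB _ _ _ _ dg tf tp); apply/eqP.
apply: sg; first by apply: (@tst_test _ A); exact: tstB.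
have : tsupport (fun x => f x - phi x) `<=` ~` O.
  apply: tsupport_sub; first exact: open_closedC.
  by move=> x /contrapT Ox; rewrite E// subrr.
by move=> H y /H nO aby; apply: nO; exact: abO.
Qed.

(** [pairing] is a choice among the values for all admissible cutoffs, so these values must be shown
    equal. Two cutoffs [chi] and [ch] are compared through their product: [chi] may be inserted
    because it is 1 near [a, b], and [ch] may then be removed because it is 1 near its own carrier
    [K]. *)
Lemma pairingP g a b F chi (O : set R) : a <= b -> Eprime a b g -> test_function chi ->
  open O -> `[a, b] `<=` O -> (forall y, O y -> chi y = 1) -> smooth F ->
  pairing g F = g (fun y => chi y * F y).
Proof.
move=> ab Eg tchi oO abO chi1 sF; rewrite /pairing; apply: xget_unique.
  by exists `[a, b]%classic, chi, O; split=> //; split; [exact: segment_compact|exact: Eg.2].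
move=> r [K [ch [P []]]] [cK sK] tch [oP KP] ch1 ->.
have [A A0 tA] := iffLR (test_functionP chi) tchi.
have [B B0 tB] := iffLR (test_functionP ch) tch.
have tA' : tst (A + B) chi by apply: tst_le tA; rewrite lerDl.
have tB' : tst (A + B) ch by apply: tst_le tB; rewrite lerDr.
have tAF := tstMl _ _ _ tA' sF; have tBF := tstMl _ _ _ tB' sF.
have tABF := tstMl _ _ _ tA' tBF.1.
transitivity (g (fun y => chi y * (ch y * F y))).
- apply/esym; apply: (dist_eq_on _ _ _ _ _ _ _ Eg oO abO tABF tBF) => y /chi1 ->.
  by rewrite mul1r.
- apply/eqP; rewrite -subr_eq0 -(distB _ _ _ _ Eg.1 tABF tAF); apply/eqP.
  apply: sK; first by apply: (@tst_test _ (A + B)); exact: tstB.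
  have : tsupport (fun y => chi y * (ch y * F y) - chi y * F y) `<=` ~` P.
    apply: tsupport_sub; first exact: open_closedC.
    by move=> x /contrapT Ox; rewrite ch1// mul1r subrr.
  by move=> H y /H nO Ky; apply: nO; exact: KP.
Qed.

(** The summand 1 leaves [a, b] strictly inside, so that a cutoff of this radius is 1 on a
    neighbourhood of it. *)
Definition hull_radius a b : R := `|a| + `|b| + 1.

Lemma hull_radius_gt0 a b : 0 < hull_radius a b.
Proof. by rewrite ltr_wpDl// addr_ge0. Qed.

Lemma hull_radius_norm a b y : a <= y <= b -> `|y| < hull_radius a b.
Proof.
move=> /andP[ay yb]; rewrite ltr_norml /hull_radius.
by have := ler_norm b; have := ler_norm (- a); rewrite normrN; have := normr_ge0 a;
   have := normr_ge0 b; lra.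
Qed.

Lemma pairingE g a b r F : a <= b -> Eprime a b g -> hull_radius a b <= r -> smooth F ->
  pairing g F = g (fun y => cutr r y * F y).
Proof.
move=> ab Eg rr sF; have r0 : 0 < r by apply: lt_le_trans rr; exact: hull_radius_gt0.
apply: (pairingP _ a b _ _ `]- r, r[%classic ab Eg (tst_test _ _ (tst_cutr _ r0)) _ _ _ sF).
- exact: itv_open.
- move=> y /=; rewrite !in_itv/= -ltr_norml => aby.
  by apply: lt_le_trans rr; exact: hull_radius_norm.
- by move=> y /=; rewrite in_itv/= -ltr_norml => /ltW; exact: cutr1.
Qed.

Lemma pairing_tst g a b A f : a <= b -> Eprime a b g -> tst A f -> pairing g f = g f.
Proof.
move=> ab Eg tf; rewrite (pairingE g a b (hull_radius a b + `|A|))//; last exact: tf.1.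
  congr g; apply/funext => y; have r0 := hull_radius_gt0 a b.
  have [yr|yr] := leP `|y| (hull_radius a b + `|A|); first by rewrite cutr1 ?mul1r// ltr_wpDr.
  by rewrite tf.2 ?mulr0//; apply: lt_trans yr; apply: le_lt_trans (ler_norm A) _; rewrite ltrDr.
by rewrite lerDl.
Qed.

Lemma pairingL g a b c f F : a <= b -> Eprime a b g -> smooth f -> smooth F ->
  pairing g (fun y => c * f y + F y) = c * pairing g f + pairing g F.
Proof.
move=> ab Eg sf sF; have tc := tst_cutr _ (hull_radius_gt0 a b).
have sfF : smooth (fun y => c * f y + F y) by exact: (smoothD _ _ (smoothZ c _ sf) sF).
rewrite !(pairingE g a b (hull_radius a b))//.
rewrite -(dist_L g (2 * hull_radius a b) c _ _ Eg.1); [|exact: tstMl|exact: tstMl].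
by congr g; apply/funext => y; rewrite mulrDr; congr (_ + _); rewrite mulrCA.
Qed.

End DistributionFacts.

(** * Uniform boundedness at a point *)

Section SmoothSeries.
Context {R : realType}.
Implicit Types (x y A C D M t T : R) (th : nat -> R -> R) (i j k m n N K : nat).

Lemma smooth_family (F : nat -> R -> R) :
  (forall i x, is_derive x 1 (F i) (F i.+1 x)) ->
  smooth (F 0%N) /\ forall i, derive1n i (F 0%N) = F i.
Proof.
move=> dF; have E i : derive1n i (F 0%N) = F i.
  by elim: i => [//|i IH]; rewrite derive1nS IH; apply: derive1_eq.
by split=> // i x; rewrite E; have [] := dF i x.
Qed.

Lemma cvg_norm_le (u : nat -> R) l M N :
  u @ \oo --> l -> (forall n, (N <= n)%N -> `|u n| <= M) -> `|l| <= M.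
Proof.
move=> ul H; have nul : `|u n| @[n --> \oo] --> `|l| by exact: cvg_norm ul.
rewrite -(cvg_lim _ nul)//; apply: limr_le; first exact: cvgP nul.
by exists N => // n /= Nn; exact: H.
Qed.

Lemma geometric_tail N K : (N <= K)%N ->
  \sum_(N <= k < K) (2^-1 : R) ^+ k <= 2 * 2^-1 ^+ N.
Proof.
move=> NK; suff -> : \sum_(N <= k < K) (2^-1 : R) ^+ k = 2 * 2^-1 ^+ N - 2 * 2^-1 ^+ K.
  by rewrite gerBl mulr_ge0// exprn_ge0.
elim: K NK => [|K IH]; first by rewrite leqn0 => /eqP ->; rewrite big_geq// subrr.
rewrite leq_eqVlt => /predU1P[->|NK]; first by rewrite big_geq// subrr.
by rewrite big_nat_recr//= IH// exprS; field.
Qed.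

Lemma derive1n_sum th i n x : (forall k, smooth (th k)) ->
  smooth (fun x => \sum_(0 <= k < n) th k x) /\
  derive1n i (fun x => \sum_(0 <= k < n) th k x) x = \sum_(0 <= k < n) derive1n i (th k) x.
Proof.
move=> sth; elim: n => [|n [sn IH]].
  under eq_fun do rewrite big_nil.
  by rewrite big_nil derive1n_cst0; split; first exact: smooth_cst.
under eq_fun do rewrite big_nat_recr//=.
split; first exact: (smoothD _ _ sn (sth n)).
by rewrite (derive1nD i _ _ sn (sth n)) IH big_nat_recr.
Qed.

(** The Taylor remainders of the partial sums are bounded uniformly through their second
    derivatives, and the bound passes to the limit, which gives termwise differentiation. The
    conclusion keeps the tail estimates because the gliding hump needs the remainder of the series
    in a seminorm. *)
Lemma smooth_series A th (D : nat -> R) : (forall k, tst A (th k)) ->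
  (forall i k x, `|derive1n i (th k) x| <= D i * 2^-1 ^+ k) ->
  exists2 Th, tst A Th & forall i N M,
    (forall K x, (N <= K)%N -> `|\sum_(N <= k < K) derive1n i (th k) x| <= M) ->
    forall x, `|derive1n i (fun y => Th y - \sum_(0 <= k < N) th k y) x| <= M.
Proof.
move=> tth HD.
pose S i n x := \sum_(0 <= k < n) derive1n i (th k) x.
have D0 i : 0 <= D i by have := HD i 0%N 0; rewrite expr0 mulr1; apply: le_trans.
have Scvg i x : cvgn (fun n => S i n x).
  apply: normed_cvg; apply: (@series_le_cvg _ _ (fun k => D i * 2^-1 ^+ k)) => [n|n|n|].
  - exact: normr_ge0.
  - by rewrite mulr_ge0// exprn_ge0.
  - exact: HD.
  - apply: nondecreasing_is_cvgn.
      by apply: nondecreasing_series => n _ _; rewrite mulr_ge0// exprn_ge0.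
    exists (D i * 2) => _ [n _ <-]; rewrite /series/= -mulr_sumr ler_wpM2l//.
    by have := @geometric_tail 0 n (leq0n _); rewrite expr0 mulr1.
pose F i x := limn (fun n => S i n x).
have FS i x : (fun n => S i n x) @ \oo --> F i x by exact: Scvg.
have sth k : smooth (th k) by have [] := tth k.
have SE i n : derive1n i (fun x => S 0%N n x) = S i n.
  by apply/funext => x; have [] := derive1n_sum th i n x sth.
have sS i n : smooth (S i n).
  by rewrite -SE; apply: smooth_derive1n; have [] := derive1n_sum th 0 n 0 sth.
have dS i n : derive1 (S i n) = S i.+1 n by rewrite -(SE i) -derive1nS SE.
have SM i n x : `|S i n x| <= D i * 2.
  apply: (le_trans (ler_norm_sum _ _ _)).
  apply: (@le_trans _ _ (\sum_(0 <= k < n) D i * 2^-1 ^+ k)).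
    by apply: ler_sum => k _; exact: HD.
  rewrite -mulr_sumr ler_wpM2l//.
  by have := @geometric_tail 0 n (leq0n _); rewrite expr0 mulr1.
have dF i x : is_derive x 1 (F i) (F i.+1 x).
  have Q h : `|F i (x + h) - F i x - h * F i.+1 x| <= D i.+2 * 2 * h ^+ 2.
    apply: (@cvg_norm_le (fun n => S i n (x + h) - S i n x - h * S i.+1 n x) _ _ 0).
      apply: cvgB; first by apply: cvgB; exact: FS.
      by apply: cvgMr; exact: FS.
    move=> n _; rewrite -dS; apply: taylor_le; first exact: sS.
    by move=> z; rewrite /derive1n/= !dS; exact: SM.
  apply: is_derive_eps => e e0.
  have D2 : 0 < D i.+2 * 2 + 1 by rewrite ltr_wpDl// mulr_ge0.
  exists (e / (D i.+2 * 2 + 1)); first by rewrite divr_gt0.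
  move=> h; rewrite ltr_pdivlMr// => hr; apply: (le_trans (Q h)).
  rewrite -(real_normK (num_real h)) expr2 mulrA ler_wpM2r//.
  by rewrite mulrDr mulr1 in hr; rewrite mulrC; have := normr_ge0 h; lra.
have [sF FE] := smooth_family F dF.
exists (F 0%N).
  split=> // x Ax; apply: cvg_lim => //.
  rewrite (_ : (fun n => _) = fun=> 0); first exact: cvg_cst.
  by apply/funext => n; rewrite /S big1// => k _; have [_] := tth k; apply.
move=> i N M HM x.
have [sN EN] := derive1n_sum th i N x sth.
rewrite (derive1nB i _ _ sF sN) EN FE.
apply: (@cvg_norm_le (fun n => S i n x - S i N x) _ _ N).
  by apply: cvgB; [exact: FS|exact: cvg_cst].
by move=> n Nn; rewrite /S (@big_cat_nat _ _ _ N 0%N n)//= [X in `|X|]addrAC subrr add0r; exact: HM.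
Qed.

Lemma tail_dominated th i (c : R) N K : 0 <= c ->
  (forall k x, (N <= k)%N -> `|derive1n i (th k) x| <= c * 2^-1 ^+ k) -> (N <= K)%N ->
  forall x, `|\sum_(N <= k < K) derive1n i (th k) x| <= c * (2 * 2^-1 ^+ N).
Proof.
move=> c0 H NK x; apply: (le_trans (ler_norm_sum _ _ _)).
apply: (@le_trans _ _ (\sum_(N <= k < K) c * 2^-1 ^+ k)).
  by rewrite !big_nat; apply: ler_sum => k /andP[Nk _]; exact: H.
by rewrite -mulr_sumr ler_wpM2l// geometric_tail.
Qed.

End SmoothSeries.

Lemma ex_choice {X Y : Type} (P : X -> Y -> Prop) :
  (forall x, exists y, P x y) -> exists f, forall x, P x (f x).
Proof. by move=> /choice[f Hf]; exists f. Qed.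

Section UniformBoundedness.
Context {R : realType}.
Implicit Types (g : (R -> R) -> R) (th phi : R -> R) (x y A C M t T : R) (i j k m n : nat).

(** The pointwise hypothesis of a uniform boundedness principle for the functionals
    [t^-1 * g (dil x t phi)]. It is weaker than a point value, and still holds where a primitive
    jumps. *)
Definition point_bounded g x := forall A phi, tst A phi ->
  exists B d, 0 < d /\ forall t, 0 < t < d -> `|g (dil x t phi)| <= B * t.

Lemma dist_sum g A (th : nat -> R -> R) n : is_distribution g -> (forall k, tst A (th k)) ->
  g (fun y => \sum_(0 <= k < n) th k y) = \sum_(0 <= k < n) g (th k) /\
  tst A (fun y => \sum_(0 <= k < n) th k y).
Proof.
move=> dg tth; elim: n => [|n [IH tn]].
  by under eq_fun do rewrite big_nil; rewrite big_nil dist0//; split=> //; exact: tst0.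
under eq_fun do rewrite big_nat_recr//=.
by rewrite (distD _ _ _ _ dg tn (tth n)) IH big_nat_recr//; split=> //; exact: tstD.
Qed.

(** This comes from continuity alone: one order [m] serves all scales up to [T], as the supports
    stay in a fixed ball, but [Q t] may blow up as t tends to 0. Its monotonicity lets one scale
    control all larger ones. *)
Lemma dil_dist_bound g x A T : is_distribution g -> 0 <= A -> 0 < T ->
  exists (Q : R -> R) m, (forall t, 0 < t -> 0 <= Q t) /\
   [/\ (forall s t, 0 < s <= t -> Q t <= Q s) &
    forall t phi M, 0 < t <= T -> tst A phi -> bounded_upto m M phi ->
      `|g (dil x t phi)| <= Q t * t * M].
Proof.
move=> dg A0 T0; have [C [m [C0 HC]]] := dist_bound g (T * A + `|x|) dg.
exists (fun t => t^-1 * C * Num.max 1 (t^-1 ^+ m)), m; split; [|split].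
- by move=> t t0; rewrite !mulr_ge0// ?invr_ge0 ?(ltW t0)// le_max ler01.
- move=> s t /andP[s0 st]; have t0 := lt_le_trans s0 st.
  have vts : t^-1 <= s^-1 by rewrite lef_pV2.
  have vt0 : 0 <= t^-1 by rewrite invr_ge0 ltW.
  apply: ler_pM; rewrite ?mulr_ge0//; first by rewrite le_max ler01.
    by rewrite ler_wpM2r.
  rewrite ge_max !le_max lexx/=; apply/orP; right.
  by apply: lerXn2r; rewrite ?nnegrE// (le_trans vt0).
- move=> t phi M /andP[t0 tT] tp bp.
  have tn : t != 0 by rewrite gt_eqF.
  rewrite (_ : _ * t * M = C * (M * Num.max 1 (t^-1 ^+ m))); last by field.
  apply: HC; last by apply: bounded_dil => //; have [] := tp.
  by apply: tst_le (tst_dil _ x _ _ t0 tp); rewrite lerD2r ler_wpM2r.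
Qed.

(* Gliding hump: test functions violating the bound more and more strongly are summed with
   coefficients so small that each of them dominates both its predecessors and its successors. *)
Lemma uniform_boundedness g x A T : is_distribution g -> point_bounded g x -> 0 <= A -> 0 < T ->
  exists C m, 0 <= C /\ forall t phi M, 0 < t <= T -> tst A phi -> bounded_upto m M phi ->
    `|g (dil x t phi)| <= C * t * M.
Proof.
move=> dg pb A0 T0.
have [Q [m0 [Q0 [Qmono HQ]]]] := dil_dist_bound g x A T dg A0 T0.
have [Bf HB] : exists Bf : (R -> R) -> R, forall phi, 0 <= Bf phi /\
    (tst A phi -> forall t, 0 < t <= T -> `|g (dil x t phi)| <= Bf phi * t).
  apply: (@ex_choice (R -> R) R (fun phi B => 0 <= B /\
    (tst A phi -> forall t, 0 < t <= T -> `|g (dil x t phi)| <= B * t))) => phi.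
  have [tp|ntp] := pselect (tst A phi); last by exists 0.
  have [B [d [d0 HBd]]] := pb A phi tp.
  have [M M0 bM] := tst_bounded m0 A phi tp.
  (* Below [d] the pointwise bound applies; between [d] and [T] the crude constant [Q d] does. *)
  exists (`|B| + Q d * M); split; first by rewrite addr_ge0// mulr_ge0 ?Q0.
  move=> _ t /andP[t0 tT]; rewrite mulrDl.
  have [td|td] := ltP t d.
    apply: (le_trans (HBd t _)); first by rewrite t0.
    apply: (@le_trans _ _ (`|B| * t)); first by rewrite ler_wpM2r ?ler_norm// ltW.
    by rewrite lerDl !mulr_ge0 ?Q0// ltW.
  apply: (le_trans (HQ t phi M _ tp bM)); first by rewrite t0.
  apply: (@le_trans _ _ (Q d * M * t)); last by rewrite lerDr mulr_ge0// ltW.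
  by rewrite mulrAC ler_wpM2r ?(ltW t0)// ler_wpM2r// Qmono// d0.
apply: contrapT => Hneg.
(* A counterexample is normalized to have seminorm at most 1; if [M] is 0, then [phi] is 0 and
   violates nothing. *)
have bad C m : 0 <= C -> exists p : R * (R -> R),
    [/\ 0 < p.1 <= T, tst A p.2, bounded_upto m 1 p.2 & C * p.1 < `|g (dil x p.1 p.2)|].
  move=> C0; apply: contrapT => Hno; apply: Hneg; exists C, m; split=> // t phi M t0T tp bp.
  rewrite leNgt; apply/negP => lt.
  have M0 : 0 <= M by apply: le_trans (bp 0%N 0 _).
  have {M0} [M0|ME] : 0 < M \/ M = 0 by move: M0; rewrite le_eqVlt => /predU1P[->|]; [right|left].
    apply: Hno; exists (t, fun y => M^-1 * phi y) => /=.
    have tp' : tst A (fun y => M^-1 * phi y) by exact: tstZ.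
    split=> //.
      have := boundedZ m M M^-1 phi tp.1 bp.
      by rewrite (gtr0_norm (_ : 0 < M^-1)) ?invr_gt0// mulVf// gt_eqF.
    rewrite -[dil _ _ _]/(fun y => M^-1 * dil x t phi y).
    have t0 : 0 < t by case/andP: t0T.
    rewrite (distZ _ _ _ _ dg (tst_dil _ x _ _ t0 tp)) normrM gtr0_norm ?invr_gt0//.
    by rewrite [ltRHS]mulrC ltr_pdivlMr.
  have phi0 : phi = fun=> 0.
    apply/funext => y; apply/eqP; rewrite -normr_le0 -ME; exact: (bp 0%N y).
  by move: lt; rewrite phi0 -[dil _ _ _]/(fun=> 0) dist0// normr0 ME mulr0 ltxx.
have [pick Hpick] : exists pick : R * nat -> R * (R -> R), forall Cm, 0 <= Cm.1 ->
    [/\ 0 < (pick Cm).1 <= T, tst A (pick Cm).2, bounded_upto Cm.2 1 (pick Cm).2 &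
      Cm.1 * (pick Cm).1 < `|g (dil x (pick Cm).1 (pick Cm).2)|].
  apply: (@ex_choice (R * nat) (R * (R -> R)) (fun Cm p => 0 <= Cm.1 ->
    [/\ 0 < p.1 <= T, tst A p.2, bounded_upto Cm.2 1 p.2 & Cm.1 * p.1 < `|g (dil x p.1 p.2)|])).
  move=> [C m]; have [C0|C0] := leP 0 C; last by exists (0, fun=> 0).
  by have [p Hp] := bad C m C0; exists p => _.
(* In a state [s], [s.1] adds up the bounds [Bf] of the humps chosen so far and [s.2] the constants
   [Q] at their scales. The coefficient brings the seminorm of the new hump down to 2^-k / (1 +
   s.2), negligible at all earlier scales; the violation asked for is so large that it still exceeds
   (k + s.1 + 1) t after this scaling. The order [maxn k m0] eventually covers every derivative, and
   always those up to [m0]. *)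
pose coef k (s : R * R) : R := (2 ^+ k * (1 + s.2))^-1.
pose choose k (s : R * R) := pick ((k%:R + s.1 + 1) * (2 ^+ k * (1 + s.2)), maxn k m0).
pose hump k s y := coef k s * (choose k s).2 y.
pose next k (s : R * R) := (s.1 + Bf (hump k s), s.2 + Q (choose k s).1).
pose st := fix st k := if k is k'.+1 then next k' (st k') else (0, 0) : R * R.
pose th k := hump k (st k).
pose tk k := (choose k (st k)).1.
pose d k := (st k).2. pose b k := (st k).1.
have st0 k : 0 <= b k /\ 0 <= d k.
  elim: k => [|k [b0 d0]]; first by rewrite /b /d.
  have C0 : 0 <= (k%:R + b k + 1) * (2 ^+ k * (1 + d k)).
    by rewrite mulr_ge0 ?addr_ge0// mulr_ge0 ?addr_ge0// exprn_ge0.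
  have [/andP[p0 _] _ _ _] := Hpick (_, maxn k m0) C0.
  by rewrite /b /d /= /next /=; split; apply: addr_ge0 => //; [have [] := HB (hump k (st k))|exact: Q0].
have P k : [/\ 0 < tk k <= T, tst A (th k), bounded_upto (maxn k m0) (2 ^+ k * (1 + d k))^-1 (th k) &
    (k%:R + b k + 1) * tk k < `|g (dil x (tk k) (th k))|].
  have [b0 d0] := st0 k.
  have c0 : 0 < 2 ^+ k * (1 + d k) :> R by rewrite mulr_gt0 ?exprn_gt0// ltr_wpDr.
  have C0 : 0 <= (k%:R + b k + 1) * (2 ^+ k * (1 + d k)).
    by rewrite mulr_ge0 ?addr_ge0// ltW.
  have [t0T tp bp lt] := Hpick (_, maxn k m0) C0; rewrite /= in bp lt t0T tp.
  have t0 : 0 < tk k by case/andP: t0T.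
  split=> //.
  - exact: tstZ.
  - have := boundedZ _ _ (2 ^+ k * (1 + d k))^-1 _ tp.1 bp.
    by rewrite mulr1 gtr0_norm ?invr_gt0.
  - rewrite -[dil _ _ (th k)]/(fun y => coef k (st k) * dil x (tk k) (choose k (st k)).2 y).
    rewrite (distZ _ _ _ _ dg (tst_dil _ x _ _ t0 tp)) normrM (gtr0_norm (_ : 0 < coef k (st k))) ?invr_gt0//.
    by rewrite /coef [ltRHS]mulrC ltr_pdivlMr// mulrAC.
have tth k : tst A (th k) by have [] := P k.
have dmono i j : (i <= j)%N -> d i <= d j.
  elim: j => [|j IH]; first by rewrite leqn0 => /eqP ->.
  rewrite leq_eqVlt => /predU1P[->//|/IH H]; apply: (le_trans H).
  by rewrite /d/= lerDl Q0//; have [/andP[]] := P j.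
have dQ k j : (k < j)%N -> Q (tk k) <= d j.
  move=> kj; apply: le_trans (dmono _ _ kj).
  by rewrite /d/= lerDr; have [] := st0 k.
have cle N k i y : (N <= k)%N -> (i <= maxn k m0)%N ->
    `|derive1n i (th k) y| <= (1 + d N)^-1 * 2^-1 ^+ k.
  move=> Nk ik; have [_ _ bk _] := P k; apply: (le_trans (bk i y ik)).
  have [_ dN0] := st0 N; have [_ dk0] := st0 k.
  rewrite invfM mulrC exprVn; apply: ler_wpM2r; first by rewrite invr_ge0 exprn_ge0.
  by rewrite lef_pV2 ?posrE ?ltr_wpDr// lerD2l dmono.
have [D HD] : exists D : nat -> R, forall i k y, `|derive1n i (th k) y| <= D i * 2^-1 ^+ k.
  apply: (@ex_choice nat R (fun i D => forall k y, `|derive1n i (th k) y| <= D * 2^-1 ^+ k)) => i.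
  (* Hump [k] is controlled only up to order [maxn k m0], so the finitely many [k] below [i] are
     bounded one by one. *)
  suff [D HD] : exists D, forall k, (k < i)%N -> forall y, `|derive1n i (th k) y| <= D * 2^-1 ^+ k.
    exists (`|D| + 1) => k y; have p0 : 0 <= (2^-1 : R) ^+ k by rewrite exprn_ge0.
    have [/HD H|ik] := ltnP k i.
      apply: (le_trans (H y)); rewrite ler_wpM2r//.
      by apply: le_trans (ler_norm D) _; rewrite lerDl.
    have := cle 0%N k i y isT (leq_trans ik (leq_maxl _ _)).
    rewrite /d/= addr0 invr1 mul1r => /le_trans; apply.
    by rewrite ler_peMl// lerDr.
  elim: {-2}i => [|n [D HD]]; first by exists 0.
  have [M M0 HM] := tst_bounded i A (th n) (tth n).
  exists (`|D| + M * 2 ^+ n) => k; rewrite ltnS leq_eqVlt => /predU1P[->|kn] y.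
    rewrite mulrDl -mulrA -exprMn divff// expr1n mulr1.
    by apply: (le_trans (HM i y (leqnn _))); rewrite lerDr mulr_ge0// exprn_ge0.
  apply: (le_trans (HD k kn y)); rewrite ler_wpM2r ?exprn_ge0//.
  by apply: le_trans (ler_norm D) _; rewrite lerDl mulr_ge0// exprn_ge0.
have [Th tTh HTh] := smooth_series A th D tth HD.
have [B0 HBT] := HB Th.
(* At the scale [tk k] the earlier humps contribute at most [b k * tk k], the later ones at most
   [tk k], and hump [k] more than [(k%:R + b k + 1) * tk k]; so [Bf Th] exceeds every [k]. *)
suff : forall k : nat, k%:R <= Bf Th.
  move=> H; have := H (Num.bound (Bf Th)).
  by rewrite leNgt archi_boundP.
move=> k.
have [t0T tthk _ big] := P k; have t0 : 0 < tk k by case/andP: t0T.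
have [dsumE tsum] := dist_sum g A th k.+1 dg tth.
pose Tl := fun y => Th y - \sum_(0 <= j < k.+1) th j y.
have tTl : tst A Tl by exact: tstB.
have [dN0 dd0] := st0 k.+1.
have bTl : bounded_upto m0 ((1 + d k.+1)^-1) Tl.
  move=> i y im; apply: HTh => K z kK.
  have H := tail_dominated th i (1 + d k.+1)^-1 k.+1 K _ _ kK z.
  apply: (le_trans (H _ _)).
  - by rewrite invr_ge0 addr_ge0.
  - by move=> j w kj; apply: cle => //; apply: leq_trans im _; exact: leq_maxr.
  - have h1 : (2^-1 : R) <= 1 by lra.
    by rewrite exprS mulrA divff// mul1r ler_piMr ?exprn_ile1// invr_ge0 addr_ge0.
have Tl1 : `|g (dil x (tk k) Tl)| <= tk k.
  apply: (le_trans (HQ _ _ _ t0T tTl bTl)).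
  rewrite ler_pdivrMr ?ltr_wpDr// mulrC ler_wpM2l//; first exact: ltW.
  by apply: (le_trans (dQ k k.+1 _)) => //; rewrite lerDr.
have headE n : `|\sum_(0 <= j < n) g (dil x (tk k) (th j))| <= b n * tk k.
  elim: n => [|n IH]; first by rewrite big_nil normr0 mulr_ge0// ?ltW//; have [] := st0 0%N.
  rewrite big_nat_recr//= (le_trans (ler_normD _ _))//.
  rewrite -[b n.+1]/(b n + Bf (th n)) mulrDl lerD//.
  by have [_] := HB (th n); apply.
have dE : g (dil x (tk k) Th) = \sum_(0 <= j < k) g (dil x (tk k) (th j)) +
    g (dil x (tk k) (th k)) + g (dil x (tk k) Tl).
  have tdil j := tst_dil A x _ _ t0 (tth j).
  have [E1 _] := dist_sum g _ (fun j => dil x (tk k) (th j)) k.+1 dg tdil.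
  rewrite -big_nat_recr//= -E1 -(distD _ _ _ _ dg _ (tst_dil A x _ _ t0 tTl)).
    by congr g; apply/funext => y; rewrite /dil /Tl [RHS]addrC subrK.
  by have := tst_dil A x _ _ t0 tsum.
have := HBT tTh _ t0T; rewrite dE.
have := headE k.
set X := \sum_(_ <= _ < _) _; set Y := g (dil x (tk k) (th k)) in big *.
set Z := g _ in Tl1 *; move=> hX hXYZ.
have : `|Y| <= `|X + Y + Z| + `|X| + `|Z|.
  have := ler_normB (X + Y + Z - X) Z; have := ler_normB (X + Y + Z) X.
  have -> : X + Y + Z - X - Z = Y by ring.
  lra.
move=> hY; have : (k%:R + b k + 1) * tk k < Bf Th * tk k + b k * tk k + tk k by lra.
rewrite (_ : Bf Th * _ + _ + _ = (Bf Th + b k + 1) * tk k); last by ring.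
by rewrite ltr_pM2r// => H; lra.
Qed.

End UniformBoundedness.

(** * Point values *)

Section PointValues.
Context {R : realType}.
Implicit Types (g : (R -> R) -> R) (phi : R -> R) (x c d t r s e A C M : R).

Lemma near0P (P : R -> Prop) :
  (\forall t \near 0^'+, P t) <-> exists2 d, 0 < d & forall t, 0 < t < d -> P t.
Proof.
split=> [[d /= d0 H]|[d d0 H]].
  exists d => // t /andP[t0 td]; apply: H => //=.
  by rewrite sub0r normrN gtr0_norm.
exists d => //= t /=; rewrite sub0r normrN => td t0; apply: H.
by rewrite t0 -(gtr0_norm t0).
Qed.

Lemma cvg0P (F : R -> R) c : (F t @[t --> 0^'+] --> c) <->
  forall e, 0 < e -> exists2 d, 0 < d & forall t, 0 < t < d -> `|F t - c| <= e.
Proof.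
split=> [/cvgrPdist_le H e /H /near0P[d d0 Hd]|H].
  by exists d => // t /Hd; rewrite distrC.
apply/cvgrPdist_le => e /H[d d0 Hd]; apply/near0P; exists d => // t /Hd.
by rewrite distrC.
Qed.

(** The limit in [point_value] is two-sided; a negative scale is a positive scale for the reflected
    test function, whose integral is the same. *)
Lemma point_valueP g x c : point_value g x c <->
  forall A phi, tst A phi -> t^-1 * g (dil x t phi) @[t --> 0^'+] --> c * intR phi.
Proof.
split=> [H A phi tp|H phi /test_functionP[A A0 tp]].
  have /cvgrPdist_le Hp := H phi (tst_test _ _ tp).
  apply/cvg0P => e /Hp [d /= d0 Hd]; exists d => // t /andP[t0 td].
  have := Hd t; rewrite /= sub0r normrN (gtr0_norm t0) distrC; apply => //.
  by rewrite gt_eqF.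
have /cvg0P H1 := H A phi tp; have /cvg0P H2 := H A _ (tst_opp _ _ tp).
apply/cvgrPdist_le => e e0; have [d1 d10 Hd1] := H1 e e0; have [d2 d20 Hd2] := H2 e e0.
exists (Num.min d1 d2) => /=; first by rewrite lt_min d10.
move=> t /=; rewrite sub0r normrN lt_min => /andP[td1 td2] t0; rewrite distrC.
have [tp0|] := ltP 0 t; first by rewrite (gtr0_norm tp0); apply: Hd1; rewrite tp0 -(gtr0_norm tp0).
rewrite le_eqVlt (negbTE t0)/= => tn0.
have nt0 : 0 < - t by rewrite oppr_gt0.
have := Hd2 (- t); rewrite -(ltr0_norm tn0) normr_gt0 t0 td2 => /(_ isT).
rewrite (intR_opp _ _ tp) (ltr0_norm tn0); congr (`|_ * g _ - _| <= _).
by apply/funext => y; rewrite /dil invrN mulrN opprK.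
Qed.

Lemma point_value_bounded g x c : point_value g x c -> point_bounded g x.
Proof.
move=> /point_valueP H A phi tp; have /cvg0P H1 := H A phi tp.
have [d d0 Hd] := H1 1 ltr01; exists (`|c * intR phi| + 1), d; split=> // t /andP[t0 td].
have := Hd t; rewrite t0 td => /(_ isT) H2.
rewrite -(@ler_pdivrMr _ t)// -(gtr0_norm t0) -normfV -normrM mulrC (gtr0_norm t0).
have := ler_normD (t^-1 * g (dil x t phi) - c * intR phi) (c * intR phi).
by rewrite subrK; lra.
Qed.

Lemma powR_le_neg s x y : s <= 0 -> 0 < x <= y -> y `^ s <= x `^ s.
Proof.
move=> s0 /andP[x0 xy]; have y0 := lt_le_trans x0 xy.
rewrite -(opprK s) (powRN y) (powRN x) lef_pV2 ?posrE ?powR_gt0//.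
have s1 : 0 <= - s by rewrite oppr_ge0.
have xn : x \in Num.nneg by rewrite nnegrE ltW.
have yn : y \in Num.nneg by rewrite nnegrE ltW.
exact: (ge0_ler_powR s1 xn yn xy).
Qed.

Lemma powR_small s e : s < 0 -> 0 < e -> exists2 r, 1 <= r & forall x, r <= x -> x `^ s <= e.
Proof.
move=> s0 e0; exists (Num.max 1 (e `^ s^-1)); first by rewrite le_max lexx.
move=> x; rewrite ge_max => /andP[x1 xe].
rewrite (le_trans (powR_le_neg s (e `^ s^-1) x (ltW s0) _))//.
  by rewrite powR_gt0.
by rewrite -powRrM mulVf ?lt_eqF// powRr1// ltW.
Qed.

Definition decays (a : R) phi := forall m : nat, exists C A,
  forall x, A <= `|x| -> `|derive1n m phi x| <= C * `|x| `^ (a - m%:R).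

Lemma decays_upto (a : R) phi m : decays a phi -> exists C A, [/\ 0 <= C, 1 <= A &
  forall i x, (i <= m)%N -> A <= `|x| -> `|derive1n i phi x| <= C * `|x| `^ (a - i%:R)].
Proof.
move=> H; elim: m => [|m [C [A [C0 A0 HC]]]].
  have [C [A HC]] := H 0%N; exists `|C|, (Num.max 1 A); split=> //; first by rewrite le_max lexx.
  move=> i x; rewrite leqn0 ge_max => /eqP -> /andP[_ Ax]; apply: (le_trans (HC x Ax)).
  by rewrite ler_wpM2r ?powR_ge0// ler_norm.
have [D [B HD]] := H m.+1; exists (C + `|D|), (Num.max A B); split.
- by rewrite addr_ge0.
- by rewrite le_max A0.
- move=> i x; rewrite leq_eqVlt ltnS ge_max => /predU1P[->|im] /andP[Ax Bx].
    apply: (le_trans (HD x Bx)); rewrite ler_wpM2r ?powR_ge0//.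
    by rewrite (le_trans (ler_norm D))// lerDr.
  by apply: (le_trans (HC i x im Ax)); rewrite ler_wpM2r ?powR_ge0// lerDl.
Qed.

(** Vanishes for |y| <= 1 and for |y| >= 4. Dilated by [r] it is [cutr (2 * r) - cutr r], one piece
    of a dyadic decomposition. *)
Definition ring_cut (y : R) : R := plateau (y / 2) - plateau y.

Lemma tst_ring_cut : tst 4 ring_cut.
Proof.
have H := tst_cutr 2 (ltr0n R 2).
by apply: tstB; [apply: tst_le H; lra|apply: tst_le tst_plateau; lra].
Qed.

(** The chain rule gives r^j at the j-th derivative, and the decay of that derivative gives r^(a-j);
    together they are r^a at every order. Here the decay that [T0] prescribes for each derivative
    enters. *)
Lemma annulus_bound (a : R) phi m C A r : smooth phi -> a <= 0 -> 0 <= C -> 1 <= A -> A <= r ->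
  (forall i x, (i <= m)%N -> A <= `|x| -> `|derive1n i phi x| <= C * `|x| `^ (a - i%:R)) ->
  forall Z, 0 <= Z -> bounded_upto m Z ring_cut ->
  bounded_upto m (2 ^+ m * (C * r `^ a) * Z) (fun y => phi (r * y) * ring_cut y).
Proof.
move=> sp a0 C0 A1 Ar HC Z Z0 HZ i y im.
have r0 : 0 < r by apply: lt_le_trans Ar; lra.
have M0 : 0 <= C * r `^ a by rewrite mulr_ge0 ?powR_ge0.
have [y1|y1] := ltP `|y| 1.
  have E : \forall z \near y, phi (r * z) * ring_cut z = (fun=> 0) z.
    near=> z; have z1 : `|z| < 1.
      near: z; have : \forall w \near `|y|, w < 1 by exact: lt_nbhsl.
      by move=> /norm_continuous.
    rewrite /ring_cut plateau1; first by rewrite plateau1 ?subrr ?mulr0// ltW.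
    by rewrite normrM normfV (@ger0_norm _ 2)//; lra.
  rewrite (nbhs_singleton (near_derive1n i _ _ _ E)) derive1n_cst0 normr0.
  by rewrite !mulr_ge0 ?exprn_ge0 ?powR_ge0.
have sr : smooth (fun z => phi (r * z)).
  by have := smooth_affine _ r 0 sp; under eq_fun do rewrite addr0.
have Er j : derive1n j (fun z => phi (r * z)) y = r ^+ j * derive1n j phi (r * y).
  have := derive1n_affine j phi r 0 sp; under eq_fun do rewrite addr0.
  by move=> /(congr1 (fun F => F y)) ->; rewrite addr0.
have := @derive1nM_bound R i (fun z => phi (r * z)) ring_cut y (C * r `^ a) Z 1 sr tst_ring_cut.1 ltr01 M0 Z0.
rewrite expr1n divr1 => H; apply: (le_trans (H _ _)).
- move=> j ji; rewrite expr1n divr1 Er normrM (ger0_norm (exprn_ge0 j (ltW r0))).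
  have ry : A <= `|r * y|.
    by rewrite normrM (gtr0_norm r0) (le_trans Ar)// ler_peMr// ltW.
  apply: (le_trans (ler_wpM2l (exprn_ge0 j (ltW r0)) (HC j _ (leq_trans ji im) ry))).
  rewrite mulrCA ler_wpM2l// -(powR_mulrn j (ltW r0)).
  apply: (@le_trans _ _ (r `^ j%:R * r `^ (a - j%:R))).
    rewrite ler_wpM2l ?powR_ge0// powR_le_neg//.
      by rewrite subr_le0 (le_trans a0).
    by rewrite r0/= normrM (gtr0_norm r0) ler_peMr// ltW.
  by rewrite -powRD ?(gt_eqF r0) ?implybT// addrC subrK.
- by move=> j ji; rewrite expr1n divr1; apply: HZ; exact: leq_trans im.
- by rewrite ler_wpM2r// ler_wpM2r// ler_weXn2l// ler1n.
Unshelve. all: by end_near. Qed.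

End PointValues.

(** * From compactly supported test functions to [T0] *)

Section RadialLimits.
Context {R : realType}.
Local Notation mu := (@lebesgue_measure R).
Implicit Types (g : (R -> R) -> R) (phi : R -> R) (x c d t r s e A C M : R).

(** An annulus of radius [r] seen at scale [t] is a fixed annulus seen at scale [r * t], where
    [uniform_boundedness] applies. *)
Lemma annulus_step g x phi r t A : is_distribution g -> smooth phi -> 0 < r -> 0 < t ->
  g (dil x t (fun y => cutr (2 * r) y * phi y)) - g (dil x t (fun y => cutr r y * phi y)) =
  g (dil x (r * t) (fun y => phi (r * y) * ring_cut y)).
Proof.
move=> dg sp r0 t0.
have t2 : tst (2 * (2 * r)) (cutr (2 * r)) by apply: tst_cutr; rewrite mulr_gt0.
have t1 : tst (2 * (2 * r)) (cutr r) by apply: tst_le (tst_cutr _ r0); lra.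
have T2 := tst_dil _ x t _ t0 (tstMl _ _ _ t2 sp).
have T1 := tst_dil _ x t _ t0 (tstMl _ _ _ t1 sp).
rewrite -(distB _ _ _ _ dg T2 T1); congr g; apply/funext => y.
have tn : t != 0 by rewrite gt_eqF.
have rn : r != 0 by rewrite gt_eqF.
rewrite /dil /ring_cut /cutr -mulrBl mulrC; congr (phi _ * (plateau _ - plateau _)); field;
  rewrite ?rn ?tn//.
Qed.

(** Each dyadic annulus contributes O(t r^(1+al)): a factor r t from its scale and r^al from the
    decay. As al < -1, the contributions of r, 2r, 4r, ... are dominated by a geometric series.
    Finitely many annuli suffice, since a cutoff that is 1 near [a, b] already computes the
    pairing. *)
Lemma tail_bound a b g x (al : R) phi : a <= b -> Eprime a b g -> point_bounded g x ->
  smooth phi -> al < -1 -> decays al phi ->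
  exists C A, [/\ 0 <= C, 1 <= A & forall r t, A <= r -> 0 < t ->
   `|pairing g (dil x t phi) - g (dil x t (fun y => cutr r y * phi y))| <= t * (C * r `^ (1 + al))].
Proof.
move=> ab Eg pb sp al1 dec; have dg := Eg.1.
pose T := hull_radius a b + `|x|.
have T0 : 0 < T by rewrite ltr_wpDr// hull_radius_gt0.
have [Cg [m [Cg0 HCg]]] := uniform_boundedness g x 4 T dg pb (ler0n _ 4) T0.
have [C [A [C0 A1 HC]]] := decays_upto _ _ m dec.
have [Z Z0 HZ] := tst_bounded m 4 _ (@tst_ring_cut R).
pose c0 := Cg * (2 ^+ m * C * Z).
have c00 : 0 <= c0 by rewrite /c0 !mulr_ge0 ?exprn_ge0.
pose th : R := 2 `^ (1 + al).
have th1 : th < 1.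
  have := @gt0_ltr_powR R (- (1 + al)) _ 1 2; rewrite !nnegrE => /(_ _ ler01 (ler0n _ 2)) H.
  have : 1 < 2 `^ (- (1 + al)) :> R by have := H ltac:(lra) ltac:(lra); rewrite powR1.
  by rewrite powRN -[X in X < _]invr1 ltf_pV2 ?posrE ?powR_gt0.
(* The sum of the geometric series, so that the contribution of one annulus is the difference
   [E r - E (2 * r)] and telescopes. *)
pose E r := c0 * r `^ (1 + al) / (1 - th).
have dth : 0 < 1 - th by rewrite subr_gt0.
have E0 r : 0 <= E r by rewrite !mulr_ge0 ?powR_ge0// invr_ge0 ltW.
have E2 r : 0 < r -> c0 * r `^ (1 + al) = E r - E (2 * r).
  move=> r0; rewrite /E powRM ?(ltW r0)// -/th; field.
  by rewrite gt_eqF.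
have step1 r t : A <= r -> 0 < t -> r * t <= T ->
    `|g (dil x t (fun y => cutr (2 * r) y * phi y)) - g (dil x t (fun y => cutr r y * phi y))|
      <= t * (E r - E (2 * r)).
  move=> Ar t0 rtT; have r0 : 0 < r by apply: lt_le_trans Ar; lra.
  rewrite annulus_step// -E2//.
  have sphi : smooth (fun y => phi (r * y)).
    by have := smooth_affine _ r 0 sp; under eq_fun do rewrite addr0.
  have al0 : al <= 0 by lra.
  have HB := annulus_bound al phi m C A r sp al0 C0 A1 Ar HC Z Z0 HZ.
  apply: (le_trans (HCg _ _ _ _ (tstMr _ _ _ sphi tst_ring_cut) HB)).
    by rewrite mulr_gt0.
  rewrite powRD ?(gt_eqF r0) ?implybT// powRr1 ?(ltW r0)// /c0.
  by rewrite le_eqVlt; apply/orP; left; apply/eqP; ring.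
have steps J r t : A <= r -> 0 < t -> (forall j, (j < J)%N -> 2 ^+ j * r * t <= T) ->
    `|g (dil x t (fun y => cutr (2 ^+ J * r) y * phi y)) - g (dil x t (fun y => cutr r y * phi y))|
      <= t * (E r - E (2 ^+ J * r)).
  move=> Ar t0; have r0 : 0 < r by apply: lt_le_trans Ar; lra.
  elim: J => [_|J IH HJ]; first by rewrite expr0 !mul1r !subrr mulr0 normr0.
  have {}IH := IH (fun j jJ => HJ j (ltnW jJ)).
  have Ar' : A <= 2 ^+ J * r.
    by rewrite (le_trans Ar)// ler_peMl ?(ltW r0)// exprn_ege1// ler1n.
  have := step1 _ _ Ar' t0 (HJ J (ltnSn J)).
  rewrite mulrA -exprS; set u := g _ in IH *; set v := g _ in IH *; set w := g _ => H.
  rewrite (_ : w - v = (w - u) + (u - v)); last by ring.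
  rewrite (_ : t * _ = t * (E (2 ^+ J * r) - E (2 ^+ J.+1 * r)) + t * (E r - E (2 ^+ J * r))); last by ring.
  by rewrite (le_trans (ler_normD _ _))// lerD.
exists (c0 / (1 - th)), A; split=> //; first by rewrite divr_ge0// ltW.
move=> r t Ar t0; have r0 : 0 < r by apply: lt_le_trans Ar; lra.
(* The least [J] for which the cutoff is 1 near [a, b]; by minimality all scales used before are at
   most [T], as [uniform_boundedness] requires. *)
have [J HJ Jmin] : exists2 J : nat, T <= 2 ^+ J * r * t & forall j, (j < J)%N -> 2 ^+ j * r * t <= T.
  have ex : exists n, T <= 2 ^+ n * r * t.
    have rt0 : 0 < r * t by rewrite mulr_gt0.
    exists (Num.bound (T / (r * t))); rewrite -mulrA -ler_pdivrMr//.
    have := archi_boundP (divr_ge0 (ltW T0) (ltW rt0)); set n := Num.bound _ => H.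
    by apply: (le_trans (ltW H)); rewrite -natrX ler_nat ltnW// ltn_expl.
  case: (ex_minnP ex) => J HJ Hmin; exists J => // j jJ; rewrite leNgt; apply/negP => /ltW /Hmin.
  by rewrite leqNgt jJ.
have := steps J r t Ar t0 Jmin.
have -> : pairing g (dil x t phi) = g (dil x t (fun y => cutr (2 ^+ J * r) y * phi y)).
  have r1 : 0 < 2 ^+ J * r by rewrite mulr_gt0// exprn_gt0.
  have sd := smooth_dil x t phi sp.
  have tc := tst_dil _ x t _ t0 (tst_cutr _ r1).
  rewrite (pairingP g a b _ (dil x t (cutr (2 ^+ J * r))) `]x - T, x + T[%classic ab Eg (tst_test _ _ tc) _ _ _ sd)//.
  - move=> y /=; rewrite !in_itv/= => /hull_radius_norm H.
    have := ler_norm y; have := ler_norm (- y); rewrite normrN /T.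
    by have := ler_norm x; have := ler_norm (- x); rewrite normrN; lra.
  - move=> y /=; rewrite in_itv/= => yT; rewrite /dil cutr1//.
    rewrite normrM normfV (gtr0_norm t0) ler_pdivrMr// (le_trans _ HJ)//.
    by rewrite ler_norml; lra.
move=> /le_trans; apply; rewrite ler_wpM2l ?(ltW t0)//.
have := E0 (2 ^+ J * r); rewrite {2}/E mulrAC; lra.
Qed.

Lemma intR_cutr_cvg phi : smooth phi -> (forall y, 0 <= phi y) ->
  (\int[mu]_y (phi y)%:E = 1)%E ->
  intR (fun y => cutr n.+1%:R y * phi y) @[n --> \oo] --> (1 : R).
Proof.
move=> sp p0 i1.
have mphi (h : R -> R) : smooth h -> measurable_fun [set: R] h.
  by move=> sh; apply: continuous_measurable_fun => y; exact: smooth_continuous.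
have ip : mu.-integrable setT (EFin \o phi).
  apply/integrableP; split; first by apply/measurable_EFinP; exact: mphi.
  suff -> : (\int[mu]_y `|(EFin \o phi) y| = 1)%E by rewrite ltry.
  by rewrite -i1; apply: eq_integral => y _ /=; rewrite ger0_norm.
have sc n : smooth (fun y => cutr n.+1%:R y * phi y).
  by apply: (smoothM _ _ _ sp); have [] := @tst_cutr R n.+1%:R (ltr0Sn _ n).
have H := @dominated_cvg _ _ _ mu setT measurableT
  (fun n y => (cutr n.+1%:R y * phi y)%:E) (fun y => (phi y)%:E) (fun y => (phi y)%:E).
have {}H := H (fun n => iffRL (measurable_EFinP _ _) (mphi _ (sc n))).
have : (\int[mu]_y (cutr n.+1%:R y * phi y)%:E)%E @[n --> \oo] --> (1 : R)%:E.
  rewrite -i1; apply: H => //.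
  - move=> y _; apply: cvg_near_cst; exists (Num.bound `|y|) => // n /= bn.
    rewrite cutr1 ?mul1r ?ltr0Sn//.
    have := archi_boundP (normr_ge0 y) => /ltW /le_trans; apply.
    by rewrite ler_nat (leq_trans bn).
  - move=> n y _; rewrite lee_fin ger0_norm; last by rewrite mulr_ge0// /cutr plateau_ge0.
    by rewrite ler_piMl// /cutr plateau_le1.
by move=> /fine_cvg.
Qed.

(** The part of [phi] beyond a radius [r] contributes little, uniformly in [t], by [tail_bound]; the
    part within is a test function, whose integral tends to 1 as [r] grows. *)
Lemma T0_limit a b g x c phi : a <= b -> Eprime a b g -> point_value g x c -> T0 phi ->
  scaled_pairing g phi x t @[t --> 0^'+] --> c.
Proof.
move=> ab Eg pv [sp p0 i1 [al al1 dec]].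
have [C [A [C0 A1 HC]]] := tail_bound a b g x al phi ab Eg (point_value_bounded _ _ _ pv) sp al1 dec.
apply/cvg0P => e e0.
have e3 : 0 < e / 3 by lra.
have C1 : 0 < C + 1 by lra.
have [r1 r11 Hr1] := @powR_small R (1 + al) (e / 3 / (C + 1)) ltac:(lra) ltac:(by rewrite divr_gt0).
have [n [nA nr nI]] : exists n : nat, [/\ A <= n.+1%:R, r1 <= n.+1%:R &
    `|c * intR (fun y => cutr n.+1%:R y * phi y) - c| <= e / 3].
  have H : c * intR (fun y => cutr n.+1%:R y * phi y) @[n --> \oo] --> c * 1.
    by apply: cvgM; [exact: cvg_cst|exact: intR_cutr_cvg].
  rewrite mulr1 in H; have /cvgrPdist_le /(_ _ e3) [N _ HN] := H.
  exists (N + Num.bound (Num.max A r1))%N.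
  have A0 : 0 <= Num.max A r1 by rewrite le_max; lra.
  have := archi_boundP A0; rewrite gt_max => /andP[hA hr].
  have B k : (k%:R : R) <= (N + k).+1%:R by rewrite ler_nat leqW// leq_addl.
  split; [exact: le_trans (ltW hA) (B _)|exact: le_trans (ltW hr) (B _)|].
  by rewrite distrC; apply: HN; rewrite /= leq_addr.
set r : R := n.+1%:R in nA nr nI.
have r0 : 0 < r by rewrite /r ltr0Sn.
have tc := tstMl _ _ _ (tst_cutr _ r0) sp.
have /cvg0P /(_ _ e3) [d d0 Hd] := iffLR (point_valueP g x c) pv _ _ tc.
exists d => // t td; have t0 : 0 < t by case/andP: td.
have := Hd t td; have := HC r t nA t0.
rewrite /scaled_pairing (gtr0_norm t0) -/(dil x t phi).
set X := pairing _ _; set Y := g _; set I := intR _ in nI * => H1 H2.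
have H3 : `|t^-1 * X - t^-1 * Y| <= e / 3.
  rewrite -mulrBr normrM gtr0_norm ?invr_gt0// mulrC ler_pdivrMr// mulrC.
  apply: (le_trans H1); rewrite ler_wpM2l ?(ltW t0)//.
  apply: (le_trans (ler_wpM2l C0 (Hr1 r nr))).
  rewrite mulrCA ler_piMr ?(ltW e3)// ler_pdivrMr//; lra.
rewrite (_ : t^-1 * X - c = (t^-1 * X - t^-1 * Y) + ((t^-1 * Y - c * I) + (c * I - c))); last by ring.
rewrite (le_trans (ler_normD _ _))//.
have := ler_normD (t^-1 * Y - c * I) (c * I - c); lra.
Qed.

End RadialLimits.

(** * Products and primitives *)

Section Operations.
Context {R : realType}.
Implicit Types (g u v U : (R -> R) -> R) (f F phi psi : R -> R) (x c d t r s e A C M : R).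

Definition mulD psi g phi : R := g (fun y => psi y * phi y).
Definition linD c u v phi : R := c * u phi + v phi.
(** [intR phi - prim phi y] is the integral of [phi] over [y, +oo), so this is the primitive of [u]
    that vanishes to the left of its support. *)
Definition primD u phi : R := pairing u (fun y => intR phi - prim phi y).
Definition mass u : R := pairing u (fun=> 1).

Lemma bounded_local m A H N f phi : smooth f -> tst A phi -> 0 <= H -> 0 <= N ->
  (forall i y, (i <= m)%N -> `|y| <= A -> `|derive1n i f y| <= H) -> bounded_upto m N phi ->
  bounded_upto m (2 ^+ m * H * N) (fun y => f y * phi y).
Proof.
move=> sf tp H0 N0 HH HN i y im; have [yA|yA] := leP `|y| A; last first.
  have tf := tstMr _ _ _ sf tp.
  by rewrite (supp_derive1n i A _ tf.2 y yA) normr0 !mulr_ge0// exprn_ge0.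
have := @derive1nM_bound R i f phi y H N 1 sf tp.1 ltr01 H0 N0; rewrite expr1n divr1 => K.
apply: (le_trans (K _ _)).
- by move=> j ji; rewrite expr1n divr1; apply: HH => //; exact: leq_trans im.
- by move=> j ji; rewrite expr1n divr1; apply: HN; exact: leq_trans im.
- by rewrite ler_wpM2r// ler_wpM2r// ler_weXn2l// ler1n.
Qed.

Lemma dist_mulD psi g : smooth psi -> is_distribution g -> is_distribution (mulD psi g).
Proof.
move=> sp dg; apply: dist_intro => [A c f phi A0 tf tp|A A0].
  rewrite /mulD -(dist_L g A c _ _ dg (tstMr _ _ _ sp tf) (tstMr _ _ _ sp tp)).
  by congr g; apply/funext => y; rewrite mulrDr mulrCA.
have [C [m [C0 HC]]] := dist_bound g A dg.
have [H H0 HH] := smooth_local_bound m A psi sp.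
exists (C * (2 ^+ m * H)), m => f M tf bf.
have M0 : 0 <= M by apply: le_trans (bf 0%N 0 _).
rewrite -mulrA; apply: HC; first exact: tstMr.
exact: bounded_local HH bf.
Qed.

Lemma supported_mulD psi g (K : set R) : smooth psi -> supported_in g K ->
  supported_in (mulD psi g) K.
Proof.
move=> sp sg phi tphi spK; have [A A0 tp] := iffLR (test_functionP phi) tphi.
apply: sg; first exact: (tst_test _ _ (tstMr _ _ _ sp tp)).
apply: subset_trans spK; apply: closure_subset => y /=; apply: contraNN => /eqP ->.
by rewrite mulr0.
Qed.

Lemma Eprime_mulD a b psi g : smooth psi -> Eprime a b g -> Eprime a b (mulD psi g).
Proof. by move=> sp [dg sg]; split; [exact: dist_mulD|exact: supported_mulD]. Qed.

Lemma dist_linD c u v : is_distribution u -> is_distribution v -> is_distribution (linD c u v).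
Proof.
move=> du dv; apply: dist_intro => [A k f phi A0 tf tp|A A0].
  by rewrite /linD (dist_L _ _ _ _ _ du tf tp) (dist_L _ _ _ _ _ dv tf tp); ring.
have [C [m [C0 HC]]] := dist_bound u A du; have [D [n [D0 HD]]] := dist_bound v A dv.
exists (`|c| * C + D), (maxn m n) => f M tf bf.
rewrite /linD (le_trans (ler_normD _ _))// mulrDl lerD//.
  rewrite normrM -mulrA ler_wpM2l//; apply: HC => //.
  by apply: bounded_le bf => //; exact: leq_maxl.
by apply: HD => //; apply: bounded_le bf => //; exact: leq_maxr.
Qed.

Lemma Eprime_linD a b c u v : Eprime a b u -> Eprime a b v -> Eprime a b (linD c u v).
Proof.
move=> [du su] [dv sv]; split; first exact: dist_linD.
by move=> phi tp sp; rewrite /linD su// sv// mulr0 addr0.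
Qed.

Lemma pairing_mulD a b psi g F : a <= b -> smooth psi -> Eprime a b g -> smooth F ->
  pairing (mulD psi g) F = pairing g (fun y => psi y * F y).
Proof.
move=> ab sp Eg sF; rewrite (pairingE _ a b (hull_radius a b) _ ab (Eprime_mulD _ _ _ _ sp Eg) (lexx _) sF).
rewrite (pairingE _ a b (hull_radius a b) _ ab Eg (lexx _) (smoothM _ _ sp sF)).
by congr g; apply/funext => y; rewrite mulrCA.
Qed.

Lemma pairing_linD a b c u v F : a <= b -> Eprime a b u -> Eprime a b v -> smooth F ->
  pairing (linD c u v) F = c * pairing u F + pairing v F.
Proof.
move=> ab Eu Ev sF; have Ew := Eprime_linD a b c u v Eu Ev.
by rewrite !(pairingE _ a b (hull_radius a b) _ ab _ (lexx _) sF).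
Qed.

Lemma smooth_tail A phi : tst A phi -> smooth (fun y => intR phi - prim phi y).
Proof. by move=> tp; exact: (smoothB _ _ (smooth_cst _) (smooth_prim _ _ tp)). Qed.

Lemma derive1_tail A phi : tst A phi ->
  derive1 (fun y => intR phi - prim phi y) = fun y => - phi y.
Proof.
move=> tp; rewrite (derive1B _ _ (smooth_cst _) (smooth_prim _ _ tp)) derive1_const (derive1_prim _ _ tp).
by apply/funext => y; rewrite sub0r.
Qed.

(** 4A + 5 is 2A + 2 twice, for the two terms at order 0, plus 1 for the higher orders, which are
    derivatives of [- phi]. *)
Lemma bounded_tail m A M phi : tst A phi -> 0 <= A -> bounded_upto m M phi ->
  bounded_upto m (M * (4 * A + 5)) (fun y => intR phi - prim phi y).
Proof.
move=> tp A0 bp.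
have M0 : 0 <= M by apply: le_trans (bp 0%N 0 _).
have E : M * (4 * A + 5) = M * (2 * A + 2) + M * (2 * A + 2) + M by ring.
have MA : 0 <= M * (2 * A + 2) by rewrite mulr_ge0//; lra.
move=> [|i] y im.
  have H z := prim_bound A phi z M tp A0 (fun z => bp 0%N z (leq0n _)).
  rewrite derive1n0 (le_trans (ler_normB _ _))//.
  by have := H y; have := H (A + 1); rewrite (prim_right _ _ _ tp.2); lra.
rewrite derive1Sn (derive1_tail _ _ tp).
have -> : (fun y => - phi y) = fun y => -1 * phi y by apply/funext => z; rewrite mulN1r.
rewrite (derive1nZ i _ _ tp.1) mulN1r normrN.
by have := bp i y (ltnW im); lra.
Qed.

Lemma dist_primD a b u : a <= b -> Eprime a b u -> is_distribution (primD u).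
Proof.
move=> ab Eu; apply: dist_intro => [A c f phi A0 tf tp|A A0].
  rewrite /primD -(pairingL _ a b c _ _ ab Eu (smooth_tail _ _ tf) (smooth_tail _ _ tp)).
  by congr pairing; apply/funext => y; rewrite (intRL A)// (primL A)//; ring.
have r0 := hull_radius_gt0 a b; set r := hull_radius a b in r0.
have [C [m [C0 HC]]] := dist_bound u (2 * r) Eu.1.
have tc := tst_cutr _ r0.
have [Z Z0 HZ] := tst_bounded m _ _ tc.
exists (C * (2 ^+ m * Z * (4 * A + 5))), m => f M tf bf.
have M0 : 0 <= M by apply: le_trans (bf 0%N 0 _).
have st := smooth_tail _ _ tf.
rewrite /primD (pairingE _ a b r _ ab Eu (lexx _) st).
rewrite (_ : C * _ * M = C * (2 ^+ m * Z * (M * (4 * A + 5)))); last by ring.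
apply: HC; first exact: tstMl.
apply: (boundedM m Z _ _ _ tc.1 st Z0 _ HZ (bounded_tail _ _ _ _ tf A0 bf)).
by rewrite mulr_ge0//; lra.
Qed.

Lemma is_derivative_primD a b u : a <= b -> Eprime a b u -> is_derivative (primD u) u.
Proof.
move=> ab Eu phi /test_functionP[A A0 tp].
rewrite /primD (intR_derive1 _ _ tp).
have -> : prim (derive1 phi) = phi.
  apply/esym; apply: (prim_unique A _ _ (- A) (tst_derive1 _ _ tp)).
  - by move=> x; exact: smooth_is_derive tp.1.
  - by move=> x xA; apply: tp.2; rewrite -normrN; apply: lt_le_trans (ler_norm _); lra.
have -> : (fun y => 0 - phi y) = fun y => -1 * phi y by apply/funext => y; rewrite mulN1r sub0r.
by rewrite (pairing_tst u a b A _ ab Eu (tstZ _ _ _ tp)) (distZ _ _ _ _ Eu.1 tp) mulN1r opprK.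
Qed.

Lemma primD_left a b u A e phi : a <= b -> Eprime a b u -> tst A phi -> 0 < e ->
  (forall z, a - e < z -> phi z = 0) -> primD u phi = 0.
Proof.
move=> ab Eu tp e0 H.
rewrite /primD (pairingE _ a b _ _ ab Eu (lexx _) (smooth_tail _ _ tp)).
have tc := tst_cutr _ (hull_radius_gt0 a b).
rewrite -[RHS](dist0 u Eu.1).
apply: (dist_eq_on u a b `]a - e, +oo[%classic _ _ _ Eu _ _ (tstMl _ _ _ tc (smooth_tail _ _ tp)) (tst0 _)).
- exact: rray_open.
- by move=> y /=; rewrite !in_itv/= andbT => /andP[ay _]; lra.
- move=> y /=; rewrite in_itv/= andbT => ay; rewrite prim_eq_intR ?subrr ?mulr0// => z yz.
  by apply: H; lra.
Qed.

Lemma primD_right a b u A e phi : a <= b -> Eprime a b u -> tst A phi -> 0 < e ->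
  (forall z, z < b + e -> phi z = 0) -> primD u phi = intR phi * mass u.
Proof.
move=> ab Eu tp e0 H.
rewrite /primD /mass (pairingE _ a b _ _ ab Eu (lexx _) (smooth_tail _ _ tp)).
rewrite (pairingE _ a b _ _ ab Eu (lexx _) (smooth_cst _)).
have tc := tst_cutr _ (hull_radius_gt0 a b).
rewrite -(distZ _ _ _ _ Eu.1 (tstMl _ _ _ tc (smooth_cst 1))).
apply: (dist_eq_on u a b `]-oo, b + e[%classic _ _ _ Eu _ _ (tstMl _ _ _ tc (smooth_tail _ _ tp))).
- exact: lray_open.
- by move=> y /=; rewrite !in_itv/= => /andP[_ yb]; lra.
- exact: (tstZ _ _ _ (tstMl _ _ _ tc (smooth_cst 1))).
- move=> y /=; rewrite in_itv/= => yb; rewrite prim_eq0 ?subr0 ?mulr1// 1?mulrC// => z zy.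
  by apply: H; lra.
Qed.

(* A bump supported in [1, 2], respectively [-2, -1]. *)
Definition bump_right (y : R) := bump01 (y - 1).
Definition bump_left (y : R) := bump_right (- y).

Lemma tst_bump_right : tst 2 bump_right.
Proof.
split; first by have := smooth_affine _ 1 (-1) (@smooth_bump01 R); under eq_fun do rewrite mul1r.
move=> y y2; apply: bump01_out; apply/negP => /andP[y0 y1].
by rewrite gtr0_norm in y2; lra.
Qed.

Lemma tst_bump_left : tst 2 bump_left.
Proof. exact: tst_opp tst_bump_right. Qed.

Lemma bump_right0 y : y <= 1 -> bump_right y = 0.
Proof. by move=> y1; apply: bump01_out; apply/negP => /andP[y0 _]; lra. Qed.

Lemma bump_left0 y : -1 <= y -> bump_left y = 0.
Proof. by move=> y1; apply: bump_right0; lra. Qed.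

Lemma intR_bump_right : 0 < intR bump_right.
Proof.
have -> : bump_right = dil 1 1 bump01 by apply/funext => y; rewrite /dil divr1.
by rewrite (intR_dil _ _ _ _ ltr01 tst_bump01) mul1r intR_bump01_gt0.
Qed.

Lemma intR_bump_left : 0 < intR bump_left.
Proof. by rewrite (intR_opp _ _ tst_bump_right); exact: intR_bump_right. Qed.

Lemma cvg_cst_eq c d : (fun=> c) @ (0:R)^'+ --> d -> c = d.
Proof. by move=> H; apply: (cvg_unique (@Rhausdorff R) _ H); exact: cvg_cst. Qed.

Lemma near_cvg (F G : R -> R) d : (forall t, 0 < t -> F t = G t) ->
  F @ (0:R)^'+ --> d -> G @ (0:R)^'+ --> d.
Proof.
move=> FG /cvg0P H; apply/cvg0P => e /H [r r0 Hr]; exists r => // t tr.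
by rewrite -FG; [exact: Hr|case/andP: tr].
Qed.

(** The difference of two primitives kills all derivatives, hence is a multiple of [intR]. Bumps to
    the left of [a] identify the factor as 0: [primD u] vanishes on them and [U] has the value 0 at
    [a]. *)
Lemma primitive_unique a b u U : a <= b -> Eprime a b u -> is_distribution U ->
  is_derivative U u -> point_value U a 0 -> forall A phi, tst A phi -> U phi = primD u phi.
Proof.
move=> ab Eu dU U'u Ua.
pose D := linD (-1) (primD u) U.
have dD : is_distribution D by apply: dist_linD => //; exact: dist_primD ab Eu.
have D' A phi : tst A phi -> D (derive1 phi) = 0.
  move=> tp; have := U'u phi (tst_test _ _ tp); have := is_derivative_primD _ _ _ ab Eu phi (tst_test _ _ tp).
  by rewrite /D /linD; lra.
have b0 : intR (@bump01 R) != 0 by rewrite gt_eqF// intR_bump01_gt0.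
have DE A phi : tst A phi -> D phi = D bump01 / intR bump01 * intR phi.
  move=> tp; pose B := Num.max A 1.
  have tb : tst B bump01 by apply: tst_le tst_bump01; rewrite le_max lexx orbT.
  have tpB : tst B phi by apply: tst_le tp; rewrite le_max lexx.
  (* With this multiple of the bump added the integral is 0, and the antiderivative is itself a test
     function. *)
  pose k := - (intR phi / intR bump01).
  have tq : tst B (fun y => k * bump01 y + phi y) by apply: tstD => //; exact: tstZ.
  have q0 : intR (fun y => k * bump01 y + phi y) = 0.
    by rewrite (intRL B)// /k mulNr divfK// addNr.
  have tP : tst B (prim (fun y => k * bump01 y + phi y)).
    split; first exact: smooth_prim tq.
    move=> y; rewrite ltr_normr => /orP[By|By].
      by rewrite (prim_right _ _ _ tq.2 By).
    by rewrite (prim_left _ _ _ tq.2)//; lra.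
  have := D' B _ tP; rewrite (derive1_prim _ _ tq) (dist_L _ _ _ _ _ dD tb tpB) /k => H.
  by rewrite mulrAC -mulrA; apply/eqP; rewrite -subr_eq0 -H; apply/eqP; ring.
suff D0 : D bump01 = 0.
  move=> A phi tp; have := DE A phi tp; rewrite D0 !mul0r /D /linD; lra.
have /point_valueP /(_ _ _ tst_bump_left) := Ua; rewrite mul0r.
have E t : 0 < t -> t^-1 * U (dil a t bump_left) = D bump01 / intR bump01 * intR bump_left.
  move=> t0; have td := tst_dil _ a t _ t0 tst_bump_left.
  have P0 : primD u (dil a t bump_left) = 0.
    apply: (primD_left a b u _ t _ ab Eu td t0) => z az; apply: bump_left0.
    by rewrite ler_pdivlMr//; lra.
  have := DE _ _ td; rewrite /D {1}/linD P0 mulr0 add0r => ->.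
  by rewrite (intR_dil _ _ _ _ t0 tst_bump_left) mulrCA mulKf ?gt_eqF// mulrA.
move=> /(near_cvg _ _ _ E) /cvg_cst_eq /eqP.
by rewrite !mulf_eq0 invr_eq0 (negbTE b0) (gt_eqF intR_bump_left) !orbF => /eqP.
Qed.

Lemma primD_value_left a b u c : a <= b -> Eprime a b u -> point_value (primD u) a c -> c = 0.
Proof.
move=> ab Eu /point_valueP /(_ _ _ tst_bump_left).
have E t : 0 < t -> t^-1 * primD u (dil a t bump_left) = 0.
  move=> t0; have td := tst_dil _ a t _ t0 tst_bump_left.
  rewrite (primD_left a b u _ t _ ab Eu td t0) ?mulr0// => z az; apply: bump_left0.
  by rewrite ler_pdivlMr//; lra.
move=> /(near_cvg _ _ _ E) /cvg_cst_eq/esym /eqP.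
by rewrite mulf_eq0 (gt_eqF intR_bump_left) orbF => /eqP.
Qed.

(** A point value can be read off from one side: to the right of [b] the primitive is the constant
    [mass u]. *)
Lemma primD_value_right a b u c : a <= b -> Eprime a b u -> point_value (primD u) b c ->
  c = mass u.
Proof.
move=> ab Eu /point_valueP /(_ _ _ tst_bump_right).
have E t : 0 < t -> t^-1 * primD u (dil b t bump_right) = mass u * intR bump_right.
  move=> t0; have td := tst_dil _ b t _ t0 tst_bump_right.
  rewrite (primD_right a b u _ t _ ab Eu td t0).
    by rewrite (intR_dil _ _ _ _ t0 tst_bump_right) -mulrA mulKf ?gt_eqF// mulrC.
  move=> z zb; apply: bump_right0.
  by rewrite ler_pdivrMr//; lra.
move=> /(near_cvg _ _ _ E) /cvg_cst_eq/esym.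
by apply: mulIf; rewrite gt_eqF// intR_bump_right.
Qed.

End Operations.

(** * Multiplication by a factor that vanishes at the point *)

Section ProductsAndPrimitives.
Context {R : realType}.
Implicit Types (g u v h U : (R -> R) -> R) (f F phi psi : R -> R) (a b x c d t r s e A C M : R).

(** Taylor's formula bounds the value, the mean value theorem the first derivative, and the chain
    rule factor t^i, with t <= 1, all higher ones. The order t^2 is what compensates the two
    divisions by [t] in the point value of a derivative. *)
Lemma taylor2_bound m psi phi A x : smooth psi -> tst A phi -> 0 <= A ->
  exists K, 0 <= K /\ forall t, 0 < t <= 1 ->
    bounded_upto m (K * t ^+ 2)
      (fun y => (psi (t * y + x) - psi x - t * derive1 psi x * y) * phi y).
Proof.
move=> sp tp A0.
pose r := `|x| + A + 1.
have r0 : 0 < r by rewrite /r; have := normr_ge0 x; lra.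
(* [psi] is cut off beyond the points t y + x that occur, which makes its derivatives globally
   bounded. *)
have tP := tstMl _ _ _ (tst_cutr _ r0) sp.
set P := (fun y => cutr r y * psi y) in tP.
have PE t y : 0 < t <= 1 -> `|y| <= A -> P (t * y + x) = psi (t * y + x).
  move=> /andP[t0 t1] yA; rewrite /P cutr1 ?mul1r// (le_trans (ler_normD _ _))//.
  rewrite normrM (gtr0_norm t0); have : t * `|y| <= A by rewrite (le_trans _ yA)// ler_piMl.
  by rewrite /r; lra.
have Px : P x = psi x by rewrite /P cutr1 ?mul1r// /r; have := normr_ge0 x; lra.
have Px1 : derive1 P x = derive1 psi x.
  have E : \forall z \near x, P z = psi z.
    near=> z; rewrite /P cutr1 ?mul1r//; apply: ltW; near: z.
    have : \forall w \near `|x|, w < r by apply: lt_nbhsl; rewrite /r; lra.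
    by move=> /norm_continuous.
  exact: nbhs_singleton (near_derive1n 1 _ _ _ E).
have [M M0 HM] := tst_bounded m.+2 _ _ tP.
have [N N0 HN] := tst_bounded m _ _ tp.
exists (2 ^+ m * (M * (A + 1) ^+ 2) * N); split; first by rewrite !mulr_ge0 ?exprn_ge0//; lra.
move=> t t01; have /andP[t0 t1] := t01.
have -> : (fun y => (psi (t * y + x) - psi x - t * derive1 psi x * y) * phi y) =
    fun y => (P (t * y + x) - P x - t * derive1 P x * y) * phi y.
  apply/funext => y; have [yA|yA] := leP `|y| A; first by rewrite PE// Px Px1.
  by rewrite tp.2// !mulr0.
rewrite (_ : _ * t ^+ 2 = 2 ^+ m * (M * (A + 1) ^+ 2 * t ^+ 2) * N); last by ring.
have sP : smooth (fun y => P (t * y + x)) by exact: smooth_affine tP.1.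
have sP1 : smooth (fun y => P (t * y + x) - P x) by exact: smoothB _ _ sP (smooth_cst _).
have sl : smooth (fun y => t * derive1 P x * y) by exact: smoothZ smooth_id.
have sh := smoothB _ _ sP1 sl.
have H0 : 0 <= M * (A + 1) ^+ 2 * t ^+ 2 by rewrite !mulr_ge0 ?exprn_ge0 ?(ltW t0)//; lra.
apply: (bounded_local m A _ N _ _ sh tp H0 N0 _ HN) => i y im yA.
have A1 : 1 <= (A + 1) ^+ 2 by rewrite exprn_ege1//; lra.
have t2 : 0 <= t ^+ 2 by rewrite exprn_ge0// ltW.
case: i im => [|[|i]] im.
- rewrite derive1n0.
  have := taylor_le P x (t * y) M tP.1 (fun z => HM 2%N z isT).
  rewrite [x + _]addrC mulrAC => /le_trans; apply.
  rewrite -mulrA ler_wpM2l// exprMn mulrC ler_wpM2r// -(real_normK (num_real y)).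
  by apply: lerXn2r; rewrite ?nnegrE//; lra.
- rewrite (derive1nB 1 _ _ sP1 sl) (derive1nB 1 _ _ sP (smooth_cst _)) (derive1n_affine 1 P t x tP.1).
  rewrite !expr1 derive1n_const.
  rewrite (derive1nZ 1 _ _ smooth_id) (_ : derive1n 1 (fun z : R => z) y = 1); last by rewrite /derive1n/= derive1_idfun.
  rewrite subr0 mulr1 -mulrBr normrM (gtr0_norm t0).
  have := mvt_le (derive1 P) x (t * y + x) M (smooth_derive1 _ tP.1) (fun z => HM 2%N z isT).
  rewrite addrK normrM (gtr0_norm t0) => H.
  apply: (le_trans (ler_wpM2l (ltW t0) H)).
  rewrite (_ : t * (M * (t * `|y|)) = M * `|y| * t ^+ 2); last by ring.
  by rewrite ler_wpM2r// ler_wpM2l// (le_trans yA)// expr2; nra.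
- rewrite (derive1nB i.+2 _ _ sP1 sl) (derive1nB i.+2 _ _ sP (smooth_cst _)) (derive1n_affine i.+2 P t x tP.1).
  rewrite derive1n_const.
  rewrite (derive1nZ i.+2 _ _ smooth_id) (_ : derive1n i.+2 (fun z : R => z) y = 0); last first.
    by rewrite !derive1Sn derive1_idfun derive1_const derive1n_cst0.
  rewrite mulr0 !subr0 normrM normrX (gtr0_norm t0) mulrC.
  apply: ler_pM => //; first by rewrite exprn_ge0// ltW.
    by apply: (le_trans (HM i.+2 _ (leqW (ltnW im)))); rewrite ler_peMr.
  by rewrite -(addn2 i) exprD ler_piMl// exprn_ile1// ltW.
Unshelve. all: by end_near. Qed.

Lemma dil_shift x t psi phi : t != 0 ->
  (fun y => psi y * dil x t phi y) = dil x t (fun y => psi (t * y + x) * phi y).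
Proof. by move=> t0; apply/funext => y; rewrite /dil; congr (psi _ * _); field. Qed.

Lemma tst_le_ge0 A phi : tst A phi -> exists2 B, 0 <= B & tst B phi.
Proof. by move=> tp; exists `|A| => //; exact: tst_le (ler_norm A) tp. Qed.

Lemma cvg0_le (F : R -> R) C : (forall t, 0 < t <= 1 -> `|F t| <= C * t) ->
  F @ (0:R)^'+ --> (0:R).
Proof.
move=> H; apply/cvg0P => e e0; exists (Num.min 1 (e / (`|C| + 1))).
  by rewrite lt_min ltr01 divr_gt0// ltr_wpDl.
move=> t /andP[t0]; rewrite lt_min => /andP[t1 te]; rewrite subr0.
apply: (le_trans (H t _)); first by rewrite t0 ltW.
move: te; rewrite ltr_pdivlMr ?ltr_wpDl// => te.
have : C * t <= `|C| * t by rewrite ler_wpM2r ?ler_norm// ltW.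
by rewrite mulrDr mulr1 [t * _]mulrC in te; lra.
Qed.

(* The factor [psi - psi x] vanishes at [x], which compensates the derivative in [U' = u]. *)
Lemma point_value_flat a b u U x c psi : smooth psi -> is_distribution U -> is_derivative U u ->
  point_value U x c -> point_value (mulD (fun y => psi y - psi x) u) x 0.
Proof.
move=> sp dU U'u pv; apply/point_valueP => A0 phi /tst_le_ge0[A A1 tp]; rewrite mul0r.
have [C [m [C0 HC]]] := uniform_boundedness U x A 1 dU (point_value_bounded _ _ _ pv) A1 ltr01.
have [K [K0 HK]] := taylor2_bound m.+1 psi phi A x sp tp A1.
have tyq : tst A (fun y => y * phi y) by exact: tstMr _ _ _ smooth_id tp.
(* The linear part of [psi] tests [U] on the derivative of y phi(y), whose integral is 0. The
   remainder [e t] is O(t^2) against two divisions by [t], and [uniform_boundedness] contributes one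
   more factor [t]. *)
have H1 : t^-1 * U (dil x t (derive1 (fun y => y * phi y))) @[t --> (0:R)^'+] --> (0 : R).
  have := iffLR (point_valueP U x c) pv A _ (tst_derive1 _ _ tyq).
  by rewrite (intR_derive1 _ _ tyq) mulr0.
pose e t := fun y => (psi (t * y + x) - psi x - t * derive1 psi x * y) * phi y.
have te t : tst A (e t).
  apply: tstMr tp; apply: (smoothB _ _ _ (smoothZ _ _ smooth_id)).
  exact: smoothB _ _ (smooth_affine _ t x sp) (smooth_cst _).
rewrite -[X in _ --> X]addr0 -[X in _ --> X + _](mulr0 (- derive1 psi x)).
apply: (@near_cvg R (fun t => - derive1 psi x * (t^-1 * U (dil x t (derive1 (fun y => y * phi y)))) +
   - (t^-1 ^+ 2 * U (dil x t (derive1 (e t)))))).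
  move=> t t0; have tn : t != 0 by rewrite gt_eqF.
  have sk : smooth (fun y => psi (t * y + x) - psi x).
    exact: smoothB _ _ (smooth_affine _ t x sp) (smooth_cst _).
  have tk := tstMr _ _ _ sk tp.
  have := dil_shift x t (fun y => psi y - psi x) phi tn; rewrite /mulD => ->.
  have Tk := tst_dil _ x _ _ t0 tk.
  rewrite (U'u _ (tst_test _ _ Tk)) (derive1_dil x t _ tk.1).
  have -> : derive1 (fun y => (psi (t * y + x) - psi x) * phi y) =
      fun y => t * derive1 psi x * derive1 (fun y => y * phi y) y + derive1 (e t) y.
    rewrite (_ : (fun y => (psi (t * y + x) - psi x) * phi y) =
        fun y => t * derive1 psi x * (y * phi y) + e t y); last by apply/funext => y; rewrite /e; ring.
    by rewrite (derive1D _ _ (smoothZ _ _ tyq.1) (te t).1) (derive1Z _ _ tyq.1).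
  have T1 := tst_dil _ x _ _ t0 (tst_derive1 _ _ tyq).
  have T2 := tst_dil _ x _ _ t0 (tst_derive1 _ _ (te t)).
  have T3 : tst (t * A + `|x|) (dil x t (fun y => t * derive1 psi x * derive1 (fun y => y * phi y) y + derive1 (e t) y)).
    exact: (tstD _ _ _ (tstZ _ (t * derive1 psi x) _ T1) T2).
  rewrite (distZ _ _ _ _ dU T3) -[dil _ _ (fun y => _ + _)]/(fun y => t * derive1 psi x * dil x t (derive1 (fun y => y * phi y)) y + dil x t (derive1 (e t)) y).
  by rewrite (dist_L _ _ _ _ _ dU T1 T2); field.
apply: cvgD; first by apply: cvgM => //; exact: cvg_cst.
apply: (cvg0_le _ (C * K)) => t t01; have /andP[t0 t1] := t01.
have := HC _ _ _ t01 (tst_derive1 _ _ (te t)) (bounded_derive1 _ _ _ (HK t t01)) => H.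
rewrite normrN normrM normrX normfV (gtr0_norm t0).
apply: (le_trans (ler_wpM2l _ H)); first by rewrite exprn_ge0// invr_ge0 ltW.
have tn : t != 0 by rewrite gt_eqF.
by rewrite le_eqVlt; apply/orP; left; apply/eqP; field.
Qed.

End ProductsAndPrimitives.

(** * Point values of primitives *)

Section Primitives.
Context {R : realType}.
Implicit Types (g u v h U : (R -> R) -> R) (f F phi psi : R -> R) (a b x c d t r s e A C M : R).

Local Notation tail phi := (fun y => intR phi - prim phi y).

Lemma primD_dil a b h x t A phi : a <= b -> Eprime a b h -> 0 < t -> tst A phi ->
  t^-1 * primD h (dil x t phi) = pairing h (dil x t (tail phi)).
Proof.
move=> ab Eh t0 tp; rewrite /primD (intR_dil _ _ _ _ t0 tp) (prim_dil _ _ _ _ t0 tp).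
have sd : smooth (dil x t (tail phi)) by apply: smooth_dil; exact: smooth_tail tp.
have -> : (fun y => t * intR phi - t * prim phi ((y - x) / t)) =
   fun y => t * dil x t (tail phi) y + (fun=> 0) y.
  by apply/funext => y; rewrite addr0 -mulrBr.
rewrite (pairingL _ a b t _ _ ab Eh sd (smooth_cst 0)).
rewrite (pairing_tst h a b 0 _ ab Eh (tst0 0)) (dist0 _ Eh.1) addr0 mulKf//.
by rewrite gt_eqF.
Qed.

(** A tail is not compactly supported, but two tails at different scales agree outside a bounded
    set. The ratio of scales is kept in [1, 2] to make the seminorm bound uniform. *)
Lemma tail_quotient m A phi mu M : tst A phi -> 0 <= A -> 1 <= mu <= 2 -> 0 <= M ->
  bounded_upto m M (tail phi) ->
  let Th := fun y => tail phi y - tail phi (mu * y) in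
  tst A Th /\ bounded_upto m (M + 2 ^+ m * M) Th.
Proof.
move=> tp A0 /andP[m1 m2] M0 HM Th; have st := smooth_tail _ _ tp.
have smu : smooth (fun y => tail phi (mu * y + 0)) by exact: smooth_affine st.
have smu' : smooth (fun y => tail phi (mu * y)).
  by move: smu; under eq_fun do rewrite addr0.
have sTh : smooth Th by exact: smoothB _ _ st smu'.
split.
  split=> // y; rewrite ltr_normr /Th => /orP[yA|yA].
    have ymA : A < mu * y by rewrite (lt_le_trans yA)// ler_peMl//; lra.
    by rewrite !(prim_right _ _ _ tp.2)// !subrr.
  have my : - y <= mu * (- y) by rewrite ler_peMl//; lra.
  have ymA : mu * y < - A by lra.
  by rewrite !(prim_left _ _ _ tp.2)//; lra.
move=> i y im; rewrite /Th (derive1nB i _ _ st smu').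
have E : derive1n i (fun y => tail phi (mu * y)) y = mu ^+ i * derive1n i (tail phi) (mu * y).
  have := derive1n_affine i _ mu 0 st; rewrite (_ : (fun y => tail phi (mu * y + 0)) = fun y => tail phi (mu * y)).
    by move=> ->; rewrite addr0.
  by apply/funext => z; rewrite addr0.
rewrite E (le_trans (ler_normB _ _))// lerD//; first exact: HM.
rewrite normrM; apply: ler_pM => //; last exact: HM.
have mu0 : 0 <= mu by lra.
rewrite ger0_norm ?exprn_ge0//; apply: (@le_trans _ _ (2 ^+ i)).
  by apply: lerXn2r; rewrite ?nnegrE.
by rewrite ler_weXn2l// ler1n.
Qed.

(** Halving the scale repeatedly, the errors C t, C t / 2, C t / 4, ... add up to at most 2 C t. *)
Lemma dyadic_cauchy (G : R -> R) C : 0 <= C ->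
  (forall t s, 0 < t <= 1 -> t / 2 <= s <= t -> `|G t - G s| <= C * t) ->
  forall t s, 0 < t <= 1 -> 0 < s <= t -> `|G t - G s| <= 2 * C * t.
Proof.
move=> C0 H t s t01 /andP[s0 st].
have [n Hn] : exists n, t / 2 ^+ n <= s.
  exists (Num.bound (t / s)); have t0 : 0 < t by case/andP: t01.
  have := archi_boundP (divr_ge0 (ltW t0) (ltW s0)); set n := Num.bound _ => K.
  rewrite ler_pdivrMr ?exprn_gt0// mulrC -ler_pdivrMr//.
  by apply: (le_trans (ltW K)); rewrite -natrX ler_nat ltnW// ltn_expl.
elim: n t t01 st Hn => [|n IH] t /andP[t0 t1] st Hn.
  have -> : s = t by apply/eqP; rewrite eq_le st; move: Hn; rewrite expr0 divr1.
  by rewrite subrr normr0 !mulr_ge0// ltW.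
have [ts|ts] := leP (t / 2) s.
  have := H t s _ _; rewrite t0 t1 ts st => /(_ isT isT) => K.
  by apply: (le_trans K); have := mulr_ge0 C0 (ltW t0); lra.
have h1 : 0 < t / 2 <= 1 by lra.
have h2 : t / 2 / 2 ^+ n <= s by move: Hn; rewrite exprS invfM mulrA.
have := IH (t / 2) h1 (ltW ts) h2.
have := H t (t / 2) _ _; rewrite t0 t1 => /(_ isT); rewrite lexx ler_pdivrMr// => /(_ _) K.
have {K}K := K ltac:(lra).
rewrite (_ : G t - G s = (G t - G (t / 2)) + (G (t / 2) - G s)); last by ring.
by have := ler_normD (G t - G (t / 2)) (G (t / 2) - G s); lra.
Qed.

Lemma cauchy_at_right (G : R -> R) C : 0 <= C ->
  (forall t s, 0 < t <= 1 -> 0 < s <= t -> `|G t - G s| <= C * t) ->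
  exists l : R, G @ (0:R)^'+ --> l.
Proof.
move=> C0 H; apply/cvg_ex; apply/cauchy_cvgP; apply: cauchy_exP => e e0.
pose t0 := Num.min 1 (e / (C + 1) / 2).
have C1 : 0 < C + 1 by lra.
have t00 : 0 < t0 by rewrite lt_min ltr01 !divr_gt0.
have t01 : t0 <= 1 by rewrite ge_min lexx.
exists (G t0); apply/near0P; exists t0 => // s /andP[s0 st].
rewrite /ball/=; apply: (@le_lt_trans _ _ (C * t0)); first by apply: H; rewrite ?t00 ?s0 ?(ltW st).
have : t0 <= e / (C + 1) / 2 by rewrite ge_min lexx orbT.
rewrite ler_pdivlMr// ler_pdivlMr// => K.
have : C * t0 <= (C + 1) * t0 by rewrite ler_wpM2r ?(ltW t00)//; lra.
have : 0 < (C + 1) * t0 by rewrite mulr_gt0.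
by rewrite mulrAC [t0 * _]mulrC in K; lra.
Qed.

(** As for the integral of a bounded function: reducing the scale by at most one half changes the
    mean value of the primitive by [h] on one test function at scale [t], which is O(t), so the mean
    values are Cauchy. The limit depends on [phi] only through its integral, because a [phi] of
    integral 0 has a test function as antiderivative, on which [h] is again O(t). *)
Lemma primD_point_value a b h x : a <= b -> Eprime a b h -> point_bounded h x ->
  exists c, point_value (primD h) x c.
Proof.
move=> ab Eh pb; have dh := Eh.1.
have lim_ex A phi : tst A phi -> exists l : R, pairing h (dil x t (tail phi)) @[t --> (0:R)^'+] --> l.
  move=> /tst_le_ge0[B B0 tp].
  have [C [m [C0 HC]]] := uniform_boundedness h x B 1 dh pb B0 ltr01.
  have [M M0 HM] := tst_bounded m _ _ tp.
  have HT := bounded_tail m B M phi tp B0 HM.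
  have N0 : 0 <= M * (4 * B + 5) by rewrite mulr_ge0//; lra.
  set N := M * _ in HT N0.
  pose K := C * (N + 2 ^+ m * N).
  have K0 : 0 <= K by rewrite mulr_ge0// addr_ge0// mulr_ge0// exprn_ge0.
  apply: (@cauchy_at_right _ (2 * K)); first by rewrite mulr_ge0.
  apply: dyadic_cauchy => // t s t01 /andP[ts st]; have /andP[t0 t1] := t01.
  have s0 : 0 < s by lra.
  have mu12 : 1 <= t / s <= 2 by rewrite ler_pdivlMr// ler_pdivrMr//; lra.
  have [tTh bTh] := tail_quotient m B phi (t / s) N tp B0 mu12 N0 HT.
  have stl := smooth_tail _ _ tp.
  have -> : pairing h (dil x t (tail phi)) - pairing h (dil x s (tail phi)) =
     h (dil x t (fun y => tail phi y - tail phi (t / s * y))).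
    rewrite -(pairing_tst h a b _ _ ab Eh (tst_dil _ x _ _ t0 tTh)).
    rewrite addrC -mulN1r -(pairingL _ a b _ _ _ ab Eh (smooth_dil x s _ stl) (smooth_dil x t _ stl)).
    congr pairing; apply/funext => y; rewrite /dil.
    have -> : t / s * ((y - x) / t) = (y - x) / s by field; rewrite !gt_eqF.
    by rewrite mulN1r addrC.
  apply: (le_trans (HC _ _ _ t01 tTh bTh)).
  by rewrite le_eqVlt; apply/orP; left; apply/eqP; rewrite /K; ring.
have [l0 Hl0] := lim_ex _ _ (@tst_bump01 R).
have ib0 : intR (@bump01 R) != 0 by rewrite gt_eqF// intR_bump01_gt0.
exists (l0 / intR bump01); apply/point_valueP => A phi tp.
apply: (@near_cvg R (fun t => pairing h (dil x t (tail phi)))).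
  by move=> t t0; rewrite (primD_dil a b _ _ _ _ _ ab Eh t0 tp).
pose B := Num.max (`|A|) 1.
have tb : tst B (@bump01 R) by apply: tst_le tst_bump01; rewrite le_max lexx orbT.
have tpB : tst B phi by apply: tst_le tp; rewrite le_max ler_norm.
pose k := - (intR phi / intR bump01).
have tq : tst B (fun y => k * bump01 y + phi y) by apply: tstD => //; exact: tstZ.
have q0 : intR (fun y => k * bump01 y + phi y) = 0.
  by rewrite (intRL B)// /k mulNr divfK// addNr.
have tP : tst B (prim (fun y => k * bump01 y + phi y)).
  split; first exact: smooth_prim tq.
  move=> y; rewrite ltr_normr => /orP[By|By].
    by rewrite (prim_right _ _ _ tq.2 By).
  by rewrite (prim_left _ _ _ tq.2)//; lra.
set q := prim _ in tP.
rewrite (_ : l0 / _ * _ = intR phi / intR bump01 * l0 + - 0); last by ring.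
apply: (@near_cvg R (fun t => intR phi / intR bump01 * pairing h (dil x t (tail bump01)) + - (h (dil x t q)))).
  move=> t t0.
  have sb := smooth_dil x t _ (smooth_tail _ _ tb).
  have tdq := tst_dil _ x _ _ t0 tP.
  rewrite -mulN1r -(distZ _ _ _ _ dh tdq) -(pairing_tst h a b _ _ ab Eh (tstZ _ (-1) _ tdq)).
  rewrite -(pairingL _ a b _ _ _ ab Eh sb (tstZ _ (-1) _ tdq).1).
  congr pairing; apply/funext => y; rewrite /dil /q (primL B)// /k.
  by field.
apply: cvgD; first by apply: cvgM => //; exact: cvg_cst.
apply: cvgN.
have [D [d [d0 HD]]] := pb _ _ tP.
apply/cvg0P => e e0; exists (Num.min d (e / (`|D| + 1))).
  by rewrite lt_min d0 divr_gt0// ltr_wpDl.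
move=> t /andP[t0]; rewrite lt_min => /andP[td te]; rewrite subr0.
apply: (le_trans (HD t _)); first by rewrite t0.
move: te; rewrite ltr_pdivlMr ?ltr_wpDl// => te.
have : D * t <= `|D| * t by rewrite ler_wpM2r ?ler_norm// ltW.
by rewrite mulrDr mulr1 [t * _]mulrC in te; lra.
Qed.

Lemma point_value_linD g h x c d k : point_value g x c -> point_value h x d ->
  point_value (linD k g h) x (k * c + d).
Proof.
move=> /point_valueP Hg /point_valueP Hh; apply/point_valueP => A phi tp.
apply: (@near_cvg R (fun t => k * (t^-1 * g (dil x t phi)) + t^-1 * h (dil x t phi))).
  by move=> t t0; rewrite /linD; ring.
rewrite mulrDl -mulrA; apply: cvgD; last exact: Hh tp.
by apply: cvgM; [exact: cvg_cst|exact: Hg tp].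
Qed.

Lemma point_value_eq g h x c : (forall A phi, tst A phi -> g phi = h phi) ->
  point_value g x c -> point_value h x c.
Proof.
move=> gh /point_valueP H; apply/point_valueP => A phi tp.
apply: near_cvg (H A phi tp) => t t0.
by rewrite (gh _ _ (tst_dil _ x _ _ t0 tp)).
Qed.

(** The distributions that can be the first component of a pair; by [primitive_unique] the second
    component agrees with [primD u] on test functions. *)
Definition good a b u := Eprime a b u /\ forall x, exists c, point_value (primD u) x c.

Lemma primD_linD a b k u v A phi : a <= b -> Eprime a b u -> Eprime a b v -> tst A phi ->
  primD (linD k u v) phi = linD k (primD u) (primD v) phi.
Proof.
by move=> ab Eu Ev tp; rewrite /primD (pairing_linD a b k u v _ ab Eu Ev (smooth_tail _ _ tp)).
Qed.

Lemma good_linD a b k u v : a <= b -> good a b u -> good a b v -> good a b (linD k u v).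
Proof.
move=> ab [Eu gu] [Ev gv]; split; first exact: Eprime_linD.
move=> x; have [c Hc] := gu x; have [d Hd] := gv x; exists (k * c + d).
apply: point_value_eq (point_value_linD _ _ _ _ _ k Hc Hd) => A phi tp.
by rewrite (primD_linD a b k u v _ _ ab Eu Ev tp).
Qed.

Lemma point_value_flat_good a b u x psi : a <= b -> smooth psi -> good a b u ->
  point_value (mulD (fun y => psi y - psi x) u) x 0.
Proof.
move=> ab sp [Eu gu]; have [c Hc] := gu x.
exact: point_value_flat sp (dist_primD _ _ _ ab Eu) (is_derivative_primD _ _ _ ab Eu) Hc.
Qed.

Lemma mulD_split psi u x A phi : smooth psi -> is_distribution u -> tst A phi ->
  mulD psi u phi = linD (psi x) u (mulD (fun y => psi y - psi x) u) phi.
Proof.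
move=> sp du tp; rewrite /mulD /linD.
have sp' : smooth (fun y => psi y - psi x) by exact: smoothB _ _ sp (smooth_cst _).
rewrite -(dist_L _ _ _ _ _ du tp (tstMr _ _ _ sp' tp)).
by congr u; apply/funext => y; ring.
Qed.

Lemma pairing_eq a b u v F : a <= b -> Eprime a b u -> Eprime a b v ->
  (forall A phi, tst A phi -> u phi = v phi) -> smooth F -> pairing u F = pairing v F.
Proof.
move=> ab Eu Ev uv sF; rewrite (pairingE _ a b _ _ ab Eu (lexx _) sF) (pairingE _ a b _ _ ab Ev (lexx _) sF).
by apply: uv; apply: tstMl sF; apply: tst_cutr; exact: hull_radius_gt0.
Qed.

(** At [x], psi u is psi(x) u plus (psi - psi(x)) u. The second term has the point value 0 there, so
    its primitive has a point value by [primD_point_value]. *)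
Lemma good_mulD a b psi u : a <= b -> smooth psi -> good a b u -> good a b (mulD psi u).
Proof.
move=> ab sp gu; have [Eu pu] := gu; split; first exact: Eprime_mulD.
move=> x; have [c Hc] := pu x.
have sp' : smooth (fun y => psi y - psi x) by exact: smoothB _ _ sp (smooth_cst _).
have Eh := Eprime_mulD a b _ _ sp' Eu.
have [d Hd] := primD_point_value a b _ x ab Eh (point_value_bounded _ _ _ (point_value_flat_good a b u x psi ab sp gu)).
exists (psi x * c + d).
apply: point_value_eq (point_value_linD _ _ _ _ _ (psi x) Hc Hd) => A phi tp.
rewrite -(primD_linD a b _ u _ _ _ ab Eu Eh tp) /primD.
apply: (pairing_eq a b _ _ _ ab (Eprime_linD a b _ _ _ Eu Eh) (Eprime_mulD a b _ _ sp Eu)) => [B f tf|].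
  by rewrite (mulD_split psi u x B f sp Eu.1 tf).
exact: smooth_tail tp.
Qed.

End Primitives.

(** * Truncation at a point *)

Section Truncation.
Context {R : realType}.
Implicit Types (g u v h U : (R -> R) -> R) (f F phi psi : R -> R) (a b x c d t r s e A C M : R).

Lemma dist_intR : is_distribution (@intR R).
Proof.
apply: dist_intro => [A c f phi A0 tf tp|A A0]; first exact: intRL tf tp.
exists (2 * A + 2), 0%N => f M tf bf; rewrite mulrC.
have := prim_bound A f (A + 1) M tf A0 (fun z => bf 0%N z isT).
by rewrite (prim_right _ _ _ tf.2) ?ltrDl.
Qed.

Definition unit_left (y : R) : R := (intR bump_left)^-1 * bump_left y.

Lemma tst_unit_left : tst 2 unit_left.
Proof. exact: tstZ tst_bump_left. Qed.

Lemma unit_left0 y : -1 <= y -> unit_left y = 0.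
Proof. by move=> y1; rewrite /unit_left bump_left0// mulr0. Qed.

Lemma intR_unit_left : intR unit_left = 1.
Proof.
have := distZ (@intR R) 2 (intR bump_left)^-1 _ dist_intR tst_bump_left.
by rewrite mulVf ?gt_eqF ?intR_bump_left.
Qed.

(* A smooth step: 1 on (-oo, -2], 0 on [-1, +oo). *)
Definition fade (y : R) : R := intR unit_left - prim unit_left y.

Lemma smooth_fade : smooth fade.
Proof. exact: smooth_tail tst_unit_left. Qed.

Lemma fade_right y : -1 <= y -> fade y = 0.
Proof.
by move=> y1; rewrite /fade prim_eq_intR ?subrr// => z yz; apply: unit_left0; lra.
Qed.

Lemma fade_left y : y <= -2 -> fade y = 1.
Proof.
move=> y1; rewrite /fade intR_unit_left prim_eq0 ?subr0// => z zy.
rewrite /unit_left /bump_left /bump_right bump01_out ?mulr0//.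
by apply/negP => /andP[_]; lra.
Qed.

(** [g] times a smooth step that falls from 1 at c - 2t to 0 at c - t; as t tends to 0 this becomes
    the restriction to (-oo, c). *)
Definition dcut g c phi t : R := g (fun y => phi y * dil c t fade y).

Lemma tst_dcut A c phi t : tst A phi -> tst A (fun y => phi y * dil c t fade y).
Proof. by move=> tp; apply: (tstMl _ _ _ tp); apply: smooth_dil; exact: smooth_fade. Qed.

(** Replacing the step at scale [t] by one at a scale between t / 2 and t tests [g] on a bump at
    scale [t], where it is O(t); [dyadic_cauchy] adds up. The test function lives at a scale [d] at
    least [t], so at scale [t] it is a factor with derivatives bounded by [M]. *)
Lemma dcut_est g c : is_distribution g -> point_bounded g c ->
  exists C m, 0 <= C /\ forall A phi d M, tst A phi -> bounded_upto m M phi -> 0 < d <= 1 ->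
    forall t s, 0 < t <= d -> 0 < s <= t ->
    `|dcut g c (dil c d phi) t - dcut g c (dil c d phi) s| <= C * M * t.
Proof.
move=> dg pb.
have [C [m [C0 HC]]] := uniform_boundedness g c 2 1 dg pb (ler0n _ 2) ltr01.
have [Mb Mb0 HMb] := tst_bounded m _ _ tst_unit_left.
have HT := bounded_tail m 2 _ _ tst_unit_left (ler0n _ 2) HMb.
set N := _ * (4 * 2 + 5) in HT.
have N0 : 0 <= N by rewrite mulr_ge0.
pose K := N + 2 ^+ m * N.
have K0 : 0 <= K by rewrite addr_ge0// mulr_ge0// exprn_ge0.
exists (2 * (C * (2 ^+ m * K))), m; split; first by rewrite !mulr_ge0// exprn_ge0.
move=> A phi d M tp bp /andP[d0 d1].
have M0 : 0 <= M by apply: le_trans (bp 0%N 0 _).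
have key l k : 0 < l <= 1 -> l / 2 <= k <= l ->
    `|dcut g c (dil c d phi) (d * l) - dcut g c (dil c d phi) (d * k)| <= C * (2 ^+ m * K) * M * d * l.
  move=> /andP[l0 l1] /andP[kl lk]; have k0 : 0 < k by lra.
  have mu12 : 1 <= l / k <= 2 by rewrite ler_pdivlMr// ler_pdivrMr//; lra.
  have [tTh bTh] := tail_quotient m 2 _ (l / k) N tst_unit_left (ler0n _ 2) mu12 N0 HT.
  rewrite -/fade in tTh bTh.
  have dl0 : 0 < d * l by rewrite mulr_gt0.
  have dl1 : d * l <= 1 by rewrite mulr_ile1// ltW.
  have td := tst_dil _ c d _ d0 tp.
  rewrite /dcut -(distB _ _ _ _ dg (tst_dcut _ c _ (d * l) td) (tst_dcut _ c _ (d * k) td)).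
  have spl : smooth (fun y => phi (l * y)).
    by have := smooth_affine _ l 0 tp.1; under eq_fun do rewrite addr0.
  have -> : (fun x => dil c d phi x * dil c (d * l) fade x - dil c d phi x * dil c (d * k) fade x) =
      dil c (d * l) (fun y => phi (l * y) * (fade y - fade (l / k * y))).
    apply/funext => y; rewrite /dil.
    have dn : d != 0 by rewrite gt_eqF.
    have ln : l != 0 by rewrite gt_eqF.
    have kn : k != 0 by rewrite gt_eqF.
    have -> : l * ((y - c) / (d * l)) = (y - c) / d by field; rewrite dn ln.
    have -> : l / k * ((y - c) / (d * l)) = (y - c) / (d * k) by field; rewrite dn ln kn.
    by rewrite [RHS]mulrBr.
  have bphi i y : (i <= m)%N -> `|y| <= 2 -> `|derive1n i (fun y => phi (l * y)) y| <= M.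
    move=> im _; have := derive1n_affine i phi l 0 tp.1; under eq_fun do rewrite addr0.
    move=> ->; rewrite addr0 normrM; have l00 := ltW l0.
    rewrite ger0_norm ?exprn_ge0// (le_trans _ (bp i (l * y) im))//.
    by rewrite ler_piMl// exprn_ile1.
  have dl01 : 0 < d * l <= 1 by rewrite dl0.
  have := HC _ _ _ dl01 (tstMr _ _ _ spl tTh) (bounded_local m 2 _ _ _ _ spl tTh M0 _ bphi bTh).
  move=> /(_ K0) /le_trans; apply.
  by rewrite le_eqVlt; apply/orP; left; apply/eqP; rewrite -/K; ring.
move=> t s /andP[t0 td] /andP[s0 st].
have dn : d != 0 by rewrite gt_eqF.
have CK : 0 <= C * (2 ^+ m * K) * M * d.
  by rewrite mulr_ge0 ?(ltW d0)// mulr_ge0// mulr_ge0// mulr_ge0// exprn_ge0.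
have := dyadic_cauchy (fun l => dcut g c (dil c d phi) (d * l)) _ CK key (t / d) (s / d).
rewrite ![d * (_ / d)]mulrC !divfK// !divr_gt0// ler_pdivrMr// mul1r td ler_pM2r ?invr_gt0// st.
move=> /(_ isT isT) /le_trans; apply.
by rewrite le_eqVlt; apply/orP; left; apply/eqP; field.
Qed.

Lemma dil1 c phi : dil c 1 (fun y => phi (y + c)) = phi.
Proof. by apply/funext => y; rewrite /dil divr1 subrK. Qed.

Lemma tst_shift A c phi : tst A phi -> tst (A + `|c|) (fun y => phi (y + c)).
Proof.
move=> [sp sA]; split; first by have := smooth_affine _ 1 c sp; under eq_fun do rewrite mul1r.
move=> y yA; apply: sA; have := ler_normD (y + c) (- c); rewrite addrK normrN; lra.
Qed.

Lemma bounded_shift m M c phi : smooth phi -> bounded_upto m M phi ->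
  bounded_upto m M (fun y => phi (y + c)).
Proof.
move=> sp bp i y im; have := derive1n_affine i phi 1 c sp; under eq_fun do rewrite mul1r.
by move=> ->; rewrite expr1n mul1r mul1r; exact: bp.
Qed.

Definition cutD g c phi : R := lim (dcut g c phi t @[t --> (0:R)^'+]).

Lemma cutD_cvg g c A phi : is_distribution g -> point_bounded g c -> tst A phi ->
  dcut g c phi t @[t --> (0:R)^'+] --> cutD g c phi.
Proof.
move=> dg pb tp; have [C [m [C0 HC]]] := dcut_est g c dg pb.
have tq := tst_shift A c _ tp.
have [M M0 HM] := tst_bounded m _ _ tq.
have d01 : 0 < (1 : R) <= 1 by rewrite ltr01 lexx.
have K0 : 0 <= C * M by rewrite mulr_ge0.
have [l Hl] := cauchy_at_right _ _ K0 (HC _ _ 1 M tq HM d01).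
by rewrite dil1 in Hl; rewrite /cutD (cvg_lim _ Hl).
Qed.

Lemma cutD_unique g c A phi l : is_distribution g -> point_bounded g c -> tst A phi ->
  dcut g c phi t @[t --> (0:R)^'+] --> l -> cutD g c phi = l.
Proof. by move=> dg pb tp H; rewrite /cutD; apply: cvg_lim. Qed.

Lemma cutD_est g c : is_distribution g -> point_bounded g c ->
  exists C m, 0 <= C /\ forall A phi d M, tst A phi -> bounded_upto m M phi -> 0 < d <= 1 ->
    forall t, 0 < t <= d ->
    `|dcut g c (dil c d phi) t - cutD g c (dil c d phi)| <= C * M * t.
Proof.
move=> dg pb; have [C [m [C0 HC]]] := dcut_est g c dg pb.
exists C, m; split=> // A phi d M tp bp d01 t td.
have /andP[d0 _] := d01; have /andP[t0 _] := td.
have /cvg0P H := cutD_cvg g c _ _ dg pb (tst_dil _ c d _ d0 tp).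
rewrite leNgt; apply/negP => lt.
have e0 : 0 < (`|dcut g c (dil c d phi) t - cutD g c (dil c d phi)| - C * M * t) / 2 by lra.
have [r r0 Hr] := H _ e0.
pose s := Num.min t (r / 2).
have s0 : 0 < s by rewrite lt_min t0 divr_gt0.
have sr : s < r by rewrite (@le_lt_trans _ _ (r / 2))// ?ge_min ?lexx ?orbT//; lra.
have st : s <= t by rewrite ge_min lexx.
have h1 := Hr s ltac:(by rewrite s0).
have h2 := HC A phi d M tp bp d01 t s td ltac:(by rewrite s0).
have := ler_normD (dcut g c (dil c d phi) t - dcut g c (dil c d phi) s)
  (dcut g c (dil c d phi) s - cutD g c (dil c d phi)).
by rewrite addrA subrK; lra.
Qed.

(** Linearity passes to the limit, and the seminorm bound is that of [dcut] at scale 1 plus the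
    distance [C * M] from there to the limit. *)
Lemma dist_cutD g c : is_distribution g -> point_bounded g c -> is_distribution (cutD g c).
Proof.
move=> dg pb; apply: dist_intro => [A k f phi A0 tf tp|A A0].
  apply: (cutD_unique _ _ A) => //; first by apply: tstD => //; exact: tstZ.
  apply: (@near_cvg R (fun t => k * dcut g c f t + dcut g c phi t)).
    move=> t t0; rewrite /dcut -(dist_L _ _ _ _ _ dg (tst_dcut _ c _ t tf) (tst_dcut _ c _ t tp)).
    by congr g; apply/funext => y; rewrite mulrDl mulrA.
  apply: cvgD; last exact: cutD_cvg tp.
  by apply: cvgM; [exact: cvg_cst|exact: cutD_cvg tf].
have [C [m [C0 HC]]] := cutD_est g c dg pb.
have [D [n [D0 HD]]] := dist_bound g A dg.
have se : smooth (dil c 1 fade) by apply: smooth_dil; exact: smooth_fade.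
have [H H0 HH] := smooth_local_bound n A _ se.
exists (C + D * (2 ^+ n * H)), (maxn m n) => f M tf bf.
have M0 : 0 <= M by apply: le_trans (bf 0%N 0 _).
have d01 : 0 < (1 : R) <= 1 by rewrite ltr01 lexx.
have bm : bounded_upto m M f by apply: bounded_le bf => //; exact: leq_maxl.
have bn : bounded_upto n M f by apply: bounded_le bf => //; exact: leq_maxr.
have := HC _ _ 1 M (tst_shift A c _ tf) (bounded_shift m M c f tf.1 bm) d01 1 d01.
rewrite dil1 mulr1 => h1.
have h2 : `|dcut g c f 1| <= D * (2 ^+ n * H * M).
  apply: HD; first exact: tst_dcut.
  rewrite (_ : (fun y => f y * _) = fun y => dil c 1 fade y * f y); last by apply/funext => y; rewrite mulrC.
  exact: bounded_local HH bn.
have := ler_normB (dcut g c f 1) (dcut g c f 1 - cutD g c f).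
rewrite opprB addrC subrK => h3.
rewrite (_ : _ * M = C * M + D * (2 ^+ n * H * M)); last by ring.
by apply: (le_trans h3); rewrite addrC lerD.
Qed.

(** At scale [d] the limit is compared with the step at scale [d * l], for a small fixed [l]. The
    error is at most [C * M * (d * l)], and what remains tests [g] at scale [d] on one fixed
    function, where its point value 0 applies. *)
Lemma cutD_point_value g c : is_distribution g -> point_value g c 0 ->
  point_value (cutD g c) c 0.
Proof.
move=> dg pv; have pb := point_value_bounded _ _ _ pv.
have [C [m [C0 HC]]] := cutD_est g c dg pb.
apply/point_valueP => A phi tp; rewrite mul0r.
have [M M0 HM] := tst_bounded m _ _ tp.
apply/cvg0P => e e0.
have CM : 0 < C * M + 1 by rewrite ltr_wpDl// mulr_ge0.
pose l := Num.min 1 (e / 2 / (C * M + 1)).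
have l0 : 0 < l by rewrite lt_min ltr01 !divr_gt0.
have l1 : l <= 1 by rewrite ge_min lexx.
have le2 : C * M * l <= e / 2.
  have : l <= e / 2 / (C * M + 1) by rewrite ge_min lexx orbT.
  by rewrite ler_pdivlMr// => K; rewrite mulrDr mulr1 mulrC in K; lra.
have sl : smooth (dil 0 l fade) by apply: smooth_dil; exact: smooth_fade.
have e2 : 0 < e / 2 by lra.
have /cvg0P /(_ _ e2) [r r0 Hr] := iffLR (point_valueP _ _ _) pv _ _ (tstMl _ _ _ tp sl).
exists (Num.min r 1); first by rewrite lt_min r0 ltr01.
move=> d /andP[d0]; rewrite lt_min => /andP[dr d1]; rewrite subr0.
have := Hr d ltac:(by rewrite d0); rewrite mul0r subr0.
have d01 : 0 < d <= 1 by rewrite d0 ltW.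
have dl : 0 < d * l <= d by rewrite mulr_gt0//= ler_piMr// ltW.
have := HC A phi d M tp HM d01 (d * l) dl.
have -> : dcut g c (dil c d phi) (d * l) = g (dil c d (fun y => phi y * dil 0 l fade y)).
  rewrite /dcut; congr g; apply/funext => y; rewrite /dil subr0 invfM mulrA.
  by congr (_ * fade _).
rewrite !normrM normfV (gtr0_norm d0) => h1 h2.
rewrite mulrC ler_pdivrMr// in h2; rewrite mulrC ler_pdivrMr//.
have h3 : C * M * (d * l) <= e / 2 * d by rewrite mulrCA mulrC ler_wpM2r// ltW.
have := ler_normB (g (dil c d (fun y => phi y * dil 0 l fade y)))
   (g (dil c d (fun y => phi y * dil 0 l fade y)) - cutD g c (dil c d phi)).
rewrite opprB addrC subrK; lra.
Qed.

End Truncation.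

(** * The truncated primitive and its derivative *)

Section TruncateGood.
Context {R : realType}.
Implicit Types (g u v h U : (R -> R) -> R) (f F phi psi : R -> R) (a b x c d t r s e A C M : R).

Lemma point_value_intR x : point_value (@intR R) x 1.
Proof.
apply/point_valueP => A phi tp; rewrite mul1r.
apply: (@near_cvg R (fun=> intR phi)); last exact: cvg_cst.
by move=> t t0; rewrite (intR_dil _ _ _ _ t0 tp) mulKf// gt_eqF.
Qed.

Lemma dil_small A x t e phi z : tst A phi -> 0 < e -> 0 < t -> t < e / (`|A| + 1) ->
  e <= `|z - x| -> dil x t phi z = 0.
Proof.
move=> tp e0 t0; have A1 : 0 < `|A| + 1 by rewrite ltr_wpDl.
rewrite ltr_pdivlMr// => te ez; apply: tp.2.
rewrite normrM normfV (gtr0_norm t0) ltr_pdivlMr// mulrC.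
have := ler_norm A; have : t * A <= t * `|A| by rewrite ler_pM2l// ler_norm.
by rewrite mulrDr mulr1 in te; lra.
Qed.

Lemma point_value_local g h x c e : 0 < e ->
  (forall A phi, tst A phi -> (forall z, e <= `|z - x| -> phi z = 0) -> g phi = h phi) ->
  point_value g x c -> point_value h x c.
Proof.
move=> e0 gh /point_valueP H; apply/point_valueP => A phi tp.
have /cvg0P Hg := H A phi tp; apply/cvg0P => k /Hg [r r0 Hr].
have A1 : 0 < `|A| + 1 by rewrite ltr_wpDl.
exists (Num.min r (e / (`|A| + 1))); first by rewrite lt_min r0 divr_gt0.
move=> t /andP[t0]; rewrite lt_min => /andP[tr te].
rewrite -(gh _ _ (tst_dil _ x _ _ t0 tp)); first by apply: Hr; rewrite t0.
by move=> z; exact: dil_small tp e0 t0 te.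
Qed.

Lemma tst_vanish_near A phi (K : set R) x : compact K -> K x -> tst A phi ->
  tsupport phi `<=` ~` K -> exists2 e, 0 < e & forall z, `|z - x| < e -> phi z = 0.
Proof.
move=> cK Kx tp sK.
have : nbhs x (~` tsupport phi).
  apply: open_nbhs_nbhs; split; first by apply: closed_openC; exact: closed_closure.
  by move=> /sK.
move=> /nbhs_ballP[e /= e0 He]; exists e => // z ze; apply: contrapT => /eqP pz.
apply: (He z); first by rewrite /ball/= distrC.
exact: subset_closure.
Qed.

Lemma derive1_0 f x e : 0 < e -> (forall z, `|z - x| < e -> f z = 0) -> derive1 f x = 0.
Proof.
move=> e0 H; have E : \forall z \near x, f z = (fun=> 0) z.
  by apply/nbhs_ballP; exists e => //= z; rewrite /ball/= distrC => /H.
by have := nbhs_singleton (near_derive1n 1 _ _ _ E); rewrite /derive1n/= derive1_const.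
Qed.

Lemma Eprime_mono a b c d u : a <= c -> d <= b -> Eprime c d u -> Eprime a b u.
Proof.
move=> ac db [du su]; split=> // phi tp sp; apply: su => // y /sp /= nab.
apply: contra_not nab; rewrite /= !in_itv/= => /andP[cy yd].
by rewrite (le_trans ac cy) (le_trans yd db).
Qed.

(** The truncated primitive is [gam] plus the part of [primD u - gam] to the left of [c].
    Subtracting [gam] makes the cut part have the value 0 at [c]; beyond [c] the primitive is
    constant, so its derivative [w] is carried by [a, c]. *)
Lemma good_truncate a b c u gam : a < c -> c <= b -> good a b u ->
  point_value (primD u) c gam ->
  exists w, [/\ good a c w, mass w = gam &
    forall A phi e, tst A phi -> 0 < e -> (forall z, c - e < z -> phi z = 0) -> w phi = u phi].
Proof.
move=> ac cb [Eu gu] pvc; have ab : a <= b by apply: le_trans cb; exact: ltW.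
have ac' := ltW ac.
pose g := linD (- gam) (@intR R) (primD u).
have dP := dist_primD _ _ _ ab Eu.
have dg : is_distribution g by apply: dist_linD => //; exact: dist_intR.
have pvg : point_value g c 0.
  have := point_value_linD _ _ _ _ _ (- gam) (point_value_intR c) pvc.
  by rewrite mulr1 addNr.
have pb := point_value_bounded _ _ _ pvg.
have dG := dist_cutD _ _ dg pb.
pose U := linD gam (@intR R) (cutD g c).
have dU : is_distribution U by apply: dist_linD => //; exact: dist_intR.
pose w phi := - cutD g c (derive1 phi).
have cutL A phi e : tst A phi -> 0 < e -> (forall z, c - e < z -> phi z = 0) ->
    cutD g c phi = g phi.
  move=> tp e0 H; apply: (cutD_unique _ _ A) => //.
  apply/cvg0P => k k0; exists (e / 2); first by lra.
  move=> t /andP[t0 te]; rewrite (_ : dcut _ _ _ _ = g phi) ?subrr ?normr0 ?(ltW k0)//.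
  rewrite /dcut; congr g; apply/funext => z.
  have [zc|zc] := ltP (c - e) z; first by rewrite H// mul0r.
  by rewrite /dil fade_left ?mulr1// ler_pdivrMr//; lra.
have cutR A phi e : tst A phi -> 0 < e -> (forall z, z < c + e -> phi z = 0) ->
    cutD g c phi = 0.
  move=> tp e0 H; apply: (cutD_unique _ _ A) => //.
  apply: (@near_cvg R (fun=> 0)); last exact: cvg_cst.
  move=> t t0; rewrite /dcut -[LHS](dist0 g dg); congr g; apply/funext => z.
  have [zc|zc] := ltP z (c + e); first by rewrite H// mul0r.
  by rewrite /dil fade_right ?mulr0// ler_pdivlMr//; lra.
have U'w : is_derivative U w.
  move=> phi /test_functionP[A A0 tp].
  by rewrite /w /U /linD (intR_derive1 _ _ tp) mulr0 add0r.
have Ew : Eprime a c w.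
  split.
    apply: dist_intro => [A k f phi A0 tf tp|A A0].
      rewrite /w (derive1D _ _ (smoothZ _ _ tf.1) tp.1) (derive1Z _ _ tf.1).
      by rewrite (dist_L _ _ _ _ _ dG (tst_derive1 _ _ tf) (tst_derive1 _ _ tp)) opprD mulrN.
    have [C [m [C0 HC]]] := dist_bound _ A dG; exists C, m.+1 => f M tf bf.
    rewrite /w normrN; apply: HC; first exact: tst_derive1.
    exact: bounded_derive1.
  move=> phi /test_functionP[A A0 tp] sp; rewrite /w.
  apply/eqP; rewrite oppr_eq0; apply/eqP.
  apply: (cutD_unique _ _ A) => //; first exact: tst_derive1.
  have phi0 z : a <= z <= c -> phi z = 0.
    move=> zac; apply: contrapT => /eqP pz; apply: (sp z); first exact: subset_closure.
    by rewrite /= in_itv.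
  (* For t < (c - a) / 2 the step varies only inside (a, c), where [phi] vanishes. The product rule
     then leaves no term with the derivative of the step, and [dcut] of [derive1 phi] is [g] of
     [derive1 kap]. *)
  apply/cvg0P => k k0; exists ((c - a) / 2); first by lra.
  move=> t /andP[t0 tca]; rewrite (_ : dcut _ _ _ _ = 0) ?subrr ?normr0 ?(ltW k0)//.
  have tk := tst_dcut _ c _ t tp.
  pose kap := fun y => phi y * dil c t fade y; rewrite -/kap in tk.
  have -> : dcut g c (derive1 phi) t = g (derive1 kap).
    rewrite /dcut /kap (derive1M _ _ tp.1 (smooth_dil c t _ smooth_fade)); congr g; apply/funext => y.
    rewrite (derive1_dil c t _ smooth_fade).
    have [y1|y1] := ltP y (c - 2 * t).
      rewrite [dil c t (derive1 fade) y](_ : _ = 0) ?mulr0 ?addr0//.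
      have n0 : 0 < - 2 - (y - c) / t by rewrite subr_gt0 ltr_pdivrMr//; lra.
      rewrite /dil; have -> : derive1 fade ((y - c) / t) = derive1 (fun z => fade z - 1) ((y - c) / t).
        by rewrite (derive1B _ _ smooth_fade (smooth_cst 1)) derive1_const subr0.
      apply: (derive1_0 _ _ _ n0) => z zn; rewrite fade_left ?subrr//.
      by have := ler_norm (z - (y - c) / t); lra.
    have [y2|y2] := ltP c y; last by rewrite [phi y]phi0 ?mul0r ?addr0//; lra.
    rewrite [dil c t (derive1 fade) y](_ : _ = 0) ?mulr0 ?addr0//.
    have n0 : 0 < (y - c) / t by rewrite divr_gt0// subr_gt0.
    rewrite /dil; apply: (derive1_0 _ _ _ n0) => z zn; rewrite fade_right//.
    by have := ler_norm (- (z - (y - c) / t)); rewrite normrN; lra.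
  have D0 : u kap = 0.
    apply: Eu.2; first exact: tst_test tk.
    have Z1 : tsupport kap `<=` tsupport phi.
      by apply: closure_subset => y /=; apply: contraNN => /eqP pz; rewrite /kap pz mul0r.
    have Z2 : tsupport kap `<=` `]-oo, c - t].
      apply: tsupport_sub; first exact: lray_closed.
      move=> y /=; rewrite in_itv/= => /negP; rewrite -ltNge => yc.
      by rewrite /kap /dil fade_right ?mulr0// ler_pdivlMr//; lra.
    move=> y yk; have := sp _ (Z1 _ yk); have := Z2 _ yk; rewrite /= !in_itv/= => yc nac /andP[ya yb].
    by apply: nac; rewrite ya; lra.
  have := is_derivative_primD _ _ _ ab Eu kap (tst_test _ _ tk); rewrite D0.
  by rewrite /g /linD (intR_derive1 _ _ tk); lra.
have UaE A phi : tst A phi -> (forall z, (c - a) / 2 <= `|z - a| -> phi z = 0) -> primD u phi = U phi.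
  move=> tp H; rewrite /U /linD (cutL A _ ((c - a) / 4)) ?/g ?/linD//; [by rewrite mulNr addrA subrr add0r|by lra|].
  by move=> z zc; apply: H; have := ler_norm (z - a); lra.
have pva : point_value U a 0.
  have [k Hk] := gu a; have k0 := primD_value_left _ _ _ _ ab Eu Hk; rewrite k0 in Hk.
  by apply: (point_value_local _ _ _ _ ((c - a) / 2) _ UaE Hk); lra.
have UE := primitive_unique _ _ _ _ ac' Ew dU U'w pva.
(* Left of [c] the truncated primitive agrees with [primD u], right of [c] with the constant [gam],
   and at [c] the cut part has the value 0. *)
have pvU x : exists k, point_value U x k.
  have [xc|xc|->] := ltgtP x c.
  - have [k Hk] := gu x; exists k.
    apply: (point_value_local _ _ _ _ ((c - x) / 2) _ _ Hk); first by lra.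
    move=> A phi tp H; rewrite /U /linD (cutL A _ ((c - x) / 4)) ?/g ?/linD//; [by rewrite mulNr addrA subrr add0r|by lra|].
    by move=> z zc; apply: H; have := ler_norm (z - x); lra.
  - exists gam.
    have H0 : point_value (linD gam (@intR R) (fun=> 0)) x gam.
      apply/point_valueP => A phi tp.
      apply: (@near_cvg R (fun=> gam * intR phi)); last exact: cvg_cst.
      by move=> t t0; rewrite /linD (intR_dil _ _ _ _ t0 tp) addr0 mulrCA mulKf// gt_eqF.
    apply: (point_value_local _ _ _ _ ((x - c) / 2) _ _ H0); first by lra.
    move=> A phi tp H; rewrite /U /linD (cutR A _ ((x - c) / 4))//; first by lra.
    by move=> z zc; apply: H; have := ler_norm (- (z - x)); rewrite normrN; lra.
  - exists (gam * 1 + 0); apply: point_value_linD; first exact: point_value_intR.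
    exact: cutD_point_value.
exists w; split.
- split=> // x; have [k Hk] := pvU x; exists k.
  by apply: point_value_eq Hk => A phi tp; exact: (UE A).
- have pc : point_value (primD w) c (gam * 1 + 0).
    have := point_value_linD _ _ _ _ _ gam (point_value_intR c) (cutD_point_value _ _ dg pvg).
    by apply: point_value_eq => A phi tp; rewrite -(UE A phi tp).
  by rewrite -(primD_value_right _ _ _ _ ac' Ew pc) mulr1 addr0.
- move=> A phi e tp e0 H; rewrite /w (cutL A _ e (tst_derive1 _ _ tp) e0).
    rewrite /g /linD (intR_derive1 _ _ tp) mulr0 add0r.
    by have := is_derivative_primD _ _ _ ab Eu phi (tst_test _ _ tp).
  move=> z zc; have z0 : 0 < z - (c - e) by rewrite subr_gt0.
  apply: (derive1_0 _ _ _ z0) => y yz; apply: H.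
  by have := ler_norm (- (y - z)); rewrite normrN; lra.
Qed.

End TruncateGood.

(** * Infinite values *)

Section InfiniteValues.
Context {R : realType}.
Implicit Types (g u v h U : (R -> R) -> R) (f F phi psi Th : R -> R) (a b x c d t r s e A C M N : R).

(** By the mean value theorem, translates of a test function depend continuously on the base point
    in every seminorm. The sets [steep] are closed for this reason. *)
Lemma continuous_dil g t A phi : is_distribution g -> 0 < t -> tst A phi ->
  continuous (fun x => g (dil x t phi)).
Proof.
move=> dg t0 tp x0.
pose B := t * A + `|x0| + 1.
have [C [m [C0 HC]]] := dist_bound g B dg.
have [M M0 HM] := tst_bounded m.+1 _ _ (tst_dil _ 0 _ _ t0 tp).
have E x : dil x t phi = fun y => dil 0 t phi (1 * y + (- x)).
  by apply/funext => y; rewrite /dil subr0 mul1r.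
have sD := smooth_dil 0 t _ tp.1.
have tx x : `|x - x0| < 1 -> tst B (dil x t phi).
  move=> xx; apply: tst_le (tst_dil _ x _ _ t0 tp); rewrite /B -addrA lerD2l.
  by have := ler_normD (x - x0) x0; rewrite subrK; lra.
have tx0 : tst B (dil x0 t phi) by apply: tx; rewrite subrr normr0.
apply/cvgrPdist_le => e e0.
have CM : 0 < C * M + 1 by rewrite ltr_wpDl// mulr_ge0.
apply/nbhs_ballP; exists (Num.min 1 (e / (C * M + 1))) => /=.
  by rewrite lt_min ltr01 divr_gt0.
move=> x; rewrite /ball/= lt_min => /andP[x1 xe].
rewrite -(distB _ _ _ _ dg tx0 (tx x _)); last by rewrite distrC.
apply: (@le_trans _ _ (C * (M * `|x0 - x|))).
  apply: HC; first by apply: (tstB _ _ _ tx0); apply: tx; rewrite distrC.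
  move=> i y im; rewrite (derive1nB i _ _ (smooth_dil _ _ _ tp.1) (smooth_dil _ _ _ tp.1)).
  rewrite (E x0) (E x) !(derive1n_affine i _ 1 _ sD) expr1n !mul1r.
  have sDi := smooth_derive1n i _ sD.
  have := mvt_le _ (1 * y + - x) (1 * y + - x0) M sDi.
  rewrite -derive1nS !mul1r => /(_ (fun z => HM i.+1 z im)).
  by rewrite (_ : y - x0 - (y - x) = - (x0 - x)) ?normrN//; ring.
move: xe; rewrite ltr_pdivlMr// mulrDr mulr1 => xe.
by rewrite mulrA mulrC; have := normr_ge0 (x0 - x); lra.
Qed.

(** If the integral were 0, the monotone antiderivative would vanish identically, and with it its
    derivative [phi]. *)
Lemma intR_gt0 A phi y : tst A phi -> (forall z, 0 <= phi z) -> 0 < phi y -> 0 < intR phi.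
Proof.
move=> tp p0 py; have mono := prim_ge0_mono _ _ tp p0.
have L z : 0 <= prim phi z.
  pose w := Num.min z (- A) - 1.
  have wz : w <= z by have h : Num.min z (- A) <= z; [rewrite ge_min lexx|rewrite /w; lra].
  have wA : w < - A by have h : Num.min z (- A) <= - A; [rewrite ge_min lexx orbT|rewrite /w; lra].
  by rewrite -(prim_left _ _ w tp.2 wA); exact: mono.
have Rt z : prim phi z <= intR phi.
  pose w := Num.max z A + 1.
  have wz : z <= w by have h : z <= Num.max z A; [rewrite le_max lexx|rewrite /w; lra].
  have wA : A < w by have h : A <= Num.max z A; [rewrite le_max lexx orbT|rewrite /w; lra].
  by rewrite -(prim_right _ _ w tp.2 wA); exact: mono.
rewrite lt_neqAle (le_trans (L 0) (Rt 0)) andbT; apply/eqP => I0.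
have P0 : prim phi = fun=> 0.
  by apply/funext => z; apply/eqP; rewrite eq_le L andbT (le_trans (Rt z))// -I0.
by move: py; rewrite -(derive1_prim _ _ tp) P0 derive1_const ltxx.
Qed.

Lemma T0_of_tst A phi : tst A phi -> (forall y, 0 <= phi y) -> 0 < intR phi ->
  T0 (fun y => (intR phi)^-1 * phi y).
Proof.
move=> tp p0 i0; have tq : tst A (fun y => (intR phi)^-1 * phi y) by exact: tstZ.
split; first exact: tq.1.
- by move=> y; rewrite mulr_ge0// invr_ge0 ltW.
- have iq := tst_integrable _ _ tq.
  rewrite -[LHS](@fineK R); last by apply: integrable_fin_num.
  congr EFin; rewrite -[LHS]/(intR (fun y => (intR phi)^-1 * phi y)).
  by rewrite (distZ _ _ _ _ dist_intR tp) mulVf// gt_eqF.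
(* Any exponent below -1 would do, as all derivatives vanish for large |y|. *)
- exists (-2); first lra.
  move=> m; exists 0, (A + 1) => y yA; rewrite mul0r.
  by rewrite (supp_derive1n m _ _ tq.2) ?normr0//; lra.
Qed.

(* [u] tested against [gain_right] or [gain_left] is the increment of the mean values of its primitive
   between a bump on one side of the base point and the same bump at half scale. *)
Definition unit_bump (y : R) : R := (intR (@bump01 R))^-1 * bump01 y.
Definition gain_right (y : R) : R := prim unit_bump (2 * y) - prim unit_bump y.
Definition gain_left (y : R) : R := prim unit_bump (y + 1) - prim unit_bump (2 * y + 1).

Lemma tst_unit_bump : tst 1 unit_bump.
Proof. exact: tstZ (@tst_bump01 R). Qed.

Lemma intR_unit_bump : intR unit_bump = 1.
Proof. by rewrite (distZ _ _ _ _ dist_intR (@tst_bump01 R)) mulVf// gt_eqF// intR_bump01_gt0. Qed.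

Lemma unit_bump_ge0 y : 0 <= unit_bump y.
Proof. by rewrite mulr_ge0 ?bump01_ge0// invr_ge0 ltW// intR_bump01_gt0. Qed.

Lemma prim_unit_le0 y : y <= 0 -> prim unit_bump y = 0.
Proof.
move=> y0; apply: prim_eq0 => z zy; rewrite /unit_bump bump01_out ?mulr0//.
by apply/negP => /andP[]; lra.
Qed.

Lemma prim_unit_ge1 y : 1 <= y -> prim unit_bump y = 1.
Proof.
move=> y1; rewrite prim_eq_intR ?intR_unit_bump// => z yz.
by rewrite /unit_bump bump01_out ?mulr0//; apply/negP => /andP[]; lra.
Qed.

Lemma prim_unit_mono : {homo prim unit_bump : x y / x <= y}.
Proof. exact: prim_ge0_mono tst_unit_bump unit_bump_ge0. Qed.

Lemma smooth_prim_unit k d : smooth (fun y => prim unit_bump (k * y + d)).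
Proof. by apply: smooth_affine; exact: smooth_prim tst_unit_bump. Qed.

Lemma smooth_prim_unit0 k : smooth (fun y => prim unit_bump (k * y)).
Proof. by have := smooth_prim_unit k 0; under eq_fun do rewrite addr0. Qed.

Lemma smooth_prim_unit1 d : smooth (fun y => prim unit_bump (y + d)).
Proof. by have := smooth_prim_unit 1 d; under eq_fun do rewrite mul1r. Qed.

Lemma tst_gain_right : tst 1 gain_right.
Proof.
split; first exact: smoothB _ _ (smooth_prim_unit0 2) (smooth_prim _ _ tst_unit_bump).
move=> y; rewrite ltr_normr /gain_right => /orP[y1|y1].
  by rewrite !prim_unit_ge1 ?subrr//; lra.
by rewrite !prim_unit_le0 ?subrr//; lra.
Qed.

Lemma tst_gain_left : tst 1 gain_left.
Proof.
split; first exact: smoothB _ _ (smooth_prim_unit1 1) (smooth_prim_unit 2 1).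
move=> y; rewrite ltr_normr /gain_left => /orP[y1|y1].
  by rewrite !prim_unit_ge1 ?subrr//; lra.
by rewrite !prim_unit_le0 ?subrr//; lra.
Qed.

Lemma gain_right_ge0 y : 0 <= gain_right y.
Proof.
rewrite subr_ge0; have [y0|y0] := leP 0 y; first by apply: prim_unit_mono; lra.
by rewrite !prim_unit_le0//; lra.
Qed.

Lemma gain_left_ge0 y : 0 <= gain_left y.
Proof.
rewrite subr_ge0; have [y0|y0] := leP y 0; first by apply: prim_unit_mono; lra.
by rewrite !prim_unit_ge1//; lra.
Qed.

Lemma prim_unit_half : 0 < prim unit_bump (1 / 2) < 1.
Proof.
have P z w : z < w -> 0 <= z -> w <= 1 -> prim unit_bump z < prim unit_bump w.
  move=> zw z0 w1; have [| |c] := @MVT R (prim unit_bump) unit_bump z w zw.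
  - by move=> y _; exact: is_derive_prim tst_unit_bump.
  - apply: continuous_subspaceT => y; apply: smooth_continuous.
    exact: smooth_prim tst_unit_bump.
  - rewrite in_itv/= => /andP[zc cw] E; rewrite -subr_gt0 E mulr_gt0 ?subr_gt0//.
    by rewrite mulr_gt0 ?invr_gt0 ?intR_bump01_gt0// bump01_gt0//; lra.
have := P 0 (1 / 2) ltac:(lra) ltac:(lra) ltac:(lra); rewrite prim_unit_le0// => ->.
by have := P (1 / 2) 1 ltac:(lra) ltac:(lra) ltac:(lra); rewrite (prim_unit_ge1 1).
Qed.

Lemma intR_gain_right : 0 < intR gain_right.
Proof.
apply: (intR_gt0 1 _ (1 / 2) tst_gain_right gain_right_ge0).
rewrite /gain_right (prim_unit_ge1 (2 * _)); last lra.
by have /andP[_] := prim_unit_half; lra.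
Qed.

Lemma intR_gain_left : 0 < intR gain_left.
Proof.
apply: (intR_gt0 1 _ (- (1 / 2)) tst_gain_left gain_left_ge0).
rewrite /gain_left (prim_unit_le0 (2 * _ + 1)); last lra.
rewrite (_ : - (1 / 2) + 1 = 1 / 2) ?subr0; last lra.
by have /andP[] := prim_unit_half.
Qed.

End InfiniteValues.

Lemma derive1_scale {R : realType} (f : R -> R) c : smooth f ->
  derive1 (fun x => f (c * x)) = fun x => c * derive1 f (c * x).
Proof.
move=> sf; have -> : (fun x => f (c * x)) = fun x => f (c * x + 0).
  by apply/funext => x; rewrite addr0.
by rewrite (derive1_affine _ _ _ sf); apply/funext => x; rewrite addr0.
Qed.

Lemma derive1_shift {R : realType} (f : R -> R) d : smooth f ->
  derive1 (fun x => f (x + d)) = fun x => derive1 f (x + d).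
Proof.
move=> sf; have -> : (fun x => f (x + d)) = fun x => f (1 * x + d).
  by apply/funext => x; rewrite mul1r.
by rewrite (derive1_affine _ _ _ sf); apply/funext => x; rewrite !mul1r.
Qed.

(** * Growth of a primitive between two points *)

Section Increments.
Context {R : realType}.
Variables (a b : R) (u : (R -> R) -> R) (gam : R -> R).
Hypotheses (ab : a <= b) (Eu : Eprime a b u).
Hypothesis Hgam : forall x, point_value (primD u) x (gam x).
Implicit Types (x y d t N : R).

Let P := primD u.
Let dP : is_distribution P := dist_primD _ _ _ ab Eu.

Definition unit_bumpl (y : R) : R := unit_bump (y + 1).

Lemma tst_unit_bumpl : tst 2 unit_bumpl.
Proof. by have -> : 2 = 1 + `|1| :> R; [rewrite normr1|exact: tst_shift tst_unit_bump]. Qed.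

Lemma intR_unit_bumpl : intR unit_bumpl = 1.
Proof.
have -> : unit_bumpl = dil (-1) 1 unit_bump by apply/funext => y; rewrite /dil divr1 opprK.
by rewrite (intR_dil _ _ _ _ ltr01 tst_unit_bump) mul1r intR_unit_bump.
Qed.

Lemma gain_right_step x t : 0 < t ->
  t^-1 * P (dil x t unit_bump) - (t / 2)^-1 * P (dil x (t / 2) unit_bump) = u (dil x t gain_right).
Proof.
move=> t0; have tn : t != 0 by rewrite gt_eqF.
have t20 : 0 < t / 2 by lra.
have tg := tst_dil _ x _ _ t0 tst_gain_right.
have T1 : tst (t + `|x|) (dil x t unit_bump) by have := tst_dil _ x _ _ t0 tst_unit_bump; rewrite mulr1.
have T2 : tst (t + `|x|) (dil x (t / 2) unit_bump).
  by apply: tst_le (tst_dil _ x _ _ t20 tst_unit_bump); lra.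
have := is_derivative_primD _ _ _ ab Eu _ (tst_test _ _ tg); rewrite -/P => ->.
rewrite (derive1_dil _ _ _ tst_gain_right.1).
have -> : derive1 gain_right = fun y => 2 * unit_bump (2 * y) - unit_bump y.
  rewrite /gain_right (derive1B _ _ (smooth_prim_unit0 2) (smooth_prim _ _ tst_unit_bump)).
  by rewrite (derive1_scale _ 2 (smooth_prim _ _ tst_unit_bump)) (derive1_prim _ _ tst_unit_bump).
have -> : (fun y => t^-1 * dil x t (fun y => 2 * unit_bump (2 * y) - unit_bump y) y) =
    fun y => (t / 2)^-1 * dil x (t / 2) unit_bump y + (- t^-1) * dil x t unit_bump y.
  apply/funext => y; rewrite /dil (_ : 2 * ((y - x) / t) = (y - x) / (t / 2)); field; rewrite ?tn//.
rewrite (dist_L _ _ _ _ _ dP T2 (tstZ _ _ _ T1)) (distZ _ _ _ _ dP T1).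
by rewrite mulNr opprB.
Qed.

Lemma gain_left_step x t : 0 < t ->
  (t / 2)^-1 * P (dil x (t / 2) unit_bumpl) - t^-1 * P (dil x t unit_bumpl) = u (dil x t gain_left).
Proof.
move=> t0; have tn : t != 0 by rewrite gt_eqF.
have t20 : 0 < t / 2 by lra.
have tg := tst_dil _ x _ _ t0 tst_gain_left.
have T1 := tst_dil _ x _ _ t0 tst_unit_bumpl.
have T2 : tst (t * 2 + `|x|) (dil x (t / 2) unit_bumpl).
  by apply: tst_le (tst_dil _ x _ _ t20 tst_unit_bumpl); lra.
have := is_derivative_primD _ _ _ ab Eu _ (tst_test _ _ tg); rewrite -/P => ->.
rewrite (derive1_dil _ _ _ tst_gain_left.1).
have -> : derive1 gain_left = fun y => unit_bumpl y - 2 * unit_bump (2 * y + 1).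
  rewrite /gain_left (derive1B _ _ (smooth_prim_unit1 1) (smooth_prim_unit 2 1)).
  rewrite (derive1_affine _ 2 1 (smooth_prim _ _ tst_unit_bump)).
  by rewrite (derive1_shift _ 1 (smooth_prim _ _ tst_unit_bump)) (derive1_prim _ _ tst_unit_bump).
have -> : (fun y => t^-1 * dil x t (fun y => unit_bumpl y - 2 * unit_bump (2 * y + 1)) y) =
    fun y => t^-1 * dil x t unit_bumpl y + (- (t / 2)^-1) * dil x (t / 2) unit_bumpl y.
  apply/funext => y; rewrite /dil /unit_bumpl (_ : 2 * ((y - x) / t) = (y - x) / (t / 2)); field; rewrite ?tn//.
rewrite (dist_L _ _ _ _ _ dP T1 (tstZ _ _ _ T2)) (distZ _ _ _ _ dP T2).
by rewrite mulNr opprB.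
Qed.

Lemma small_dyadic (d r : R) : 0 < d -> 0 < r -> exists n, d / 2 ^+ n.+1 < r.
Proof.
move=> d0 r0; exists (Num.bound (d / r)).
have := archi_boundP (divr_ge0 (ltW d0) (ltW r0)); set n := Num.bound _ => K.
rewrite ltr_pdivrMr ?exprn_gt0// mulrC -ltr_pdivrMr//.
apply: (lt_le_trans K); rewrite -natrX ler_nat ltnW//.
by rewrite (ltn_trans (ltnSn n))// ltn_expl.
Qed.

(** The halving from [d] to [d / 2] already yields [N * d]; the later halvings, down to the limit
    [l], contribute nonnegative gains. *)
Lemma dyadic_gain (G : R -> R) l d N : 0 <= N -> 0 < d ->
  (forall t, 0 < t <= d -> N * t <= G t - G (t / 2)) -> G @ (0:R)^'+ --> l ->
  l + N * d <= G d.
Proof.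
move=> N0 d0 step /cvg0P Gl.
have dn n : 0 < d / 2 ^+ n :> R by rewrite divr_gt0// exprn_gt0.
have dle n : d / 2 ^+ n <= d by rewrite ler_pdivrMr ?exprn_gt0// ler_peMr ?(ltW d0)// exprn_ege1// ler1n.
have steps n : G (d / 2 ^+ n.+1) + N * d <= G d.
  elim: n => [|n IH].
    by have := step d ltac:(by rewrite d0 lexx); rewrite expr1; lra.
  have := step (d / 2 ^+ n.+1); rewrite dn dle => /(_ isT).
  have -> : d / 2 ^+ n.+2 = d / 2 ^+ n.+1 / 2 by rewrite [in LHS]exprSr invfM mulrA.
  by have := mulr_ge0 N0 (ltW (dn n.+1)); lra.
rewrite leNgt; apply/negP => lt.
have e0 : 0 < (l + N * d - G d) / 2 by lra.
have [r r0 Hr] := Gl _ e0.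
have [n Hn] := small_dyadic d r d0 r0.
have := Hr (d / 2 ^+ n.+1); rewrite dn Hn => /(_ isT) K.
have := steps n; have := ler_norm (- (G (d / 2 ^+ n.+1) - l)); rewrite normrN; lra.
Qed.

Lemma right_gain x d N : 0 <= N -> 0 < d ->
  (forall t, 0 < t <= d -> N * t <= u (dil x t gain_right)) ->
  gam x + N * d <= d^-1 * P (dil x d unit_bump).
Proof.
move=> N0 d0 H; apply: (dyadic_gain (fun t => t^-1 * P (dil x t unit_bump)) _ _ _ N0 d0).
  by move=> t td; rewrite gain_right_step ?(andP td).1//; exact: H.
have := iffLR (point_valueP _ _ _) (Hgam x) _ _ tst_unit_bump.
by rewrite intR_unit_bump mulr1.
Qed.

Lemma left_gain x d : 0 < d ->
  (forall t, 0 < t <= d -> 0 <= u (dil x t gain_left)) ->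
  d^-1 * P (dil x d unit_bumpl) <= gam x.
Proof.
move=> d0 H; have := dyadic_gain (fun t => - (t^-1 * P (dil x t unit_bumpl))) (- gam x) d 0 (lexx 0) d0.
rewrite mul0r addr0 lerN2; apply.
  move=> t td; rewrite mul0r opprK addrC gain_left_step ?(andP td).1//; exact: H.
apply: cvgN; have := iffLR (point_valueP _ _ _) (Hgam x) _ _ tst_unit_bumpl.
by rewrite intR_unit_bumpl mulr1.
Qed.

(* The mean over the bump to the right of [x] is also the mean over the bump to the left of [y]. *)
Lemma increment x y N : 0 <= N -> x < y ->
  (forall t, 0 < t <= y - x -> N * t <= u (dil x t gain_right)) ->
  (forall t, 0 < t <= y - x -> 0 <= u (dil y t gain_left)) ->
  N * (y - x) <= gam y - gam x.
Proof.
move=> N0 xy H1 H2; have d0 : 0 < y - x by lra.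
have := right_gain x (y - x) N N0 d0 H1; have := left_gain y (y - x) d0 H2.
have -> : dil y (y - x) unit_bumpl = dil x (y - x) unit_bump.
  apply/funext => z; rewrite /dil /unit_bumpl; congr unit_bump; field.
  by rewrite subr_eq0 gt_eqF.
lra.
Qed.

(** The scale from which both inequalities hold is fixed as 1 / (n+1), which makes the set closed. A
    point where all mean values tend to +oo lies in [steep n N] for every [N] and a suitable [n]. *)
Definition steep (n : nat) (N : R) : set R := [set x | forall t, 0 < t <= n.+1%:R^-1 ->
  N * t <= u (dil x t gain_right) /\ 0 <= u (dil x t gain_left)].

Lemma steep_closed n N : closed (steep n N).
Proof.
have -> : steep n N = \bigcap_(t in [set t | 0 < t <= n.+1%:R^-1])
    ((fun x => u (dil x t gain_right)) @^-1` `[N * t, +oo[ `&`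
     (fun x => u (dil x t gain_left)) @^-1` `[0, +oo[).
  apply/seteqP; split=> x H t /= t0; have := H t t0.
    by rewrite /= !in_itv/= !andbT.
  by rewrite /= !in_itv/= !andbT.
apply: closed_bigI => t /= /andP[t0 _]; apply: closedI.
  apply: preimage_closed; last exact: rray_closed.
  by move=> x _; exact: continuous_dil Eu.1 t0 tst_gain_right x.
apply: preimage_closed; last exact: rray_closed.
by move=> x _; exact: continuous_dil Eu.1 t0 tst_gain_left x.
Qed.

Lemma steep_increment n N x y : 0 <= N -> steep n N x -> steep n 0 y -> x <= y ->
  y - x <= n.+1%:R^-1 -> N * (y - x) <= gam y - gam x.
Proof.
move=> N0 Hx Hy; rewrite le_eqVlt => /predU1P[->|xy yx]; first by rewrite !subrr mulr0.
apply: increment => // t /andP[t0 td].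
  by have [] := Hx t ltac:(by rewrite t0 (le_trans td)).
by have [] := Hy t ltac:(by rewrite t0 (le_trans td)).
Qed.

End Increments.

(** * Infinitely steep points form a null set *)

Section NullSteepness.
Context {R : realType}.
Local Notation mu := (@lebesgue_measure R).
Variables (a b : R) (u : (R -> R) -> R) (gam : R -> R).
Hypotheses (ab : a <= b) (Eu : Eprime a b u).
Hypothesis Hgam : forall x, point_value (primD u) x (gam x).
Implicit Types (x y d t N lo : R).

Lemma measure_diam (D : set R) k : measurable D -> 0 <= k ->
  (forall x y, D x -> D y -> x <= y -> y - x <= k) -> (mu D <= (2 * k)%:E)%E.
Proof.
move=> mD k0 H; have [->|/set0P[x0 Dx0]] := eqVneq D set0.
  by rewrite measure0 lee_fin mulr_ge0.
apply: (@le_trans _ _ (mu `[x0 - k, x0 + k]%classic)).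
  apply: le_measure; rewrite ?inE//.
  move=> y Dy; rewrite /= in_itv/=; have [xy|/ltW yx] := leP x0 y.
    by have := H _ _ Dx0 Dy xy; lra.
  by have := H _ _ Dy Dx0 yx; lra.
rewrite lebesgue_measure_itv/=; case: ifP => _; last by rewrite lee_fin mulr_ge0.
by rewrite -EFinD lee_fin; lra.
Qed.

Lemma steep_le n m N M x : (n <= m)%N -> 0 <= N -> 0 <= M -> M <= N ->
  steep u n N x -> steep u m M x.
Proof.
move=> nm N0 M0 MN H t /andP[t0 tm].
have tn : t <= n.+1%:R^-1 by rewrite (le_trans tm)// lef_pV2 ?posrE ?ltr0Sn// ler_nat.
have [H1 H2] := H t ltac:(by rewrite t0); split=> //.
by apply: le_trans H1; rewrite ler_wpM2r// ltW.
Qed.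

Section Window.
Variables (n0 : nat) (lo : R).
Let hi := lo + n0.+1%:R^-1.
(** The length of the window is the common scale 1 / (n0+1), so [increment] applies to any two
    points of [win], and [gam] is monotone on it. *)
Let win := steep u n0 0 `&` `[lo, hi]%classic.

Lemma lo_le_hi : lo <= hi.
Proof. by rewrite lerDl invr_ge0. Qed.

Lemma win_mono x y : win x -> win y -> x <= y -> gam x <= gam y.
Proof.
move=> [sx +] [sy +] xy; rewrite /= !in_itv/= /hi => /andP[lx xh] /andP[ly yh].
have := steep_increment _ _ _ _ ab Eu Hgam n0 0 x y (lexx 0) sx sy xy.
by rewrite mul0r subr_ge0; apply; rewrite lerBlDr (le_trans yh)// addrC lerD2l.
Qed.

(** At a point of [win], [gam] lies between the mean values of the primitive over the bumps on its
    left and on its right at the scale of the window; both are continuous in the point. *)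
Lemma win_bounded : exists B, forall x, win x -> - B <= gam x <= B.
Proof.
pose d : R := n0.+1%:R^-1; have d0 : 0 < d by rewrite invr_gt0 ltr0Sn.
have dP := dist_primD _ _ _ ab Eu.
have c1 := continuous_dil _ d _ _ dP d0 (@tst_unit_bump R).
have c2 := continuous_dil _ d _ _ dP d0 (@tst_unit_bumpl R).
have [p Hp] : exists p, forall x, x \in `[lo, hi] -> primD u (dil x d unit_bump) <= p.
  by have [z _ Hz] := EVT_max lo_le_hi (continuous_subspaceT c1); exists (primD u (dil z d unit_bump)).
have [q Hq] : exists q, forall x, x \in `[lo, hi] -> q <= primD u (dil x d unit_bumpl).
  by have [z _ Hz] := EVT_min lo_le_hi (continuous_subspaceT c2); exists (primD u (dil z d unit_bumpl)).
exists (d^-1 * (`|p| + `|q|)) => x [sx wx].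
have di : 0 < d^-1 by rewrite invr_gt0.
have g1 : gam x <= d^-1 * p.
  have := right_gain _ _ _ _ ab Eu Hgam x d 0 (lexx 0) d0 (fun t td => (sx t td).1).
  by rewrite mul0r addr0 => H; exact: le_trans H (ler_wpM2l (ltW di) (Hp x wx)).
have g2 : d^-1 * q <= gam x.
  have H := left_gain _ _ _ _ ab Eu Hgam x d d0 (fun t td => (sx t td).2).
  exact: le_trans (ler_wpM2l (ltW di) (Hq x wx)) H.
apply/andP; split.
  apply: le_trans g2; rewrite -mulrN ler_pM2l//.
  by have := ler_norm (- q); rewrite normrN; have := normr_ge0 p; lra.
apply: (le_trans g1); rewrite ler_pM2l//.
by have := ler_norm p; have := normr_ge0 q; lra.
Qed.

Lemma measurable_win n N : measurable (win `&` steep u n N).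
Proof.
apply: measurableI; last by apply: closed_measurable; exact: steep_closed Eu _ _.
by apply: measurableI; [apply: closed_measurable; exact: steep_closed Eu _ _|exact: measurable_itv].
Qed.

(** Within a piece of length 1 / (n+1), two points of [steep u n N] at distance d see [gam] grow by
    at least N d. The growth over the whole window is at most 2B, and [measure_diam] loses a factor
    2, which gives 4B / N. *)
Lemma win_measure B n N : (forall x, win x -> - B <= gam x <= B) -> 0 <= B -> 0 < N ->
  (mu (win `&` steep u n N) <= (4 * B / N)%:E)%E.
Proof.
move=> HB B0 N0; pose h : R := n.+1%:R^-1; have h0 : 0 < h by rewrite invr_gt0 ltr0Sn.
(* [Gam s] is the supremum of [gam] over the points of the window before [s], with [- B] added to
   keep the set nonempty. Its increments over consecutive pieces telescope. *)
pose V s := [set y | y = - B \/ exists2 x, win x /\ x < s & y = gam x].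
pose Gam s := sup (V s).
have Vub s : ubound (V s) B.
  move=> y [->|[x [wx _] ->]]; first by lra.
  by have /andP[] := HB x wx.
have V0 s : (V s) (- B) by left.
have Gub s y : V s y -> y <= Gam s.
  by move=> Vy; apply: ub_le_sup => //; exists B; exact: Vub.
have Gle s c : (forall y, V s y -> y <= c) -> Gam s <= c.
  by move=> H; apply: ge_sup => //; exists (- B).
have mwin := measurable_win n N.
pose J x y : set R := `[x, y[%classic.
have mJ x y : measurable (J x y) by exact: measurable_itv.
have key (k : nat) : (mu (win `&` steep u n N `&` J lo (lo + k%:R * h)%R) <=
     (2 * ((Gam (lo + k%:R * h)%R + B) / N))%:E)%E.
  elim: k => [|k IH].
    rewrite mul0r addr0 /J set_itvco0 setI0 measure0 lee_fin mulr_ge0// divr_ge0 ?(ltW N0)//.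
    by have := Gub lo _ (V0 lo); lra.
  set s := lo + k%:R * h in IH *; have sE : lo + k.+1%:R * h = s + h by rewrite /s -natr1; ring.
  rewrite sE.
  pose D := win `&` steep u n N `&` J s (s + h).
  have mD : measurable D by exact: measurableI.
  have m1 : measurable (win `&` steep u n N `&` J lo s) by exact: measurableI.
  have D1 x y : D x -> D y -> x <= y -> y - x <= (Gam (s + h) - Gam s) / N.
    move=> [[wx sx] ix] [[wy sy] iy] xy; rewrite ler_pdivlMr// mulrC.
    rewrite /J /= !in_itv/= in ix iy.
    have := steep_increment _ _ _ _ ab Eu Hgam n N x y (ltW N0) sx
      (steep_le _ _ _ _ _ (leqnn n) (ltW N0) (lexx 0) (ltW N0) sy) xy.
    move=> /(_ _)/le_trans; apply; first by rewrite -/h; lra.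
    apply: lerB.
      by apply: Gub; right; exists y => //; split=> //; lra.
    apply: Gle => z [->|[w [ww ws] ->]]; first by have /andP[] := HB x wx.
    by apply: win_mono => //; lra.
  have D0 : 0 <= (Gam (s + h) - Gam s) / N.
    apply: divr_ge0; last exact: ltW.
    rewrite subr_ge0; apply: Gle => z [->|[w [ww ws] ->]]; first exact: Gub (V0 _).
    by apply: Gub; right; exists w => //; split=> //; lra.
  apply: (@le_trans _ _ (mu (win `&` steep u n N `&` J lo s) + mu D)%E).
    apply: (@le_trans _ _ (mu ((win `&` steep u n N `&` J lo s) `|` D))).
      apply: le_measure.
      - by apply/mem_set; exact: (measurableI _ _ mwin (mJ _ _)).
      - by apply/mem_set; exact: (measurableU _ _ m1 mD).
      - move=> x [wx]; rewrite /J /= in_itv/= => /andP[lx xs].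
        have [xs'|xs'] := ltP x s; [left|right]; split=> //=; rewrite /J /= in_itv/=.
          by rewrite lx.
        by rewrite xs'.
    exact: measureU2.
  apply: (@le_trans _ _ ((2 * ((Gam s + B) / N))%:E + (2 * ((Gam (s + h)%R - Gam s) / N))%:E)%E).
    by apply: leeD => //; exact: measure_diam.
  by rewrite -EFinD lee_fin le_eqVlt; apply/orP; left; apply/eqP; field; rewrite gt_eqF.
have [k Hk] : exists k : nat, hi < lo + k%:R * h.
  have q0 : 0 <= n0.+1%:R^-1 / h by rewrite divr_ge0 ?invr_ge0 ?ltW.
  exists (Num.bound (n0.+1%:R^-1 / h)); rewrite /hi ltrD2l -ltr_pdivrMr//.
  exact: archi_boundP.
apply: (@le_trans _ _ (mu (win `&` steep u n N `&` J lo (lo + k%:R * h)))).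
  apply: le_measure; [exact/mem_set|by apply/mem_set; exact: (measurableI _ _ mwin (mJ _ _))|].
  move=> x [[sx wx] sx']; split=> //; move: wx; rewrite /J /= !in_itv/= => /andP[-> /= xh].
  exact: le_lt_trans Hk.
apply: (le_trans (key k)); rewrite lee_fin.
have GB : Gam (lo + k%:R * h) <= B by apply: Gle => y /Vub.
rewrite mulrA ler_pM2r ?invr_gt0//; lra.
Qed.

Lemma win_null : mu.-negligible [set x | win x /\ forall k : nat, exists n, steep u n k.+1%:R x].
Proof.
have [B HB0] := win_bounded.
have HB x : win x -> - `|B| <= gam x <= `|B|.
  move=> /HB0 /andP[h1 h2]; have := ler_norm B; have := normr_ge0 B; lra.
pose T k := \bigcup_n (win `&` steep u n k.+1%:R).
have mT k : measurable (T k) by apply: bigcup_measurable => n _; apply: measurable_win.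
have T1 k : (mu (T k) <= (4 * `|B| / k.+1%:R)%:E)%E.
  have nd : nondecreasing_seq (fun n => win `&` steep u n k.+1%:R).
    move=> n m nm; apply/subsetPset => x [wx sx]; split=> //.
    exact: steep_le nm (ler0n _ _) (ler0n _ _) (lexx _) sx.
  have cv := @nondecreasing_cvg_mu _ _ _ mu _ (fun n => measurable_win n k.+1%:R) (mT k) nd.
  rewrite -/(T k) in cv; rewrite -(cvg_lim _ cv)//.
  apply: lime_le; first exact: (cvgP _ cv).
  by apply: nearW => n; exact: (win_measure `|B| n k.+1%:R HB (normr_ge0 B) (ltr0Sn _ _)).
exists (\bigcap_k T k); split.
- exact: bigcapT_measurable.
- apply/eqP; rewrite eq_le measure_ge0 andbT; apply/lee_addgt0Pr => e e0; rewrite add0e.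
  have [k Hk] : exists k : nat, 4 * `|B| / k.+1%:R <= e.
    have q0 : 0 <= 4 * `|B| / e by rewrite divr_ge0 ?mulr_ge0// ltW.
    exists (Num.bound (4 * `|B| / e)); rewrite ler_pdivrMr ?ltr0Sn// [e * _]mulrC -ler_pdivrMr//.
    by apply: (le_trans (ltW (archi_boundP q0))); rewrite ler_nat.
  apply: (@le_trans _ _ (mu (T k))).
    apply: le_measure; [apply/mem_set; exact: bigcapT_measurable|apply/mem_set; exact: mT|].
    by move=> x; apply.
  by apply: (le_trans (T1 k)); rewrite lee_fin.
- by move=> x [wx H] k _; have [n Hn] := H k; exists n.
Qed.

End Window.

End NullSteepness.

Section InfiniteSet.
Context {R : realType}.
Local Notation mu := (@lebesgue_measure R).
Implicit Types (u : (R -> R) -> R) (x t N a b : R).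

(** Up to normalization [gain_right] and [gain_left] belong to [T0], so at such a point [u] tested
    on them eventually exceeds any multiple of the scale: the point is steep for every [N].
    Countably many windows cover these points. *)
Lemma infinite_null a b u : a <= b -> good a b u ->
  mu.-negligible [set x : R | a <= x <= b /\ forall phi, T0 phi -> forall N,
    \forall t \near 0^'+, N <= scaled_pairing u phi x t].
Proof.
move=> ab [Eu gu]; have [gam Hgam] := ex_choice _ gu.
pose W n0 i := [set x : R | (steep u n0 0 `&` `[a + i%:R / n0.+1%:R, a + i%:R / n0.+1%:R + n0.+1%:R^-1]%classic) x /\
  forall k : nat, exists n, steep u n k.+1%:R x].
set T := [set x : R | _].
have mW : mu.-negligible (\bigcup_n0 \bigcup_i W n0 i).
  apply: negligible_bigcup => n0; apply: negligible_bigcup => i.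
  exact: win_null ab Eu Hgam n0 (a + i%:R / n0.+1%:R).
apply: negligibleS mW.
move=> x [/andP[ax xb] H].
have gain phi A N : tst A phi -> (forall y, 0 <= phi y) -> 0 < intR phi ->
    \forall t \near 0^'+, N * t <= u (dil x t phi).
  move=> tp p0 i0; have := H _ (T0_of_tst _ _ tp p0 i0) ((intR phi)^-1 * N).
  move=> /near0P[d d0 Hd]; apply/near0P; exists d => // t td; have := Hd t td.
  have t0 : 0 < t by case/andP: td.
  have tq := tst_dil _ x _ _ t0 (tstZ _ (intR phi)^-1 _ tp).
  rewrite /scaled_pairing (gtr0_norm t0) -/(dil x t (fun y => (intR phi)^-1 * phi y)).
  rewrite (pairing_tst u a b _ _ ab Eu tq).
  rewrite -[dil x t _]/(fun y => (intR phi)^-1 * dil x t phi y).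
  rewrite (distZ _ _ _ _ Eu.1 (tst_dil _ x _ _ t0 tp)) mulrCA ler_pM2l ?invr_gt0//.
  by rewrite mulrC ler_pdivlMr// mulrC.
have st N : exists n, steep u n N x.
  have /near0P[d1 d10 H1] := gain _ _ N tst_gain_right gain_right_ge0 intR_gain_right.
  have /near0P[d2 d20 H2] := gain _ _ 0 tst_gain_left gain_left_ge0 intR_gain_left.
  have dd : 0 < Num.min d1 d2 by rewrite lt_min d10.
  exists (Num.bound (Num.min d1 d2)^-1) => t /andP[t0 tn].
  have : t < Num.min d1 d2.
    apply: (le_lt_trans tn); rewrite invf_plt ?posrE ?ltr0Sn//.
    have i0 : 0 <= (Num.min d1 d2)^-1 by rewrite invr_ge0 ltW.
    by apply: (lt_le_trans (archi_boundP i0)); rewrite ler_nat.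
  rewrite lt_min => /andP[td1 td2]; split; first by apply: H1; rewrite t0.
  by have := H2 t; rewrite mul0r t0; apply.
(* [n0] fixes the length of the windows, and the integer part of (x - a)(n0 + 1) selects the one
   that contains [x]. *)
have [n0 Hn0] := st 0; exists n0 => //.
have y0 : 0 <= (x - a) * n0.+1%:R by rewrite mulr_ge0// subr_ge0.
exists (Num.truncn ((x - a) * n0.+1%:R)) => //; split; last by move=> k; exact: st.
split=> //; rewrite /= in_itv/=.
have /andP[h1 h2] := Num.Theory.truncn_itv y0.
have np : 0 < n0.+1%:R :> R by rewrite ltr0Sn.
have g1 : (Num.truncn ((x - a) * n0.+1%:R))%:R / n0.+1%:R <= x - a by rewrite ler_pdivrMr.
have g2 : x - a <= ((Num.truncn ((x - a) * n0.+1%:R))%:R + 1) / n0.+1%:R.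
  by rewrite ler_pdivlMr// natr1 ltW.
rewrite mulrDl mul1r in g2.
by apply/andP; split; [rewrite -lerBrDl|rewrite -addrA -lerBlDl].
Qed.

End InfiniteSet.

(** * Majorants and integrability *)

Section Majorants.
Context {R : realType}.
Local Notation mu := (@lebesgue_measure R).
Implicit Types (u v w U : (R -> R) -> R) (phi psi : R -> R) (f g h : R -> \bar R) (x t r a b c : R).

Lemma lower_valueP (c : \bar R) u phi x : (c <= lower_value u phi x)%E <->
  forall r, (r%:E < c)%E -> \forall t \near 0^'+, r <= scaled_pairing u phi x t.
Proof.
rewrite /lower_value limf_einfE; split=> [cl r rc|H].
  have /ereal_sup_gt[_ [V FV <-] rV] := lt_le_trans rc cl.
  apply: filterS FV => t Vt; rewrite -lee_fin; apply: le_trans (ltW rV) _.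
  by apply: ereal_inf_lbound; exists t.
set S := ereal_sup _.
have K r : (r%:E < c)%E -> (r%:E <= S)%E.
  move=> /H Hr; pose V := [set t | r <= scaled_pairing u phi x t].
  apply: (@le_trans _ _ (ereal_inf ((fun t => (scaled_pairing u phi x t)%:E) @` V))).
    by apply: le_ereal_inf_tmp => _ [t /= Ht <-]; rewrite lee_fin.
  by apply: ereal_sup_ubound; exists V.
case: c {H} K => [s||] K; last exact: leNye.
- apply/lee_subgt0Pr => e e0; apply: K; rewrite lte_fin.
  by rewrite ltrBlDr ltrDl.
- by rewrite leye_eq; apply/eqP/eqyP => A _; apply: K; exact: ltry.
Qed.

(** -2 u + u: writing - u by means of [linD] makes all facts about [linD] available. *)
Definition oppD u := linD (-2) u u.

Lemma scaled_pairing_linD a b c u v phi x t : a <= b -> Eprime a b u -> Eprime a b v ->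
  smooth phi ->
  scaled_pairing (linD c u v) phi x t = c * scaled_pairing u phi x t + scaled_pairing v phi x t.
Proof.
move=> ab Eu Ev sp; rewrite /scaled_pairing.
rewrite (pairing_linD _ _ _ _ _ _ ab Eu Ev (smooth_dil x t _ sp)).
by rewrite mulrDr mulrCA.
Qed.

Lemma scaled_pairing_oppD a b u phi x t : a <= b -> Eprime a b u -> smooth phi ->
  scaled_pairing (oppD u) phi x t = - scaled_pairing u phi x t.
Proof.
move=> ab Eu sp; rewrite /oppD (scaled_pairing_linD _ _ _ _ _ _ _ _ ab Eu Eu sp).
by rewrite mulNr mulr_natl mulr2n opprD addrNK.
Qed.

Lemma mass_linD a b c u v : a <= b -> Eprime a b u -> Eprime a b v ->
  mass (linD c u v) = c * mass u + mass v.
Proof. by move=> ab Eu Ev; exact: pairing_linD ab Eu Ev (smooth_cst 1). Qed.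

Lemma mass_oppD a b u : a <= b -> Eprime a b u -> mass (oppD u) = - mass u.
Proof.
move=> ab Eu; rewrite (mass_linD _ _ _ _ _ ab Eu Eu).
by rewrite mulNr mulr_natl mulr2n opprD addrNK.
Qed.

Lemma upper_value_oppD a b u phi x : a <= b -> Eprime a b u -> smooth phi ->
  upper_value u phi x = (- lower_value (oppD u) phi x)%E.
Proof.
move=> ab Eu sp; rewrite /lower_value /upper_value /limf_einf oppeK; congr limf_esup.
by apply/funext => t; rewrite /= (scaled_pairing_oppD _ _ _ _ _ _ ab Eu sp) -?EFinN opprK.
Qed.

(* The distributions u of the major pairs (u, primD u). Minor pairs for f are handled through
   majorants of -f. *)
Definition majorant a b f u := good a b u /\ exists E Z : set R,
  [/\ countable E, mu.-negligible Z,
      forall x phi, a <= x <= b -> ~ Z x -> T0 phi -> forall r, (r%:E < f x)%E ->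
        \forall t \near 0^'+, r <= scaled_pairing u phi x t &
      forall x phi, a <= x <= b -> ~ E x -> T1 phi -> exists r,
        \forall t \near 0^'+, r <= scaled_pairing u phi x t].

Lemma lower_value_finite u phi x : (-oo < lower_value u phi x)%E <->
  exists r, \forall t \near 0^'+, r <= scaled_pairing u phi x t.
Proof.
split=> [H|[r Hr]].
  have [q Hq] : exists q : R, (q%:E < lower_value u phi x)%E.
    case: (lower_value u phi x) H => [s||]//; last by exists 0; exact: ltry.
    by exists (s - 1); rewrite lte_fin ltrBlDr ltrDl.
  by exists q; exact: (lower_valueP _ _ _ _).1 (lexx _) _ Hq.
apply: lt_le_trans (ltNyr r) ((lower_valueP _ _ _ _).2 _) => s.
by rewrite lte_fin => /ltW sr; apply: filterS Hr => t; exact: le_trans.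
Qed.

Lemma T0_smooth phi : T0 phi -> smooth phi. Proof. by case. Qed.

Lemma Lojasiewicz_good a b u U : a <= b -> Eprime a b u -> Lojasiewicz U -> is_derivative U u ->
  point_value U a 0 -> good a b u /\ forall x c, point_value U x c -> point_value (primD u) x c.
Proof.
move=> ab Eu [dU LU] UU Ua.
have K x c : point_value U x c -> point_value (primD u) x c.
  by apply: point_value_eq => A phi; exact: primitive_unique ab Eu dU UU Ua _ _.
split=> //; split=> // x; have [c Hc] := LU x; exists c; exact: K.
Qed.

Lemma good_Lojasiewicz a b u : a <= b -> good a b u ->
  [/\ Lojasiewicz (primD u), is_derivative (primD u) u, point_value (primD u) a 0 &
      point_value (primD u) b (mass u)].
Proof.
move=> ab [Eu gu]; split.
- by split=> //; exact: dist_primD ab Eu.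
- exact: is_derivative_primD ab Eu.
- by have [c Hc] := gu a; rewrite -(primD_value_left _ _ _ _ ab Eu Hc).
- by have [c Hc] := gu b; rewrite -(primD_value_right _ _ _ _ ab Eu Hc).
Qed.

Lemma itv_mem a b (x : R) (D : set R) :
  (`[a, b] `\` D)%classic x <-> a <= x <= b /\ ~ D x.
Proof. by rewrite /setD /= in_itv. Qed.

Lemma major_pairP a b f : a <= b ->
  (forall u U, major_pair a b f u U -> majorant a b f u /\
    forall c, point_value U b c -> c = mass u) /\
  (forall u, majorant a b f u -> major_pair a b f u (primD u) /\
    point_value (primD u) b (mass u)).
Proof.
move=> ab; split=> [u U [Eu LU UU Ua [E [Z [cE nZ H0 H1]]]]|u [gu [E [Z [cE nZ H0 H1]]]]].
  have [gu K] := Lojasiewicz_good _ _ _ _ ab Eu LU UU Ua.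
  split; last by move=> c /K; exact: primD_value_right ab Eu.
  split=> //; exists E, Z; split=> //.
  - by move=> x phi ix Zx Tp; apply/lower_valueP; apply: H0 => //; exact/itv_mem.
  - by move=> x phi ix Ex Tp; apply/lower_value_finite; apply: H1 => //; exact/itv_mem.
have [L1 L2 L3 L4] := good_Lojasiewicz _ _ _ ab gu; split=> //; split=> //; first by have [] := gu.
exists E, Z; split=> //.
- by move=> x phi /itv_mem[ix Zx] Tp; apply/lower_valueP; exact: H0.
- by move=> x phi /itv_mem[ix Ex] Tp; apply/lower_value_finite; exact: H1.
Qed.

Lemma minor_pairP a b f : a <= b ->
  (forall v V, minor_pair a b f v V -> majorant a b (fun x => - f x)%E (oppD v) /\
    forall c, point_value V b c -> c = - mass (oppD v)) /\
  (forall w, majorant a b (fun x => - f x)%E w -> minor_pair a b f (oppD w) (primD (oppD w)) /\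
    point_value (primD (oppD w)) b (- mass w)).
Proof.
move=> ab; split=> [v V [Ev LV VV Va [E [Z [cE nZ H0 H1]]]]|w [gw [E [Z [cE nZ H0 H1]]]]].
  have [gv K] := Lojasiewicz_good _ _ _ _ ab Ev LV VV Va.
  split; last first.
    by move=> c /K /(primD_value_right _ _ _ _ ab Ev) ->; rewrite (mass_oppD _ _ _ ab Ev) opprK.
  split; first exact: good_linD.
  exists E, Z; split=> //.
  - move=> x phi ix Zx Tp; apply/lower_valueP; rewrite leeNl.
    by rewrite -(upper_value_oppD _ _ _ _ _ ab Ev (T0_smooth _ Tp)); apply: H0 => //; exact/itv_mem.
  - move=> x phi ix Ex Tp; apply/lower_value_finite; rewrite -lteN2.
    rewrite -(upper_value_oppD _ _ _ _ _ ab Ev (T0_smooth _ Tp.1)).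
    by apply: H1 => //; exact/itv_mem.
have gw' : good a b (oppD w) by exact: good_linD.
have [L1 L2 L3 L4] := good_Lojasiewicz _ _ _ ab gw'.
rewrite (mass_oppD _ _ _ ab gw.1) in L4; split=> //; split=> //; first by have [] := gw'.
have EE phi x : smooth phi -> upper_value (oppD w) phi x = (- lower_value w phi x)%E.
  move=> sp; rewrite (upper_value_oppD _ _ _ _ _ ab gw'.1 sp); congr (- limf_einf _ _)%E.
  apply/funext => t; rewrite (scaled_pairing_oppD _ _ _ _ _ _ ab gw'.1 sp).
  by rewrite (scaled_pairing_oppD _ _ _ _ _ _ ab gw.1 sp) opprK.
exists E, Z; split=> //.
- move=> x phi /itv_mem[ix Zx] Tp; rewrite (EE _ _ (T0_smooth _ Tp)) leeNl.
  by apply/lower_valueP; exact: H0.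
- move=> x phi /itv_mem[ix Ex] Tp; rewrite (EE _ _ (T0_smooth _ Tp.1)) lteNl/=.
  by apply/lower_value_finite; exact: H1.
Qed.

Lemma major_valuesE a b f : a <= b ->
  major_values a b f = [set (mass u)%:E | u in majorant a b f].
Proof.
move=> ab; have [H1 H2] := major_pairP a b f ab; apply/seteqP; split=> x /=.
  by move=> [c [u [U [/H1[Mu /[apply] ->]]]] <-]; exists u.
move=> [u Mu <-]; exists (mass u) => //; have [p v] := H2 _ Mu.
by exists u, (primD u).
Qed.

Lemma minor_valuesE a b f : a <= b ->
  minor_values a b f = [set (- mass w)%:E | w in majorant a b (fun x => - f x)%E].
Proof.
move=> ab; have [H1 H2] := minor_pairP a b f ab; apply/seteqP; split=> x /=.
  by move=> [c [v [V [/H1[Mv /[apply] ->]]]] <-]; exists (oppD v).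
move=> [w Mw <-]; exists (- mass w) => //; have [p v] := H2 _ Mw.
by exists (oppD w), (primD (oppD w)).
Qed.

(** The inequality between minor and major values that a monotonicity theorem would give. Together
    with arbitrarily small gaps it yields integrability. *)
Definition consistent a b g := forall u w, majorant a b g u ->
  majorant a b (fun x => - g x)%E w -> 0 <= mass u + mass w.

Lemma dist_int_bounds a b g u w : a <= b -> consistent a b g -> majorant a b g u ->
  majorant a b (fun x => - g x)%E w -> - mass w <= dist_int a b g <= mass u.
Proof.
move=> ab cg Mu Mw; rewrite /dist_int (major_valuesE _ _ _ ab).
set S := [set _ | _ in _]; have h1 : (ereal_inf S <= (mass u)%:E)%E.
  by apply: ereal_inf_lbound; exists u.
have h2 : ((- mass w)%:E <= ereal_inf S)%E.
  apply: le_ereal_inf_tmp => _ [v Mv <-]; rewrite lee_fin.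
  by have := cg _ _ Mv Mw; rewrite -subr_ge0 opprK.
by case: (ereal_inf S) h1 h2 => [s||]//; rewrite !lee_fin => -> ->.
Qed.

Lemma dist_integrable_consistent a b f : a <= b -> dist_integrable a b f -> consistent a b f.
Proof.
move=> ab [_ _ H] u w Mu Mw; rewrite (major_valuesE _ _ _ ab) (minor_valuesE _ _ _ ab) in H.
suff : ((- mass w)%:E <= (mass u)%:E)%E by rewrite lee_fin -subr_ge0 opprK.
apply: (@le_trans _ _ (ereal_sup [set (- mass w)%:E | w in majorant a b (fun x => - f x)%E])).
  by apply: ereal_sup_ubound; exists w.
by rewrite H; apply: ereal_inf_lbound; exists u.
Qed.

(** The common extremum is finite, lying between a minor and a major value, so it is approached from
    both sides to within e / 2. *)
Lemma dist_integrable_gap a b f : a <= b -> dist_integrable a b f -> forall e, 0 < e ->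
  exists u w, [/\ majorant a b f u, majorant a b (fun x => - f x)%E w & mass u + mass w <= e].
Proof.
move=> ab If e e0; have cf := dist_integrable_consistent _ _ _ ab If.
have [[u0 [U0 /((major_pairP a b f ab).1)[Mu0 _]]] [v0 [V0 /((minor_pairP a b f ab).1)[Mw0 _]]] H] := If.
rewrite (major_valuesE _ _ _ ab) (minor_valuesE _ _ _ ab) in H.
set I := ereal_inf _ in H.
have h1 : (I <= (mass u0)%:E)%E by apply: ereal_inf_lbound; exists u0.
have h2 : ((- mass (oppD v0))%:E <= I)%E.
  by rewrite -H; apply: ereal_sup_ubound; exists (oppD v0).
have e2 : 0 < e / 2 by rewrite divr_gt0.
have [s sE] : exists s : R, I = s%:E.
  by case: (I) h1 h2 => [s||]// _ _; exists s.
have : (I < (s + e / 2)%:E)%E by rewrite sE lte_fin ltrDl.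
move=> /ereal_inf_lt[_ [u Mu <-]]; rewrite lte_fin => us.
have : ((s - e / 2)%:E < I)%E by rewrite sE lte_fin ltrBlDr ltrDl.
rewrite -H => /ereal_sup_gt[_ [w Mw <-]]; rewrite lte_fin => ws.
by exists u, w; split=> //; lra.
Qed.

Lemma gap_dist_integrable a b f : a <= b -> consistent a b f ->
  (forall e, 0 < e ->
  exists u w, [/\ majorant a b f u, majorant a b (fun x => - f x)%E w & mass u + mass w <= e]) ->
  dist_integrable a b f.
Proof.
move=> ab cf H; have [u0 [w0 [Mu0 Mw0 _]]] := H 1 ltr01.
split.
- by exists u0, (primD u0); apply: ((major_pairP a b f ab).2 _ Mu0).1.
- by exists (oppD w0), (primD (oppD w0)); apply: ((minor_pairP a b f ab).2 _ Mw0).1.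
rewrite (major_valuesE _ _ _ ab) (minor_valuesE _ _ _ ab); apply/eqP; rewrite eq_le; apply/andP; split.
  apply: ge_ereal_sup => _ [w Mw <-]; apply: le_ereal_inf_tmp => _ [u Mu <-].
  by rewrite lee_fin; have := cf _ _ Mu Mw; rewrite -subr_ge0 opprK.
apply/lee_addgt0Pr => e e0; have [u [w [Mu Mw uw]]] := H e e0.
apply: (@le_trans _ _ (mass u)%:E); first by apply: ereal_inf_lbound; exists u.
apply: (@le_trans _ _ ((- mass w)%:E + e%:E)%E); first by rewrite -EFinD lee_fin; lra.
by rewrite leeD2r//; apply: ereal_sup_ubound; exists w.
Qed.

End Majorants.

(** * Combinations of majorants with nonnegative coefficients *)

Section CombineMajorants.
Context {R : realType}.
Local Notation mu := (@lebesgue_measure R).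
Implicit Types (u v w U : (R -> R) -> R) (phi psi al be : R -> R) (f g h : R -> \bar R).
Implicit Types (x t r a b c e p q : R).

Lemma scaled_pairing_eq a b u v phi x t : a <= b -> Eprime a b u -> Eprime a b v ->
  (forall A psi, tst A psi -> u psi = v psi) -> smooth phi ->
  scaled_pairing u phi x t = scaled_pairing v phi x t.
Proof.
move=> ab Eu Ev uv sp; congr (_ * _).
exact: pairing_eq ab Eu Ev uv (smooth_dil x t _ sp).
Qed.

(** The difference is the mean value of (al - al(x)) u, which has the point value 0 at [x];
    [T0_limit] covers test functions without compact support. *)
Lemma scaled_pairing_mulD a b u al phi x : a <= b -> good a b u -> smooth al -> T0 phi ->
  scaled_pairing (mulD al u) phi x t - al x * scaled_pairing u phi x t @[t --> 0^'+] --> (0 : R).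
Proof.
move=> ab gu sa Tp; have sp := T0_smooth _ Tp.
have sb : smooth (fun y => al y - al x) by exact: smoothB _ _ sa (smooth_cst (al x)).
have ED := Eprime_mulD a b _ u sb gu.1.
have := T0_limit a b _ x 0 phi ab ED (point_value_flat_good a b u x al ab sa gu) Tp.
apply: near_cvg => t t0.
rewrite (scaled_pairing_eq a b (mulD al u) _ phi x t ab (Eprime_mulD a b _ u sa gu.1)
  (Eprime_linD a b (al x) _ _ gu.1 ED) (fun A (k : R -> R) tk => mulD_split al u x A k sa gu.1.1 tk) sp).
by rewrite (scaled_pairing_linD a b _ _ _ _ _ _ ab gu.1 ED sp) addrAC subrr add0r.
Qed.

Lemma near_small (F : R -> R) e : 0 < e -> F t @[t --> 0^'+] --> (0 : R) ->
  \forall t \near 0^'+, `|F t| <= e.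
Proof.
move=> e0 /cvg0P/(_ e e0)[d d0 Hd]; apply/near0P; exists d => // t td.
by have := Hd t td; rewrite subr0.
Qed.

Definition combD al be u w := linD 1 (mulD al u) (mulD be w).

Lemma good_combD a b al be u w : a <= b -> smooth al -> smooth be -> good a b u -> good a b w ->
  good a b (combD al be u w).
Proof.
move=> ab sa sb gu gw.
exact: good_linD ab (good_mulD a b al u ab sa gu) (good_mulD a b be w ab sb gw).
Qed.

Lemma mass_combD a b al be u w : a <= b -> smooth al -> smooth be -> good a b u -> good a b w ->
  mass (combD al be u w) = pairing u al + pairing w be.
Proof.
move=> ab sa sb gu gw.
rewrite (mass_linD a b _ _ _ ab (Eprime_mulD a b _ _ sa gu.1) (Eprime_mulD a b _ _ sb gw.1)) mul1r.
rewrite /mass (pairing_mulD a b _ _ _ ab sa gu.1 (smooth_cst 1)).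
rewrite (pairing_mulD a b _ _ _ ab sb gw.1 (smooth_cst 1)).
by congr (pairing u _ + pairing w _); apply/funext => y; rewrite mulr1.
Qed.

(** Giving away d / (al + be + 1) in each of the two mean values costs at most d altogether, and
    each error term costs another d. *)
Lemma comb_lower (al be p q d s s' E1 E2 : R) : 0 <= al -> 0 <= be -> 0 < d ->
  p - d / (al + be + 1) <= s -> q - d / (al + be + 1) <= s' ->
  `|E1 - al * s| <= d -> `|E2 - be * s'| <= d ->
  al * p + be * q - 3 * d <= 1 * E1 + E2.
Proof.
move=> a0 b0 d0 h1 h2 + +; rewrite !ler_norml => /andP[e1 _] /andP[e2 _].
set k := d / _ in h1 h2; have n0 : 0 < al + be + 1 by lra.
have kE : k * (al + be + 1) = d by rewrite mulfVK// gt_eqF.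
have k0 : 0 < k by rewrite divr_gt0.
have m1 : al * (p - k) <= al * s by rewrite ler_wpM2l.
have m2 : be * (q - k) <= be * s' by rewrite ler_wpM2l.
have := mulr_ge0 a0 (ltW k0); have := mulr_ge0 b0 (ltW k0).
by rewrite mulrBr in m1; rewrite mulrBr in m2; rewrite !mulrDr in kE; lra.
Qed.

(** At [x] the mean values of the combination behave like those of al(x) u + be(x) w, and
    nonnegative coefficients preserve lower bounds. The real witnesses [p] and [q] avoid sums of
    opposite infinities; [N] collects the points where they may fail to exist. *)
Lemma majorant_comb a b al be f g h u w (N : set R) : a <= b -> smooth al -> smooth be ->
  (forall x, a <= x <= b -> 0 <= al x /\ 0 <= be x) ->
  majorant a b f u -> majorant a b g w -> mu.-negligible N ->
  (forall x, a <= x <= b -> ~ N x -> exists p q,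
     [/\ (p%:E <= f x)%E, (q%:E <= g x)%E & (h x <= (al x * p + be x * q)%:E)%E]) ->
  majorant a b h (combD al be u w).
Proof.
move=> ab sa sb pos [gu [E1 [Z1 [cE1 nZ1 H1 K1]]]] [gw [E2 [Z2 [cE2 nZ2 H2 K2]]]] nN Hh.
have EA := Eprime_mulD a b _ _ sa gu.1; have EB := Eprime_mulD a b _ _ sb gw.1.
split; first exact: good_combD.
have main x phi p q (d : R) : a <= x <= b -> T0 phi -> 0 < d ->
    (\forall t \near 0^'+, p - d / (al x + be x + 1) <= scaled_pairing u phi x t) ->
    (\forall t \near 0^'+, q - d / (al x + be x + 1) <= scaled_pairing w phi x t) ->
    \forall t \near 0^'+, al x * p + be x * q - 3 * d <= scaled_pairing (combD al be u w) phi x t.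
  move=> ix Tp d0 h1 h2; have [a0 b0] := pos x ix.
  have e1 := near_small _ d d0 (scaled_pairing_mulD a b u al phi x ab gu sa Tp).
  have e2 := near_small _ d d0 (scaled_pairing_mulD a b w be phi x ab gw sb Tp).
  near=> t.
  rewrite (scaled_pairing_linD a b _ _ _ _ _ _ ab EA EB (T0_smooth _ Tp)).
  by apply: (comb_lower (al x) (be x) p q d (scaled_pairing u phi x t)
    (scaled_pairing w phi x t)) => //; near: t.
exists (E1 `|` E2), (N `|` (Z1 `|` Z2)); split.
- rewrite -bigcup2E; apply: bigcup_countable => // i _; rewrite /bigcup2.
  by case: ifP => // _; case: ifP.
- by apply: negligibleU => //; exact: negligibleU.
- move=> x phi ix NZ Tp r rh.
  have xN : ~ N x by move=> ?; apply: NZ; left.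
  have x1 : ~ Z1 x by move=> ?; apply: NZ; right; left.
  have x2 : ~ Z2 x by move=> ?; apply: NZ; right; right.
  have [p [q [pf qg hpq]]] := Hh x ix xN; have [a0 b0] := pos x ix.
  have := lt_le_trans rh hpq; rewrite lte_fin => rpq.
  pose d := (al x * p + be x * q - r) / 3.
  have d0 : 0 < d by rewrite divr_gt0// subr_gt0.
  have k0 : 0 < d / (al x + be x + 1) by rewrite divr_gt0// ltr_wpDl// addr_ge0.
  have rE : r = al x * p + be x * q - 3 * d by rewrite /d [3 * _]mulrC mulfVK// opprB addrC subrK.
  rewrite rE; apply: (main x phi p q d ix Tp d0).
    apply: (H1 x phi ix x1 Tp); apply: (@lt_le_trans _ _ p%:E) pf.
    by rewrite lte_fin ltrBlDr ltrDl.
  apply: (H2 x phi ix x2 Tp); apply: (@lt_le_trans _ _ q%:E) qg.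
  by rewrite lte_fin ltrBlDr ltrDl.
- move=> x phi ix NE Tp.
  have x1 : ~ E1 x by move=> ?; apply: NE; left.
  have x2 : ~ E2 x by move=> ?; apply: NE; right.
  have [p Hp] := K1 x phi ix x1 Tp; have [q Hq] := K2 x phi ix x2 Tp.
  have [a0 b0] := pos x ix.
  exists (al x * p + be x * q - 3 * 1); apply: (main x phi p q 1 ix Tp.1 ltr01).
    by apply: filterS Hp => t; apply: le_trans; rewrite lerBlDr lerDl divr_ge0// addr_ge0// addr_ge0.
  by apply: filterS Hq => t; apply: le_trans; rewrite lerBlDr lerDl divr_ge0// addr_ge0// addr_ge0.
Unshelve. all: by end_near.
Qed.

Lemma majorant_pinfty a b f u : a <= b -> majorant a b f u ->
  mu.-negligible [set x : R | a <= x <= b /\ f x = +oo%E].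
Proof.
move=> ab [gu [E [Z [cE nZ H K]]]].
have nI := negligibleU nZ (infinite_null a b u ab gu).
apply: negligibleS nI => x [ix fx]; have [|nz] := pselect (Z x); first by left.
right; split=> // phi Tp N; apply: (H x phi ix nz Tp).
by rewrite fx ltry.
Qed.

Lemma dist_integrable_finite a b f : a <= b -> dist_integrable a b f ->
  mu.-negligible [set x : R | a <= x <= b /\ f x \isn't a fin_num].
Proof.
move=> ab If; have [u [w [Mu Mw _]]] := dist_integrable_gap _ _ _ ab If 1 ltr01.
have nI := negligibleU (majorant_pinfty a b f u ab Mu) (majorant_pinfty a b _ w ab Mw).
apply: negligibleS nI => x [ix]; rewrite fin_numE negb_and !negbK => /orP[] /eqP fx.
  by right; split=> //; rewrite fx.
by left.
Qed.

(* If w majorizes 0 then u + k w majorizes f for all k >= 0; as the masses of the majorants of f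
   are bounded below, mass w cannot be negative. *)
Lemma mass_ge0 a b f w : a <= b -> dist_integrable a b f -> majorant a b (fun=> 0%E) w ->
  0 <= mass w.
Proof.
move=> ab If Mw; rewrite leNgt; apply/negP => w0.
have [u [v [Mu Mv _]]] := dist_integrable_gap _ _ _ ab If 1 ltr01.
have cf := dist_integrable_consistent _ _ _ ab If.
have S k : 0 <= k -> 0 <= mass u + k * mass w + mass v.
  move=> k0.
  have Mk : majorant a b f (combD (fun=> 1) (fun=> k) u w).
    apply: majorant_comb ab (smooth_cst 1) (smooth_cst k) _ Mu Mw (dist_integrable_finite _ _ _ ab If) _.
      by move=> x _; split.
    move=> x ix nf; have fx : f x \is a fin_num by apply/negPn/negP => ?; apply: nf.
    exists (fine (f x)), 0; rewrite fineK//; split=> //.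
    by rewrite mul1r mulr0 addr0 fineK.
  have := cf _ _ Mk Mv; rewrite (mass_combD a b _ _ _ _ ab (smooth_cst 1) (smooth_cst k) Mu.1 Mw.1).
  have := pairingL w a b k (fun=> 1) (fun=> 0) ab Mw.1.1 (smooth_cst 1) (smooth_cst 0).
  have -> : (fun=> k * 1 + 0) = (fun=> k) :> (R -> R) by apply/funext => y; rewrite mulr1 addr0.
  have -> : pairing w (fun=> 0) = 0.
    rewrite (pairingE w a b _ _ ab Mw.1.1 (lexx _) (smooth_cst 0)).
    under eq_fun do rewrite mulr0.
    exact: dist0 Mw.1.1.1.
  by move=> ->; rewrite addr0.
(* For this [k] the quantity that [S] claims to be nonnegative equals -1. *)
have /S : 0 <= (mass u + mass v + 1) / - mass w.
  rewrite divr_ge0// ?oppr_ge0 ?ltW// ltr_wpDl//.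
  by have := S 0 (lexx 0); rewrite mul0r addr0.
rewrite invrN mulrN mulNr mulfVK ?lt_eqF//.
by move=> ?; lra.
Qed.

Lemma majorant_sum a b c f g u w : a <= c -> c <= b -> dist_integrable a b f ->
  (forall x, a <= x <= c -> f x \is a fin_num -> g x \is a fin_num) ->
  majorant a c g u -> majorant a c (fun x => - g x)%E w ->
  majorant a c (fun=> 0%E) (combD (fun=> 1) (fun=> 1) u w).
Proof.
move=> ac cb If fg Mu Mw; have ab := le_trans ac cb.
apply: majorant_comb ac (smooth_cst 1) (smooth_cst 1) _ Mu Mw (dist_integrable_finite _ _ _ ab If) _.
  by move=> x _; split.
move=> x ix nf; have ix' : a <= x <= b.
  by case/andP: ix => ? ?; apply/andP; split=> //; exact: le_trans cb.
have fx : f x \is a fin_num by apply/negPn/negP => ?; apply: nf.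
have gx := fg x ix fx.
exists (fine (g x)), (- fine (g x)); rewrite EFinN !fineK//; split=> //.
by rewrite !mul1r subrr.
Qed.

(** Beyond [c] the distribution [w] vanishes, so its mean values tend to 0 by [T0_limit]. This
    carries a majorant from [a, c] to the interval on which the integrable function of [mass_ge0]
    lives. *)
Lemma majorant_extend a b c w : a <= c -> c <= b -> majorant a c (fun=> 0%E) w ->
  majorant a b (fun=> 0%E) w.
Proof.
move=> ac cb [gw [E [Z [cE nZ H K]]]]; have ab := le_trans ac cb.
have Ew : Eprime a b w by exact: Eprime_mono (lexx a) cb gw.1.
have out x phi : a <= x <= b -> c < x -> T0 phi ->
    scaled_pairing w phi x t @[t --> 0^'+] --> (0 : R).
  move=> ix cx Tp; apply: (T0_limit a b w x 0 phi ab Ew _ Tp).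
  have e0 : 0 < (x - c) / 2 by rewrite divr_gt0// subr_gt0.
  apply: (point_value_local (fun=> 0) w x 0 _ e0) => [A f tf f0|].
    apply/esym/gw.1.2; first exact: tst_test tf.
    have out y : ~ `[x - (x - c) / 2, x + (x - c) / 2]%classic y -> f y = 0.
      rewrite /= in_itv/= => /negP ny; apply: f0; rewrite leNgt; apply: contra ny.
      by rewrite ltr_norml => /andP[? ?]; lra.
    have cI : closed (`[x - (x - c) / 2, x + (x - c) / 2]%classic : set R) by exact: itv_closed.
    move=> y /(tsupport_sub _ _ cI out); rewrite /= !in_itv/= => /andP[y1 _] /andP[_ y2].
    lra.
  apply/point_valueP => A f _; rewrite mul0r.
  by under eq_fun do rewrite mulr0; exact: cvg_cst.
split; first by split=> //; exact: gw.2.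
exists E, Z; split=> //.
- move=> x phi ix nz Tp r r0; have [xc|cx] := leP x c.
    by apply: (H x phi _ nz Tp r r0); case/andP: ix => -> _.
  have r0' : 0 < - r by move: r0; rewrite lte_fin oppr_gt0.
  apply: filterS (near_small _ _ r0' (out x phi ix cx Tp)) => t.
  by rewrite ler_norml => /andP[]; rewrite opprK.
- move=> x phi ix ne Tp; have [xc|cx] := leP x c.
    by apply: (K x phi _ ne Tp); case/andP: ix => -> _.
  exists (- 1); apply: filterS (near_small _ _ ltr01 (out x phi ix cx Tp.1)) => t.
  by rewrite ler_norml => /andP[].
Qed.

(** The sum of [u] and [w] majorizes 0, so [mass_ge0] applies to it. [f] enters through its
    finiteness and through the sign of masses, so the lemma serves [f] on subintervals as well as
    the two integrands of the theorem. *)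
Lemma consistent_fin a b c f g : a <= c -> c <= b -> dist_integrable a b f ->
  (forall x, a <= x <= c -> f x \is a fin_num -> g x \is a fin_num) -> consistent a c g.
Proof.
move=> ac cb If fg u w Mu Mw.
have M0 := majorant_extend a b c _ ac cb (majorant_sum a b c f g u w ac cb If fg Mu Mw).
have := mass_ge0 _ _ _ _ (le_trans ac cb) If M0.
by rewrite (mass_combD a c _ _ _ _ ac (smooth_cst 1) (smooth_cst 1) Mu.1 Mw.1).
Qed.

End CombineMajorants.

(** * Integration by parts *)

Section BalancedPrimitive.
Context {R : realType}.
Local Notation tail phi := (fun y => intR phi - prim phi y).
Implicit Types (u v w : (R -> R) -> R) (phi psi f F G : R -> R).
Implicit Types (x y z t r a b c e p q k A : R).

Lemma constant_on f p q x y : smooth f -> (forall z, p < z < q -> derive1 f z = 0) ->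
  p < x < q -> p < y < q -> f x = f y.
Proof.
move=> sf f0.
suff W s t : p < s < q -> p < t < q -> s <= t -> f s = f t.
  by move=> hx hy; have [xy|/ltW yx] := leP x y; [exact: W|apply/esym; exact: W].
move=> /andP[ps _] /andP[_ tq] st.
have cf : {within `[s, t], continuous f} by apply: continuous_subspaceT; exact: smooth_continuous sf.
have [z] := MVT_segment st (fun z _ => smooth_is_derive f z sf) cf.
rewrite in_itv/= => /andP[sz zt]; rewrite f0; last by apply/andP; split; lra.
by rewrite mul0r => /eqP; rewrite subr_eq0 => /eqP ->.
Qed.

Lemma pairing_local a b u F G p q : a <= b -> Eprime a b u -> p < a -> b < q ->
  smooth F -> smooth G -> (forall z, p < z < q -> F z = G z) -> pairing u F = pairing u G.
Proof.
move=> ab Eu pa bq sF sG FG.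
rewrite (pairingE _ a b _ _ ab Eu (lexx _) sF) (pairingE _ a b _ _ ab Eu (lexx _) sG).
have tc := tst_cutr _ (hull_radius_gt0 a b).
apply: (dist_eq_on u a b `]p, q[%classic _ _ _ Eu _ _ (tstMl _ _ _ tc sF) (tstMl _ _ _ tc sG)).
- exact: interval_open.
- by move=> z /=; rewrite !in_itv/= => /andP[az zb]; apply/andP; split; lra.
- by move=> z /=; rewrite in_itv/= => /FG ->.
Qed.

Lemma pairing_cst a b u k : a <= b -> Eprime a b u -> pairing u (fun=> k) = k * mass u.
Proof.
move=> ab Eu; rewrite /mass.
rewrite (pairingE u a b _ _ ab Eu (lexx _) (smooth_cst k)).
rewrite (pairingE u a b _ _ ab Eu (lexx _) (smooth_cst 1)).
have tc := tst_cutr _ (hull_radius_gt0 a b).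
rewrite -(distZ _ _ _ _ Eu.1 (tstMl _ _ _ tc (smooth_cst 1))); congr u.
by apply/funext => y; rewrite mulr1 mulrC.
Qed.

(** For a test function supported off [a, b] the tail is constant near [a, b], and [u] of a constant
    is a multiple of the mass, here 0. *)
Lemma primD_Eprime a b u : a <= b -> Eprime a b u -> mass u = 0 -> Eprime a b (primD u).
Proof.
move=> ab Eu u0; split; first exact: dist_primD ab Eu.
move=> phi /test_functionP[A A0 tp] sup.
have cI : compact (`[a, b]%classic : set R) by exact: segment_compact.
have sup' : tsupport phi `<=` ~` `[a, b]%classic by [].
have [e1 e10 H1] := tst_vanish_near A phi _ a cI ltac:(by rewrite /= in_itv/= lexx) tp sup'.
have [e2 e20 H2] := tst_vanish_near A phi _ b cI ltac:(by rewrite /= in_itv/= lexx andbT) tp sup'.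
have p0 z : a - e1 < z < b + e2 -> phi z = 0.
  move=> /andP[z1 z2]; have [za|az] := ltP z a.
    by apply: H1; rewrite ltr_norml; apply/andP; split; lra.
  have [zb|bz] := leP z b.
    apply: contrapT => /eqP pz; have : tsupport phi z by apply: subset_closure.
    by move=> /sup'; apply; rewrite /= in_itv/= az.
  by apply: H2; rewrite ltr_norml; apply/andP; split; lra.
rewrite /primD (pairing_local a b u _ (fun=> intR phi - prim phi b) (a - e1) (b + e2) ab Eu).
- by rewrite (pairing_cst _ _ _ _ ab Eu) u0 mulr0.
- by rewrite ltrBlDr ltrDl.
- by rewrite ltrDl.
- exact: smooth_tail tp.
- exact: smooth_cst.
- move=> z hz; congr (_ - _); apply: (constant_on _ (a - e1) (b + e2)) hz _.
  + exact: smooth_prim tp.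
  + by move=> y hy; rewrite (derive1_prim _ _ tp) p0.
  + by apply/andP; split; lra.
Qed.

Definition deltaD b phi : R := phi b.

Lemma Eprime_deltaD a b : a <= b -> Eprime a b (deltaD b).
Proof.
move=> ab; split.
  apply: dist_intro => [//|A _]; exists 1, 0%N => f M _ H.
  by rewrite mul1r; exact: H 0%N b (leqnn 0).
move=> phi _ sup; apply: contrapT => /eqP pb.
have : tsupport phi b by apply: subset_closure.
by move=> /sup; apply; rewrite /= in_itv/= ab lexx.
Qed.

Lemma pairing_deltaD a b F : a <= b -> smooth F -> pairing (deltaD b) F = F b.
Proof.
move=> ab sF; rewrite (pairingE _ a b _ _ ab (Eprime_deltaD a b ab) (lexx _) sF) /deltaD.
rewrite cutr1 ?mul1r ?hull_radius_gt0//; apply/ltW/hull_radius_norm.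
by rewrite ab lexx.
Qed.

(** The primitive of the point mass at [b] is the jump from 0 to 1 there, so [primD (balance b u)]
    is [primD u] cut off to the right of [b]. *)
Definition balance b u := linD (- mass u) (deltaD b) u.

Lemma Eprime_balance a b u : a <= b -> Eprime a b u -> Eprime a b (balance b u).
Proof. by move=> ab Eu; exact: Eprime_linD (Eprime_deltaD a b ab) Eu. Qed.

Lemma mass_balance a b u : a <= b -> Eprime a b u -> mass (balance b u) = 0.
Proof.
move=> ab Eu; rewrite (mass_linD a b _ _ _ ab (Eprime_deltaD a b ab) Eu).
by rewrite /mass (pairing_deltaD a b _ ab (smooth_cst 1)) mulr1 addNr.
Qed.

Lemma primD_balance a b u A phi : a <= b -> Eprime a b u -> tst A phi ->
  primD (balance b u) phi = - mass u * (intR phi - prim phi b) + primD u phi.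
Proof.
move=> ab Eu tp.
rewrite (primD_linD a b _ _ _ _ _ ab (Eprime_deltaD a b ab) Eu tp) /linD; congr (_ * _ + _).
exact: pairing_deltaD a b _ ab (smooth_tail _ _ tp).
Qed.

(** The cut-off primitive jumps at [b], so it has no point value there in general. Its mean values
    are bounded at every point, which is what [primD_point_value] asks for. *)
Lemma good_primD_balance a b u : a <= b -> good a b u -> good a b (primD (balance b u)).
Proof.
move=> ab gu; have Eb := Eprime_balance a b u ab gu.1.
have EP := primD_Eprime a b _ ab Eb (mass_balance a b u ab gu.1).
split=> // x; apply: (primD_point_value a b _ x ab EP) => A0 phi tp0.
have [A Age tp] := tst_le_ge0 _ _ tp0.
have [M M0 HM] := tst_bounded 0 _ _ tp.
have HM' z : `|phi z| <= M by exact: HM 0%N z (leqnn 0).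
have [c Hc] := gu.2 x.
have [B [d [d0 HB]]] := point_value_bounded _ _ _ Hc A phi tp.
exists (`|mass u| * (`|intR phi| + M * (2 * A + 2)) + B), d; split=> // t td.
have t0 : 0 < t by case/andP: td.
rewrite (primD_balance a b _ _ _ ab gu.1 (tst_dil _ x _ _ t0 tp)).
rewrite (prim_dil _ _ _ _ t0 tp) (intR_dil _ _ _ _ t0 tp).
apply: le_trans (ler_normD _ _) _; rewrite [leRHS]mulrDl; apply: lerD; last exact: HB.
rewrite -mulrBr normrM normrN -mulrA; apply: ler_wpM2l => //.
rewrite normrM (gtr0_norm t0) mulrC; apply: ler_wpM2r; first exact: ltW.
apply: le_trans (ler_normB _ _) _; rewrite lerD2l; exact: prim_bound _ _ _ _ tp Age HM'.
Qed.

Lemma point_value_primD_balance a b u x c : a <= b -> good a b u -> x < b ->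
  point_value (primD u) x c -> point_value (primD (balance b u)) x c.
Proof.
move=> ab gu xb; have e0 : 0 < b - x by rewrite subr_gt0.
apply: (point_value_local _ _ _ _ _ e0) => A phi tp p0.
rewrite (primD_balance a b _ _ _ ab gu.1 tp) prim_eq_intR ?subrr ?mulr0 ?add0r// => z bz.
apply: p0; rewrite ger0_norm ?subr_ge0; first by lra.
by lra.
Qed.

(* Integration by parts: the primitive U of u, restricted to [a, b], is primD (balance b u). *)
Lemma pairing_primD_balance a b u F : a <= b -> good a b u -> smooth F ->
  pairing (primD (balance b u)) (derive1 F) = mass u * F b - pairing u F.
Proof.
move=> ab gu sF; have Eb := Eprime_balance a b u ab gu.1.
have EP := primD_Eprime a b _ ab Eb (mass_balance a b u ab gu.1).
have sF' := smooth_derive1 _ sF.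
set r := hull_radius a b; have r0 : 0 < r by exact: hull_radius_gt0.
have ar : - r < a.
  have : `|a| < r by apply: hull_radius_norm; rewrite lexx.
  by rewrite ltr_norml => /andP[].
have br : b < r.
  have : `|b| < r by apply: hull_radius_norm; rewrite ab lexx.
  by rewrite ltr_norml => /andP[].
rewrite (pairingE _ a b r _ ab EP (lexx _) sF').
set th := fun y => cutr r y * derive1 F y.
have tt : tst (2 * r) th by exact: tstMl _ _ _ (tst_cutr _ r0) sF'.
rewrite (primD_balance a b _ _ _ ab gu.1 tt).
set k := intR th - prim th b.
have sT := smooth_tail _ _ tt.
have sG : smooth (fun y => (-1) * F y + (k + F b)).
  exact: smoothD _ _ (smoothZ (-1) _ sF) (smooth_cst (k + F b)).
(* On (-r, r) the tail of [th] and [- F] have the same derivative, so they differ by a constant,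
   which is read off at [b]. *)
have -> : primD u th = pairing u (fun y => (-1) * F y + (k + F b)).
  apply: (pairing_local a b u _ _ (- r) r ab gu.1 ar br sT sG) => z hz.
  have sS : smooth (fun y => intR th - prim th y + F y) by exact: smoothD _ _ sT sF.
  have rb : - r < b < r by rewrite br (lt_le_trans ar ab).
  have dS y : - r < y < r -> derive1 (fun y => intR th - prim th y + F y) y = 0.
    move=> hy; rewrite (derive1D _ _ sT sF) (derive1_tail _ _ tt) /th cutr1//.
      by rewrite mul1r addNr.
    by rewrite ler_norml; case/andP: hy => /ltW -> /ltW ->.
  have E := constant_on _ (- r) r z b sS dS hz rb.
  by apply: (addIr (F z)); rewrite E mulN1r [RHS]addrC addNKr.
rewrite (pairingL u a b (-1) F _ ab gu.1 sF (smooth_cst (k + F b))).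
rewrite (pairing_cst a b u _ ab gu.1).
have alg (m l P f : R) : - m * l + (-1 * P + (l + f) * m) = m * f - P by ring.
exact: alg.
Qed.

(** Before [b] the mean values converge to the point value, by [T0_limit]; the jump makes [b] the
    exceptional point. *)
Lemma majorant_primD_balance a b u gam : a <= b -> good a b u ->
  (forall x, point_value (primD u) x (gam x)) ->
  majorant a b (fun x => (gam x)%:E) (primD (balance b u)).
Proof.
move=> ab gu Hg; have gP := good_primD_balance a b u ab gu.
split=> //; exists [set b], [set b].
have lim x phi : a <= x <= b -> ~ [set b] x -> T0 phi ->
    scaled_pairing (primD (balance b u)) phi x t @[t --> 0^'+] --> gam x.
  move=> /andP[_ xb] nb Tp; apply: (T0_limit a b _ x _ phi ab gP.1 _ Tp).
  apply: (point_value_primD_balance a b u x _ ab gu _ (Hg x)).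
  by rewrite lt_neqAle xb andbT; apply/eqP.
have low x phi e : a <= x <= b -> ~ [set b] x -> T0 phi -> 0 < e ->
    \forall t \near 0^'+, gam x - e <= scaled_pairing (primD (balance b u)) phi x t.
  move=> ix nb Tp e0; have /cvg0P/(_ e e0)[d d0 Hd] := lim x phi ix nb Tp.
  apply/near0P; exists d => // t td; have := Hd t td.
  by rewrite ler_norml => /andP[h _]; lra.
split.
- exact: countable1.
- by exists [set b]; split=> //; exact: lebesgue_measure_set1.
- move=> x phi ix nb Tp r; rewrite lte_fin -subr_gt0 => r0.
  by have := low x phi _ ix nb Tp r0; rewrite opprB addrC subrK.
- by move=> x phi ix nb Tp; exists (gam x - 1); exact: low ix nb Tp.1 ltr01.
Qed.

Lemma ereal_gap r (z : \bar R) : (r%:E < z)%E -> exists2 e, 0 < e & ((r + e)%:E < z)%E.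
Proof.
case: z => [s||]//; last by move=> _; exists 1; rewrite ?ltry.
rewrite lte_fin => rs; exists ((s - r) / 2); first by rewrite divr_gt0// subr_gt0.
by rewrite lte_fin; lra.
Qed.

(** Left of [c] the distributions [u] and [w] agree, so their mean values differ by a quantity
    tending to 0; [c] itself joins the exceptional sets. *)
Lemma majorant_truncate a b c (g : R -> \bar R) u gam : a < c -> c <= b -> majorant a b g u ->
  point_value (primD u) c gam -> exists w, majorant a c g w /\ mass w = gam.
Proof.
move=> ac cb [gu [E [Z [cE nZ H K]]]] uc.
have ab : a <= b by apply: le_trans cb; exact: ltW.
have [w [gw mw wu]] := good_truncate a b c u gam ac cb gu uc.
have Ew : Eprime a b w by exact: Eprime_mono (lexx a) cb gw.1.
exists w; split=> //; split=> //; exists (E `|` [set c]), (Z `|` [set c]).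
have small x phi e : a <= x <= c -> ~ [set c] x -> T0 phi -> 0 < e ->
    \forall t \near 0^'+, scaled_pairing u phi x t - e <= scaled_pairing w phi x t.
  move=> /andP[_ xc] nc Tp e0.
  have {}xc : x < c by rewrite lt_neqAle xc andbT; apply/eqP.
  have h0 : 0 < (c - x) / 2 by rewrite divr_gt0// subr_gt0.
  have pv : point_value (linD (-1) u w) x 0.
    apply: (point_value_local (fun=> 0) _ _ _ _ h0) => [A phi' tp p0|].
      rewrite /linD (wu A phi' ((c - x) / 2) tp h0) ?mulN1r ?addNr// => z hz.
      by apply: p0; rewrite ger0_norm; lra.
    apply/point_valueP => A phi' _; rewrite mul0r.
    by under eq_fun do rewrite mulr0; exact: cvg_cst.
  have := near_small _ _ e0 (T0_limit a b _ x 0 phi ab (Eprime_linD a b _ _ _ gu.1 Ew) pv Tp).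
  apply: filterS => t.
  rewrite (scaled_pairing_linD a b _ _ _ _ _ _ ab gu.1 Ew (T0_smooth _ Tp)) mulN1r.
  by rewrite ler_norml => /andP[h _]; lra.
have inj x : a <= x <= c -> a <= x <= b.
  by move=> /andP[-> xc] /=; exact: le_trans xc cb.
split.
- rewrite -bigcup2E; apply: bigcup_countable => // i _; rewrite /bigcup2.
  by case: ifP => // _; case: ifP.
- by apply: negligibleU => //; exists [set c]; split=> //; exact: lebesgue_measure_set1.
- move=> x phi ix nx Tp r /ereal_gap[e e0 re].
  have n1 : ~ Z x by move=> ?; apply: nx; left.
  have n2 : ~ [set c] x by move=> ?; apply: nx; right.
  have h1 := H x phi (inj x ix) n1 Tp _ re; have h2 := small x phi e ix n2 Tp e0.
  near=> t.
  have t1 : r + e <= scaled_pairing u phi x t by near: t.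
  have t2 : scaled_pairing u phi x t - e <= scaled_pairing w phi x t by near: t.
  lra.
- move=> x phi ix nx Tp.
  have n1 : ~ E x by move=> ?; apply: nx; left.
  have n2 : ~ [set c] x by move=> ?; apply: nx; right.
  have [r h1] := K x phi (inj x ix) n1 Tp; have h2 := small x phi 1 ix n2 Tp.1 ltr01.
  exists (r - 1); near=> t.
  have t1 : r <= scaled_pairing u phi x t by near: t.
  have t2 : scaled_pairing u phi x t - 1 <= scaled_pairing w phi x t by near: t.
  lra.
Unshelve. all: by end_near.
Qed.

End BalancedPrimitive.

(** The arithmetic of [parts_gap]: [m] and [n] are the masses of [u] and [w], [pu], [pw] their
    pairings with [psi], and [iu], [iw] those with the identity. In the last two inequalities [pu]
    and [pw] cancel, which is the integration by parts; what remains beyond multiples of m + n is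
    the distance of m pb from Fb pb, respectively of n pb from - Fb pb. In [K], the term 4 M absorbs
    the multiples of M, and 2 M' (b - a) those of M', through a (m + n) <= iu + iw. *)
Lemma gap_algebra (R : realType) (a b M M' m n e pu pw iu iw Fb pb : R) : a < b -> 0 <= M -> 0 <= M' ->
  0 <= m + n -> m + n <= e -> pu + pw <= M * (m + n) -> - (M * (m + n)) <= pu + pw ->
  a * (m + n) <= iu + iw -> - n <= Fb <= m -> - M <= pb <= M ->
  let K := 4 * M + 2 * M' * (b - a) in
  [/\ M * m + pu + M * n + (M * m + (M * n + pw)) <= K * e,
      m * (M' * b + pb) - (M' * iu + pu) + (n * (M' * b) - M' * iw) +
      (m * (M' * b) - M' * iu + (n * (M' * b + pb) - (M' * iw + pw))) <= K * e,
      M * m + pu + M * n + (m * (M' * b + pb) - (M' * iu + pu) + (n * (M' * b) - M' * iw)) <=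
        Fb * pb + K * e &
      M * m + (M * n + pw) + (m * (M' * b) - M' * iu + (n * (M' * b + pb) - (M' * iw + pw))) <=
        - (Fb * pb) + K * e].
Proof.
move=> ab M0 M'0 d0 de p1 p2 p3 /andP[hb1 hb2] /andP[hp1 hp2] K.
have K0 : 0 <= K by rewrite addr_ge0// ?mulr_ge0// subr_ge0 ltW.
have Ke : K * (m + n) <= K * e by rewrite ler_wpM2l.
have M'ba : 0 <= M' * (b - a) * (m + n) by rewrite !mulr_ge0// subr_ge0 ltW.
have Mmn : 0 <= M * (m + n) by rewrite mulr_ge0.
(* The products of inequalities that linear arithmetic does not form by itself. *)
have q3 : 0 <= M' * (iu + iw - a * (m + n)) by rewrite mulr_ge0// subr_ge0.
have q4 : 0 <= (M - pb) * (m + n) by rewrite mulr_ge0// subr_ge0.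
have q5 : 0 <= (M + pb) * (m + n) by rewrite mulr_ge0//; lra.
have q6 : 0 <= (M - pb) * (m - Fb) by rewrite mulr_ge0// subr_ge0.
have q7 : 0 <= (M + pb) * (n + Fb) by rewrite mulr_ge0//; lra.
have q8 : 0 <= (M - pb) * (n + Fb) by rewrite mulr_ge0//; lra.
have q9 : 0 <= (M + pb) * (m - Fb) by rewrite mulr_ge0//; lra.
have KE : K * (m + n) = 4 * (M * (m + n)) + 2 * (M' * (b - a) * (m + n)) by rewrite /K; ring.
rewrite KE in Ke; move: (K * e) Ke => Z Ke.
split; lra.
Qed.

(** * Majorants of the two integrands and their masses *)

Section IntegrationByParts.
Context {R : realType}.
Local Notation mu := (@lebesgue_measure R).
Variables (a b : R) (f : R -> \bar R) (psi : R -> R).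
Hypotheses (ab : a < b) (If : dist_integrable a b f) (spsi : smooth psi).
Let F x := dist_int a x f.
Implicit Types (u w : (R -> R) -> R) (al : R -> R) (M K e x : R).

Let leab : a <= b := ltW ab.

Let fin_ae := dist_integrable_finite a b f leab If.

(** al u + al w majorizes al (f - f) = 0 almost everywhere, and [mass_ge0] applies. *)
Lemma pairing_sum_ge0 u w al : majorant a b f u -> majorant a b (fun x => - f x)%E w ->
  smooth al -> (forall x, a <= x <= b -> 0 <= al x) -> 0 <= pairing u al + pairing w al.
Proof.
move=> Mu Mw sal al0.
rewrite -(mass_combD a b _ _ _ _ leab sal sal Mu.1 Mw.1); apply: (mass_ge0 a b f _ leab If).
apply: (majorant_comb _ _ _ _ _ _ _ _ _ _ leab sal sal _ Mu Mw fin_ae).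
  by move=> x ix; split; exact: al0.
move=> x ix nf; have fx : f x \is a fin_num by apply/negPn/negP => ?; apply: nf.
exists (fine (f x)), (- fine (f x)); rewrite EFinN !fineK//; split=> //.
by rewrite mulrN subrr.
Qed.

Lemma pairing_sum_le u w al M : majorant a b f u -> majorant a b (fun x => - f x)%E w ->
  smooth al -> (forall x, a <= x <= b -> al x <= M) ->
  pairing u al + pairing w al <= M * (mass u + mass w).
Proof.
move=> Mu Mw sal alM; have sM := smooth_cst M.
have sb : smooth (fun y => (-1) * al y + M) by exact: smoothD _ _ (smoothZ (-1) _ sal) sM.
have pos x : a <= x <= b -> 0 <= -1 * al x + M.
  by move=> ix; rewrite mulN1r addrC subr_ge0; exact: alM.
have := pairing_sum_ge0 u w _ Mu Mw sb pos.
rewrite (pairingL u a b (-1) al _ leab Mu.1.1 sal sM) (pairingL w a b (-1) al _ leab Mw.1.1 sal sM).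
rewrite (pairing_cst a b u _ leab Mu.1.1) (pairing_cst a b w _ leab Mw.1.1).
have E (p q m n k : R) : 0 <= -1 * p + k * m + (-1 * q + k * n) -> p + q <= k * (m + n).
  by rewrite mulrDr; lra.
exact: E.
Qed.

Lemma smooth_bounded al : smooth al -> exists2 M, 0 <= M & forall x, a <= x <= b -> `|al x| <= M.
Proof.
move=> sal; have [M M0 HM] := smooth_local_bound 0 (hull_radius a b) al sal.
by exists M => // x /hull_radius_norm/ltW xr; exact: HM 0%N x (leqnn 0) xr.
Qed.

(** The shift by [M] makes both coefficients nonnegative and cancels in (M + psi) f - M f = f
    psi. *)
Lemma majorant_product u w M : majorant a b f u -> majorant a b (fun x => - f x)%E w ->
  (forall x, a <= x <= b -> `|psi x| <= M) -> exists U W,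
  [/\ majorant a b (fun x => f x * (psi x)%:E)%E U,
      majorant a b (fun x => - (f x * (psi x)%:E))%E W,
      mass U = M * mass u + pairing u psi + M * mass w &
      mass W = M * mass u + (M * mass w + pairing w psi)].
Proof.
move=> Mu Mw HM; have sM := smooth_cst M.
(* The constant is written [M * 1] so that [pairingL] can split it off. *)
have sal : smooth (fun y => M * 1 + psi y) by exact: smoothD _ _ (smooth_cst (M * 1)) spsi.
have M0 : 0 <= M by apply: le_trans (HM a _); rewrite ?lexx.
have al0 x : a <= x <= b -> 0 <= M * 1 + psi x.
  by move=> /HM; rewrite ler_norml => /andP[h _]; lra.
exists (combD (fun y => M * 1 + psi y) (fun=> M) u w), (combD (fun=> M) (fun y => M * 1 + psi y) u w).
split.
- apply: (majorant_comb _ _ _ _ _ _ _ _ _ _ leab sal sM _ Mu Mw fin_ae).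
    by move=> x ix; split=> //; exact: al0.
  move=> x ix nf; have fx : f x \is a fin_num by apply/negPn/negP => ?; apply: nf.
  exists (fine (f x)), (- fine (f x)); rewrite EFinN !fineK//; split=> //.
  by rewrite -{1}(fineK fx) -EFinM lee_fin; lra.
- apply: (majorant_comb _ _ _ _ _ _ _ _ _ _ leab sM sal _ Mu Mw fin_ae).
    by move=> x ix; split=> //; exact: al0.
  move=> x ix nf; have fx : f x \is a fin_num by apply/negPn/negP => ?; apply: nf.
  exists (fine (f x)), (- fine (f x)); rewrite EFinN !fineK//; split=> //.
  by rewrite -{1}(fineK fx) -EFinM -EFinN lee_fin; lra.
- rewrite (mass_combD a b _ _ _ _ leab sal sM Mu.1 Mw.1).
  rewrite (pairingL u a b M _ _ leab Mu.1.1 (smooth_cst 1) spsi).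
  by rewrite (pairing_cst a b w _ leab Mw.1.1).
- rewrite (mass_combD a b _ _ _ _ leab sM sal Mu.1 Mw.1).
  rewrite (pairingL w a b M _ _ leab Mw.1.1 (smooth_cst 1) spsi).
  by rewrite (pairing_cst a b u _ leab Mu.1.1).
Qed.

(** Truncated at [x], the majorants of [f] and of its opposite have the masses [gu] and [gw];
    consistency of [f] on [a, x] puts the integral between. *)
Lemma indefinite_bounds u w gu gw x : majorant a b f u -> majorant a b (fun x => - f x)%E w ->
  a < x <= b -> point_value (primD u) x gu -> point_value (primD w) x gw -> - gw <= F x <= gu.
Proof.
move=> Mu Mw /andP[ax xb] Hu Hw.
have [u' [Mu' <-]] := majorant_truncate a b x f u gu ax xb Mu Hu.
have [w' [Mw' <-]] := majorant_truncate a b x _ w gw ax xb Mw Hw.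
apply: dist_int_bounds (ltW ax) _ Mu' Mw'.
exact: (consistent_fin a b x f f (ltW ax) xb If (fun _ _ => id)).
Qed.

(** M y + psi and M y are antiderivatives of the coefficients M + psi' and M, so
    [pairing_primD_balance] computes the masses; the pairings with [id] come from the term M y. *)
Lemma majorant_primitive u w M : majorant a b f u -> majorant a b (fun x => - f x)%E w ->
  (forall x, a <= x <= b -> `|derive1 psi x| <= M) -> exists U W,
  [/\ majorant a b (fun x => (F x * derive1 psi x)%:E) U,
      majorant a b (fun x => - (F x * derive1 psi x)%:E)%E W,
      mass U = mass u * (M * b + psi b) - (M * pairing u id + pairing u psi) +
        (mass w * (M * b) - M * pairing w id) &
      mass W = mass u * (M * b) - M * pairing u id +
        (mass w * (M * b + psi b) - (M * pairing w id + pairing w psi))].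
Proof.
move=> Mu Mw HM; have sM := smooth_cst M; have sid := @smooth_id R.
have sMid : smooth (fun y => M * y) by exact: smoothZ M _ sid.
have sTh : smooth (fun y => M * y + psi y) by exact: smoothD _ _ sMid spsi.
have dMid : derive1 (fun y => M * y) = fun=> M.
  by rewrite (derive1Z M _ sid) derive1_idfun; apply/funext => y; rewrite mulr1.
have dTh : derive1 (fun y => M * y + psi y) = fun y => M + derive1 psi y.
  by rewrite (derive1D _ _ sMid spsi) dMid.
have sdTh : smooth (fun y => M + derive1 psi y) by rewrite -dTh; exact: smooth_derive1.
have M0 : 0 <= M by apply: le_trans (HM a _); rewrite ?lexx.
have al0 x : a <= x <= b -> 0 <= M + derive1 psi x.
  by move=> /HM; rewrite ler_norml => /andP[h _]; lra.
have [gu Hu] := ex_choice _ Mu.1.2; have [gw Hw] := ex_choice _ Mw.1.2.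
have Pu := majorant_primD_balance a b u gu leab Mu.1 Hu.
have Pw := majorant_primD_balance a b w gw leab Mw.1 Hw.
(* The bounds on [F] come from truncation to a proper interval [a, x], which excludes x = a. *)
have nN : mu.-negligible [set a; b].
  by apply: negligibleU; [exists [set a]|exists [set b]]; split=> //; exact: lebesgue_measure_set1.
have bnd x : a <= x <= b -> ~ [set a; b] x -> - gw x <= F x <= gu x.
  move=> /andP[ax xb] nx; apply: (indefinite_bounds u w _ _ _ Mu Mw _ (Hu x) (Hw x)).
  by rewrite xb andbT lt_neqAle ax andbT; apply/eqP => ax'; apply: nx; left.
exists (combD (fun y => M + derive1 psi y) (fun=> M) (primD (balance b u)) (primD (balance b w))).
exists (combD (fun=> M) (fun y => M + derive1 psi y) (primD (balance b u)) (primD (balance b w))).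
have E1 u' : good a b u' -> pairing (primD (balance b u')) (fun y => M + derive1 psi y) =
    mass u' * (M * b + psi b) - (M * pairing u' id + pairing u' psi).
  move=> gu'; rewrite -dTh (pairing_primD_balance a b u' _ leab gu' sTh); congr (_ - _).
  exact: pairingL u' a b M _ _ leab gu'.1 sid spsi.
have E2 u' : good a b u' -> pairing (primD (balance b u')) (fun=> M) =
    mass u' * (M * b) - M * pairing u' id.
  move=> gu'; rewrite -dMid (pairing_primD_balance a b u' _ leab gu' sMid); congr (_ - _).
  have -> : (fun y => M * y) = (fun y => M * id y + 0) :> (R -> R).
    by apply/funext => y; rewrite addr0.
  rewrite (pairingL u' a b M id _ leab gu'.1 sid (smooth_cst 0)).
  by rewrite (pairing_cst a b u' _ leab gu'.1) mul0r addr0.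
have key (m d p q s : R) : 0 <= m -> 0 <= m + d -> - q <= s <= p -> s * d <= (m + d) * p + m * q.
  move=> m0 md0 /andP[qs sp].
  have h1 : 0 <= (m + d) * (p - s) by rewrite mulr_ge0// subr_ge0.
  have h2 : 0 <= m * (q + s) by rewrite mulr_ge0//; lra.
  lra.
split.
- apply: (majorant_comb _ _ _ _ _ _ _ _ _ _ leab sdTh sM _ Pu Pw nN).
    by move=> x ix; split=> //; exact: al0.
  move=> x ix nx; exists (gu x), (gw x); split=> //.
  rewrite lee_fin; exact: key M0 (al0 x ix) (bnd x ix nx).
- apply: (majorant_comb _ _ _ _ _ _ _ _ _ _ leab sM sdTh _ Pu Pw nN).
    by move=> x ix; split=> //; exact: al0.
  move=> x ix nx; exists (gu x), (gw x); split=> //.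
  rewrite -EFinN lee_fin -mulNr addrC; apply: key M0 (al0 x ix) _.
  by have /andP[h1 h2] := bnd x ix nx; apply/andP; split; lra.
- by rewrite (mass_combD a b _ _ _ _ leab sdTh sM Pu.1 Pw.1) (E1 _ Mu.1) (E2 _ Mw.1).
- by rewrite (mass_combD a b _ _ _ _ leab sM sdTh Pu.1 Pw.1) (E1 _ Mw.1) (E2 _ Mu.1).
Qed.

(* The majorants and minorants of f psi and of F psi' built from a pair u, w of gap d have gaps
   O(d), and the difference of their masses is F(b) psi(b) up to O(d). *)
Lemma parts_gap : exists2 K, 0 <= K & forall e, 0 < e -> exists U W U' W',
  [/\ majorant a b (fun x => f x * (psi x)%:E)%E U,
      majorant a b (fun x => - (f x * (psi x)%:E))%E W,
      majorant a b (fun x => (F x * derive1 psi x)%:E) U',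
      majorant a b (fun x => - (F x * derive1 psi x)%:E)%E W' &
      [/\ mass U + mass W <= K * e, mass U' + mass W' <= K * e,
          mass U + mass U' <= F b * psi b + K * e &
          mass W + mass W' <= - (F b * psi b) + K * e]].
Proof.
have [M M0 HM] := smooth_bounded psi spsi.
have [M' M'0 HM'] := smooth_bounded _ (smooth_derive1 _ spsi).
exists (4 * M + 2 * M' * (b - a)); first by rewrite addr_ge0// ?mulr_ge0// subr_ge0.
move=> e e0; have [u [w [Mu Mw uw]]] := dist_integrable_gap a b f leab If e e0.
have [U [W [MU MW EU EW]]] := majorant_product u w M Mu Mw HM.
have [U' [W' [MU' MW' EU' EW']]] := majorant_primitive u w M' Mu Mw HM'.
exists U, W, U', W'; split=> //.
set m := mass u in uw EU EW EU' EW' *; set n := mass w in uw EU EW EU' EW' *.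
have d0 : 0 <= m + n := pairing_sum_ge0 u w (fun=> 1) Mu Mw (smooth_cst 1) (fun _ _ => ler01).
have p1 := pairing_sum_le u w psi M Mu Mw spsi (fun x ix => le_trans (ler_norm _) (HM x ix)).
have p2 : - (M * (m + n)) <= pairing u psi + pairing w psi.
  have sN := smoothZ (-1) _ spsi; have s0 := smooth_cst (0 : R).
  have h x : a <= x <= b -> -1 * psi x + 0 <= M.
    by move=> /HM; rewrite ler_norml => /andP[h _]; lra.
  have := pairing_sum_le u w _ M Mu Mw (smoothD _ _ sN s0) h.
  rewrite (pairingL u a b (-1) psi _ leab Mu.1.1 spsi s0) (pairingL w a b (-1) psi _ leab Mw.1.1 spsi s0).
  rewrite (pairing_cst a b u _ leab Mu.1.1) (pairing_cst a b w _ leab Mw.1.1) -/m -/n.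
  move: (pairing u psi) (pairing w psi) => p q; lra.
have p3 : a * (m + n) <= pairing u id + pairing w id.
  have sN := smoothZ (-1) _ (@smooth_id R); have s0 := smooth_cst (0 : R).
  have h x : a <= x <= b -> -1 * x + 0 <= - a by move=> /andP[h _]; lra.
  have := pairing_sum_le u w _ (- a) Mu Mw (smoothD _ _ sN s0) h.
  rewrite (pairingL u a b (-1) id _ leab Mu.1.1 (@smooth_id R) s0).
  rewrite (pairingL w a b (-1) id _ leab Mw.1.1 (@smooth_id R) s0).
  rewrite (pairing_cst a b u _ leab Mu.1.1) (pairing_cst a b w _ leab Mw.1.1) -/m -/n.
  move: (pairing u id) (pairing w id) => p q; lra.
have hb0 : - n <= F b <= m.
  exact: dist_int_bounds leab (dist_integrable_consistent a b f leab If) Mu Mw.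
have hpsi := HM b; rewrite leab lexx ler_norml in hpsi; have {}hpsi := hpsi isT.
rewrite EU EW EU' EW'; rewrite -/m -/n in p1.
move: (pairing u psi) (pairing w psi) (pairing u id) (pairing w id) (F b) (psi b)
  p1 p2 p3 hb0 hpsi => pu pw iu iw Fb pb p1 p2 p3 hb0 hpsi.
exact: gap_algebra.
Qed.

End IntegrationByParts.

Theorem theorem7p2 (R : realType) (a b : R) (hab : a < b) (f : R -> \bar R)
    (psi : R -> R) (hf : dist_integrable a b f) (hpsi : smooth psi) :
  let F := fun x : R => dist_int a x f in
  [/\ dist_integrable a b (fun x => (f x * (psi x)%:E)%E),
      dist_integrable a b (fun x => (F x * derive1 psi x)%:E) &
      dist_int a b (fun x => (f x * (psi x)%:E)%E) =
        F b * psi b - dist_int a b (fun x => (F x * derive1 psi x)%:E)].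
Proof.
move=> F; have leab := ltW hab.
have [K K0 gap] := parts_gap a b f psi hab hf hpsi.
(* Both integrands are finite wherever [f] is, so [consistent_fin] applies to each of them. *)
have cp : consistent a b (fun x => (f x * (psi x)%:E)%E).
  by apply: (consistent_fin a b b f _ leab (lexx b) hf) => x _ fx; rewrite fin_numM.
have cq : consistent a b (fun x => (F x * derive1 psi x)%:E).
  by apply: (consistent_fin a b b f _ leab (lexx b) hf).
have small e : 0 < e -> exists2 d, 0 < d & K * d <= e.
  move=> e0; have k0 : 0 < K + 1 by rewrite ltr_wpDl.
  exists (e / (K + 1)); first by rewrite divr_gt0.
  by rewrite mulrCA ler_piMr ?(ltW e0)// ler_pdivrMr// mul1r lerDl.
split.
- apply: gap_dist_integrable leab cp _ => e /small[d d0 Kd].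
  have [U [W [U' [W' [MU MW _ _ [h _ _ _]]]]]] := gap d d0.
  by exists U, W; split=> //; exact: le_trans h Kd.
- apply: gap_dist_integrable leab cq _ => e /small[d d0 Kd].
  have [U [W [U' [W' [_ _ MU MW [_ h _ _]]]]]] := gap d d0.
  by exists U', W'; split=> //; exact: le_trans h Kd.
(* The two integrals are at most the masses of [U] and [U'], and at least the opposites of those of
   [W] and [W']; [h1] and [h2] thus confine their sum to within [K * d] of [F b * psi b]. *)
have H e : 0 < e -> `|dist_int a b (fun x => (f x * (psi x)%:E)%E) -
    (F b * psi b - dist_int a b (fun x => (F x * derive1 psi x)%:E))| <= e.
  move=> /small[d d0 Kd].
  have [U [W [U' [W' [MU MW MU' MW' [_ _ h1 h2]]]]]] := gap d d0.
  have /andP[] := dist_int_bounds a b _ U W leab cp MU MW.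
  have /andP[] := dist_int_bounds a b _ U' W' leab cq MU' MW'.
  rewrite -/(F b) in h1 h2.
  by rewrite ler_norml => *; apply/andP; split; lra.
apply/eqP; rewrite -subr_eq0 -normr_le0; apply/ler_addgt0Pr => e e0.
by rewrite add0r; exact: H.
Qed.
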